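(* Let $A \in \mathbb{R}^{m \times n}$ be a nonzero matrix with effective rank $\rho = \|A\|_F^2/\|A\|_2^2$, let $X_1, X_2$ be independent $\mathcal{N}(0, I_n)$ random vectors, and for $\theta \ge 1$ set $$T^{\mathrm{cb}}(\theta, X) = \theta \sqrt{\left(\frac{\|A^\top A X_1\|_2}{\|A X_1\|_2}\right)^2 + \|A X_2\|_2^2}, \qquad X = (X_1, X_2).$$ Then for any $\theta \geq 1$, $$\mathbb{P}\left(T^{\mathrm{cb}}(\theta,X) \leq \|A\|_2\right) \leq g(\theta,\rho),$$ where $$g(\theta,\rho) = \begin{cases} \theta^{-4}/8, & \rho \ge 7, \\[6pt] \displaystyle\int_0^{\theta^{-2}}\chi_1^2\left(\frac{(\rho - 1) t}{1 - t}\right) p_{(1, \rho - 1)}\left(\theta^{-2} - t\right)dt, & 1 + \theta^{-2} \le \rho \le 7, \\[6pt] \displaystyle\int_0^{\theta^{-2}}\chi_1^2\left(\frac{(\rho - 1) t}{1 - t}\right) p_{(1, 0)}\left(\frac{\theta^{-2} - t}{\rho}\right)dt, & 1 \le \rho < 1 + \theta^{-2}. \end{cases}$$ (At $\rho = 7$, where the first two cases overlap, the inequality is asserted with either expression.)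
   Context: $\|\cdot\|_2$ denotes the Euclidean norm of a vector and the spectral norm of a matrix; $\|\cdot\|_F$ is the Frobenius norm; $I_n$ is the $n \times n$ identity matrix. The ratio $\|A^\top A X_1\|_2/\|A X_1\|_2$ is defined almost surely, since $A X_1 \neq 0$ almost surely. For $\alpha \ge 0$, let $\xi,\eta$ be i.i.d. standard normal $\mathcal{N}(0,1)$ random variables; $\chi^2_{(1,\alpha)}(t) = \mathbb{P}(\xi^2 + \alpha \eta^2 \le t)$ is the cumulative distribution function of $\xi^2 + \alpha\eta^2$ and $p_{(1,\alpha)}(t)$ is the corresponding probability density function. In particular $\chi_1^2(t) = \chi^2_{(1,0)}(t) = \mathbb{P}(\xi^2 \le t)$ is the cumulative distribution function of the chi-squared distribution with one degree of freedom, and $p_{(1,0)}$ is its density. *)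

(* Defs.v *)
From HB Require Import structures.
From mathcomp Require Import all_boot all_order all_algebra.
From mathcomp Require Import all_classical all_reals all_analysis.
From mathcomp Require Import measurable_realfun.

Set Implicit Arguments.
Unset Strict Implicit.
Unset Printing Implicit Defensive.

Import Order.TTheory GRing.Theory Num.Theory.
Import numFieldNormedType.Exports.

Local Open Scope classical_set_scope.
Local Open Scope ring_scope.

Section norms.
Context {R : realType}.

Definition enorm (n : nat) (x : 'cV[R]_n) : R :=
  Num.sqrt (\sum_(i < n) x i 0 ^+ 2).

Definition frobenius (m n : nat) (A : 'M[R]_(m, n)) : R :=
  Num.sqrt (\sum_(i < m) \sum_(j < n) A i j ^+ 2).

(* The operator norm induced by the Euclidean norms. *)
Definition spectral_norm (m n : nat) (A : 'M[R]_(m, n)) : R :=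
  sup [set enorm (A *m x) | x in [set x : 'cV[R]_n | enorm x <= 1]].

Definition effective_rank (m n : nat) (A : 'M[R]_(m, n)) : R :=
  frobenius A ^+ 2 / spectral_norm A ^+ 2.

(* When [A *m x1 = 0] the ratio is [0] (division by zero); for a Gaussian [x1]
   and [A != 0] this happens with probability zero. *)
Definition Tcb (m n : nat) (A : 'M[R]_(m, n)) (theta : R) (x1 x2 : 'cV[R]_n) :
    R :=
  theta * Num.sqrt ((enorm (A^T *m A *m x1) / enorm (A *m x1)) ^+ 2
                    + enorm (A *m x2) ^+ 2).

End norms.

(* Matrices carry no measurable structure in the library, so random vectors are
   random variables with values in [n.-tuple R] (product sigma-algebra). *)
Definition vec {R : realType} (n : nat) (x : n.-tuple R) : 'cV[R]_n :=
  \col_(i < n) tnth x i.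

Section gaussian_vectors.
Context {d : measure_display} {T : measurableType d} {R : realType}.
Variable P : probability T R.

(* X ~ N(0, I_n): the coordinates of X are i.i.d. N(0, 1). *)
Definition std_gaussian_vector (n : nat) (X : {RV P >-> n.-tuple R}) : Prop :=
  forall B : 'I_n -> set R, (forall i, measurable (B i)) ->
    P [set w | forall i, B i (tnth (X w) i)] =
    (\prod_(i < n) normal_prob (0 : R) 1 (B i))%E.

Definition independent_RV (d1 d2 : measure_display) (T1 : measurableType d1)
    (T2 : measurableType d2) (X : {RV P >-> T1}) (Y : {RV P >-> T2}) : Prop :=
  forall (A : set T1) (B : set T2), measurable A -> measurable B ->
    P (X @^-1` A `&` Y @^-1` B) = (P (X @^-1` A) * P (Y @^-1` B))%E.

End gaussian_vectors.

Section generalized_chi2.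
Context {R : realType}.

(* [measurableTypeR R] is [R] with the Borel structure on which [normal_prob]
   and [lebesgue_measure] are defined. *)
Let RB := measurableTypeR R.

(* The law of a pair (xi, eta) of i.i.d. N(0, 1) random variables. *)
Definition std_gaussian_pair : probability (RB * RB)%type R :=
  (normal_prob (0 : R) 1 \x normal_prob (0 : R) 1)%E.

Definition quad_form (alpha : R) (z : RB * RB) : RB :=
  (z.1 : R) ^+ 2 + alpha * (z.2 : R) ^+ 2.

Let measurable_quad_form (alpha : R) : measurable_fun setT (quad_form alpha).
Proof.
have m1 : measurable_fun setT (fst : RB * RB -> R) by exact: measurable_fst.
have m2 : measurable_fun setT (snd : RB * RB -> R) by exact: measurable_snd.
apply: measurable_funD; first exact: measurable_funX m1.
by apply: measurable_funM => //; exact: measurable_funX m2.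
Qed.

HB.instance Definition _ (alpha : R) :=
  isMeasurableFun.Build _ _ _ _ (quad_form alpha) (measurable_quad_form alpha).

(* The law of xi^2 + alpha eta^2. *)
Definition chi2_law (alpha : R) : probability RB R :=
  distribution std_gaussian_pair (quad_form alpha).

Definition chi2_cdf (alpha t : R) : \bar R :=
  std_gaussian_pair [set z | quad_form alpha z <= t].

(* The law is absolutely continuous for [alpha >= 0]; the integrals below do not
   depend on the version of the density. *)
Definition chi2_pdf (alpha : R) : R -> \bar R :=
  Radon_Nikodym (charge_of_finite_measure (chi2_law alpha)) lebesgue_measure.

Definition g_high (theta : R) : R := theta ^- 4 / 8.

(* Lebesgue integrals of an a.e. nonnegative integrand, hence well defined in
   [\bar R]; the integrand at the single point [t = 1] (reached only when
   [theta = 1]) is irrelevant. *)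
Definition g_mid (theta rho : R) : \bar R :=
  (\int[lebesgue_measure]_(t in `[0%R, (theta ^- 2)%R])
     (chi2_cdf 0 ((rho - 1) * t / (1 - t)) *
      chi2_pdf (rho - 1) (theta ^- 2 - t)))%E.

Definition g_low (theta rho : R) : \bar R :=
  (\int[lebesgue_measure]_(t in `[0%R, (theta ^- 2)%R])
     (chi2_cdf 0 ((rho - 1) * t / (1 - t)) *
      chi2_pdf 0 ((theta ^- 2 - t) / rho)))%E.

End generalized_chi2.

(* Main.v *)
From HB Require Import structures.
Require Import Defs.
From mathcomp Require Import all_boot all_order all_algebra.
From mathcomp Require Import all_classical all_reals all_analysis.
From mathcomp Require Import measurable_realfun complex perm ring lra.
Set Implicit Arguments.
Unset Strict Implicit.
Unset Printing Implicit Defensive.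
Import Order.TTheory GRing.Theory Num.Theory.
Import numFieldNormedType.Exports.
Local Open Scope classical_set_scope.
Local Open Scope ring_scope.


(** Diagonalise [A^T *m A] in an orthonormal basis. The standard Gaussian law is
    invariant under rotations, so the coordinates [y_i] of the two Gaussian vectors stay
    independent and standard. Let [l_i] be the eigenvalues divided by the largest one,
    so that [l_0 = 1] and [rho = 1 + r], where [r] is the sum of the other [l_i], and let
    [tau = theta ^- 2]. The event becomes [R1 + Q <= tau], where
    [R1 = (\sum_i l_i ^+ 2 * y_i ^+ 2) / (\sum_i l_i * y_i ^+ 2)] is a function of the
    first vector and [Q = \sum_i l_i * y_i ^+ 2] a function of the second one
    ([Tcb_leE], [Tcb_probability_le]).

    The ratio. Keeping only [y_0] in its numerator, [R1 <= u] implies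
    [y_0 ^+ 2 <= u / (1 - u) * S] for [0 <= u < 1], where [S] is the form in the other
    coordinates. The distribution function of [xi ^+ 2] is concave on the positive
    half-line, so Jensen's inequality allows [S] to be replaced by its mean [r]: the
    ratio [R1] is stochastically at least [R = xi ^+ 2 / (xi ^+ 2 + r)]
    ([qform_ratio_le]). It remains to bound the probability of [R + Q <= tau] for an
    independent [R].

    For [rho >= 7], the event [Q <= tau] alone is rare enough, by Chernoff's bound
    ([high_bound]). For [rho < 1 + tau], use [Q >= y_0 ^+ 2], then replace [y_0 ^+ 2] by
    [rho * y_0 ^+ 2] at the cost of a factor [rho], by concavity again ([low_bound]).

    For [rho >= 1 + tau], condition on [R] and [y_0]. The remaining form, of mean
    [r >= tau], has to be at most some [z < r], and the point is that this is most
    likely, among all forms with a given mean, for the form [r * eta ^+ 2] of rank one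
    ([qform_le_rank1], [mid_bound]). To prove it, move the largest weight [a] and
    another one [b] to [a + b] and 0 along the segment that joins these pairs. Stein's
    identity expresses the derivative of the distribution function along it as [a - b]
    times the slope at [z] of the density of the form increased by an independent
    [a * chi2_2 + b * chi2_2] ([merge_weights]). The slope is nonnegative below the mean
    ([smoothed_slope_ge0]) by the size-bias identity of the form, which is a linear
    integral equation for the slope: since [a] is the largest weight, the convolutions of
    the slope enter it with nonnegative coefficients, and the other terms are
    nonnegative below the mean, so that Gronwall's inequality shows the negative part of
    the slope to vanish. These computations are made with test functions that vanish on
    the negative half-line, on which [expconv] and [sqconv] are the convolutions with the
    exponential law and with the law of [l * xi ^+ 2]; the indicator of a half-line is
    reached at the end.

    The law of [xi ^+ 2 + alpha * eta ^+ 2] has a density ([chi2_law_dominates]), and a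
    reflection of the variable identifies the resulting expectations with the integrals
    of the statement ([integral_chi2_pdf]). *)

(** * The Gaussian density *)

Section gauss.
Context {R : realType}.
Local Notation RB := (measurableTypeR R).
Local Notation mu := (@lebesgue_measure R).
Local Notation gauss := (normal_prob (0 : R) 1).

Lemma normal_pdf01E (x : R) :
  normal_pdf 0 1 x = normal_peak 1 * expR (- x ^+ 2 / 2).
Proof.
by rewrite normal_pdfE ?oner_neq0// /normal_fun subr0 expr1n.
Qed.

Lemma gauss_dominates : gauss `<< mu.
Proof. exact: normal_prob_dominates. Qed.

Lemma gauss_density_ae :
  ae_eq mu setT (Radon_Nikodym (charge_of_finite_measure gauss) mu)
     (fun x => (normal_pdf (0:R) 1 x)%:E).
Proof.
have dom : charge_of_finite_measure gauss `<< mu by exact: gauss_dominates.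
apply: integral_ae_eq => //=.
- exact: Radon_Nikodym_integrable.
- by apply/measurable_EFinP; exact: measurable_normal_pdf.
- by move=> E _ mE; rewrite -Radon_Nikodym_integral.
Qed.

Lemma integral_gauss (f : R -> \bar R) :
  gauss.-integrable setT f ->
  (\int[gauss]_x f x = \int[mu]_x (f x * (normal_pdf 0 1 x)%:E))%E.
Proof.
move=> intf; have mf := measurable_int _ intf.
rewrite -(Radon_Nikodym_change_of_variables gauss_dominates)//=.
have dom : charge_of_finite_measure gauss `<< mu by exact: gauss_dominates.
apply: ae_eq_integral => //.
- apply: emeasurable_funM => //.
- apply: emeasurable_funM => //.
  by apply/measurable_EFinP; exact: measurable_normal_pdf.
- by apply: ae_eqe_mul2l => /=; exact: gauss_density_ae.
Qed.

Lemma ge0_integral_gauss (f : R -> \bar R) :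
  measurable_fun setT f -> (forall x, 0 <= f x)%E ->
  (\int[gauss]_x f x = \int[mu]_x (f x * (normal_pdf 0 1 x)%:E))%E.
Proof.
move=> mf f0.
rewrite -(Radon_Nikodym_SigmaFinite.change_of_variables gauss_dominates)//=.
have dom : charge_of_finite_measure gauss `<< mu by exact: gauss_dominates.
apply: ae_eq_integral => //.
- apply: emeasurable_funM => //.
  apply: measurable_int.
  exact: Radon_Nikodym_SigmaFinite.f_integrable gauss_dominates.
- apply: emeasurable_funM => //.
  by apply/measurable_EFinP; exact: measurable_normal_pdf.
- apply: ae_eqe_mul2l => /=.
  apply: ae_eq_trans gauss_density_ae.
  exact: ae_eq_Radon_Nikodym_SigmaFinite gauss_dominates _ _.
Qed.

End gauss.

(** * Differential equations and exponential convolutions *)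

Section calculus.
Context {R : realType}.
Local Notation mu := (@lebesgue_measure R).
Implicit Types (f g h : R -> R) (x y c w : R).

Lemma is_deriveDf f g x a b : is_derive x 1 f a -> is_derive x 1 g b ->
  is_derive x 1 (fun x => f x + g x) (a + b).
Proof. by move=> fa gb; apply: is_deriveD. Qed.

Lemma is_deriveMf f g x a b : is_derive x 1 f a -> is_derive x 1 g b ->
  is_derive x 1 (fun x => f x * g x) (f x * b + a * g x).
Proof.
move=> fa gb; have := is_deriveM fa gb.
by rewrite /GRing.scale/= [g x * a]mulrC.
Qed.

Lemma is_deriveZf c f x a : is_derive x 1 f a ->
  is_derive x 1 (fun x => c * f x) (c * a).
Proof. by move=> fa; apply: is_deriveZ. Qed.

Lemma is_derive_expRM c x :
  is_derive x 1 (fun x => expR (c * x)) (c * expR (c * x)).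
Proof.
rewrite mulrC.
apply: (@is_derive1_comp _ (@expR R) (fun x => c * x) x).
by rewrite -[X in is_derive _ _ _ X]mulr1; exact: is_deriveZf.
Qed.

Lemma is_derive_continuous f (df : R -> R) :
  (forall x, is_derive x 1 f (df x)) -> continuous f.
Proof.
move=> fd x; apply: differentiable_continuous.
by apply/derivable1_diffP; exact: (@ex_derive _ _ _ _ _ _ _ (fd x)).
Qed.

Lemma ger0_is_derive_le_oo f (df : R -> R) x y :
  (forall x, is_derive x 1 f (df x)) -> (forall z, x < z < y -> 0 <= df z) ->
  x <= y -> f x <= f y.
Proof.
move=> fd df0 xy.
apply: (@ger0_derive1_le_cc _ f x y); rewrite ?bound_itvE//.
- move=> z; rewrite in_itv/= => zxy.
  by rewrite derive1E (@derive_val _ _ _ _ _ _ _ (fd z)) df0.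
- by apply: continuous_subspaceT; exact: is_derive_continuous fd.
Qed.

Lemma ger0_is_derive_le f (df : R -> R) c x y :
  (forall x, is_derive x 1 f (df x)) -> (forall x, x <= c -> 0 <= df x) ->
  x <= y -> y <= c -> f x <= f y.
Proof.
move=> fd df0 xy yc; apply: (ger0_is_derive_le_oo fd) => // z /andP[_ zy].
by rewrite df0// (le_trans (ltW zy)).
Qed.

(** Used for functions vanishing on the negative half-line: the base point is -1, and
    not 0, so that the fundamental theorem of calculus also applies at 0. *)
Definition primitive f x := \int[mu]_(t in `[-1, x]) f t.

Lemma primitive_le0 f x : (forall y, y <= 0 -> f y = 0) -> x <= 0 ->
  primitive f x = 0.
Proof.
move=> f0 x0; rewrite /primitive /Rintegral integral0_eq// => t/=.
by rewrite in_itv/= => /andP[_ tx]; rewrite f0// (le_trans tx).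
Qed.

Lemma is_derive_primitive f x : continuous f -> (forall y, y <= 0 -> f y = 0) ->
  is_derive x 1 (primitive f) (f x).
Proof.
move=> cf f0; have [x0|x0] := ltP x 0.
  have := @is_derive_cst R R R^o 0 x 1; rewrite f0 ?(ltW x0)//.
  apply: near_eq_is_derive; near=> y; rewrite primitive_le0//.
  by near: y; move/lt_nbhsl: x0; apply: filterS => y /ltW.
have intf : mu.-integrable `[-1, x + 1] (EFin \o f).
  apply: continuous_compact_integrable; first exact: segment_compact.
  exact: continuous_subspaceT.
have xx : x < x + 1 by rewrite ltrDl.
have x1 : -1 < x by apply: lt_le_trans x0; rewrite ltrN10.
have [d1 d2] := continuous_FTC1_closed xx intf x1 (cf x).
by rewrite -d2 derive1E; exact: derivableP.
Unshelve. all: end_near. Qed.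

(** Causal signals: the functions convolved below with the laws of the
    nonnegative variables [l * xi ^+ 2]. *)
Definition causal f := continuous f /\ forall x, x <= 0 -> f x = 0.

Lemma causalD f g : causal f -> causal g -> causal (fun x => f x + g x).
Proof.
move=> [cf f0] [cg g0]; split=> [x|x x0]; last by rewrite f0// g0// addr0.
by apply: continuousD; [exact: cf|exact: cg].
Qed.

Lemma causalM f g : continuous f -> causal g -> causal (fun x => f x * g x).
Proof.
move=> cf [cg g0]; split=> [x|x x0]; last by rewrite g0// mulr0.
by apply: continuousM; [exact: cf|exact: cg].
Qed.

Lemma causalZ c f : causal f -> causal (fun x => c * f x).
Proof. by apply: causalM => x; exact: cvg_cst. Qed.

Lemma causalB f g : causal f -> causal g -> causal (fun x => f x - g x).
Proof.
move=> cf cg; have := causalD cf (causalZ (-1) cg).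
by under eq_fun do rewrite mulN1r.
Qed.

Lemma causalX f : causal f -> causal (fun x => x * f x).
Proof. by apply: causalM => x; exact: cvg_id. Qed.

(** Convolution with the exponential law of mean [2 * w], which is the law of
    [w * (xi ^+ 2 + eta ^+ 2)]. *)
Definition expconv w f x :=
  expR (- (2 * w)^-1 * x) *
  ((2 * w)^-1 * primitive (fun y => expR ((2 * w)^-1 * y) * f y) x).

Lemma continuous_expRM c : continuous (fun x => expR (c * x)).
Proof. exact: is_derive_continuous (is_derive_expRM c). Qed.

Lemma is_derive_expconv w f x : causal f ->
  is_derive x 1 (expconv w f) ((2 * w)^-1 * (f x - expconv w f x)).
Proof.
move=> cf; set k := (2 * w)^-1.
have [cf1 cf2] := causalM (@continuous_expRM k) cf.
have /is_derive_eq := is_deriveMf (is_derive_expRM (- k) x)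
  (is_deriveZf k (is_derive_primitive x cf1 cf2)).
rewrite -/(expconv w f); apply.
rewrite /expconv -/k.
have : expR (- k * x) * expR (k * x) = 1 by rewrite -expRD mulNr addNr expR0.
move=> e1; transitivity (k * ((expR (- k * x) * expR (k * x)) * f x
  - expR (- k * x) * (k * primitive (fun y => expR (k * y) * f y) x))).
  by ring.
by rewrite e1 mul1r.
Qed.

Lemma expconv_le0 w f x : causal f -> x <= 0 -> expconv w f x = 0.
Proof.
move=> cf x0; have [_ f0] := causalM (@continuous_expRM (2 * w)^-1) cf.
by rewrite /expconv primitive_le0// !mulr0.
Qed.

Opaque expconv.

Lemma causal_expconv w f : causal f -> causal (expconv w f).
Proof.
move=> cf; split; last by move=> x; exact: expconv_le0.
exact: is_derive_continuous (fun x => @is_derive_expconv w f x cf).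
Qed.

(** Uniqueness for the first-order equation [2 * w * g' = f - g]: every identity
    between these convolutions is checked by differentiating. *)
Lemma expconv_unique w f g : causal f -> (forall x, x <= 0 -> g x = 0) ->
  (forall x, is_derive x 1 g ((2 * w)^-1 * (f x - g x))) -> g = expconv w f.
Proof.
move=> cf g0 dg; set k := (2 * w)^-1.
pose d x := expR (k * x) * (g x + -1 * expconv w f x).
have dd x : is_derive x 1 d 0.
  have /is_derive_eq := is_deriveMf (is_derive_expRM k x)
    (is_deriveDf (dg x) (is_deriveZf (-1) (is_derive_expconv w x cf))).
  by apply; rewrite -/k; ring.
apply/funext => x; have := @is_derive_0_is_cst _ d x 0 dd.
rewrite /d (g0 0)// (@expconv_le0 w f 0)// !(mulr0, addr0) => /eqP.
by rewrite mulf_eq0 gt_eqF ?expR_gt0//= mulN1r subr_eq0 => /eqP.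
Qed.

Lemma expconvD w f g : causal f -> causal g ->
  expconv w (fun x => f x + g x) = (fun x => expconv w f x + expconv w g x).
Proof.
move=> cf cg; symmetry; apply: expconv_unique.
  exact: causalD.
  by move=> x x0; rewrite !expconv_le0// addr0.
move=> x; have /is_derive_eq := is_deriveDf (is_derive_expconv w x cf) (is_derive_expconv w x cg).
by apply; ring.
Qed.

Lemma expconvZ w c f : causal f ->
  expconv w (fun x => c * f x) = (fun x => c * expconv w f x).
Proof.
move=> cf; symmetry; apply: expconv_unique.
  exact: causalZ.
  by move=> x x0; rewrite expconv_le0// mulr0.
move=> x; have /is_derive_eq := is_deriveZf c (is_derive_expconv w x cf).
by apply; ring.
Qed.

Lemma expconvX w f x : w != 0 -> causal f -> x * expconv w f x =
  expconv w (fun x => x * f x) x + 2 * w * expconv w (expconv w f) x.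
Proof.
move=> w0 cf; have cTf := causal_expconv w cf.
have cXf := causalX cf.
have cZ := causalZ (2 * w) cTf.
have E : (fun x => x * expconv w f x) =
    expconv w (fun x => x * f x + 2 * w * expconv w f x).
  apply: expconv_unique; first exact: causalD.
    by move=> y y0; rewrite expconv_le0// mulr0.
  move=> y; have /is_derive_eq :=
    is_deriveMf (is_derive_id y 1) (is_derive_expconv w y cf).
  by apply; field.
by have := congr1 (@^~ x) E; rewrite /= expconvD// expconvZ.
Qed.

(** The resolvent identity, formally [T_b - T_a = (1 - b / a) T_b (1 - T_a)]. *)
Lemma expconv_resolvent a b f x : a != 0 -> b != 0 -> causal f ->
  expconv b f x - expconv a f x =
  (a - b) / a * expconv b (fun y => f y - expconv a f y) x.
Proof.
move=> a0 b0 cf; have cTf := causal_expconv a cf.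
have cd := causalB cf cTf; have cTd := causal_expconv b cd.
pose g y := expconv a f y
   + (a - b) / a * expconv b (fun y => f y - expconv a f y) y.
suff <- : g = expconv b f by rewrite /g; ring.
apply: expconv_unique => //.
  by move=> y y0; rewrite /g !expconv_le0// mulr0 addr0.
move=> y; have /is_derive_eq := is_deriveDf (is_derive_expconv a y cf)
  (is_deriveZf ((a - b) / a) (is_derive_expconv b y cd)).
apply; rewrite /g; set T := expconv b _ y; set U := expconv a _ y.
by field; rewrite a0.
Qed.

Lemma expconv_ge0 w f c x : 0 < w -> causal f ->
  (forall y, y <= c -> 0 <= f y) -> x <= c -> 0 <= expconv w f x.
Proof.
move=> w0 cf f0 xc; have [x0|x0] := leP x 0; first by rewrite expconv_le0.
set k := (2 * w)^-1.
have := @ger0_is_derive_le _ _ c 0 x (fun y =>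
  is_deriveMf (is_derive_expRM k y) (is_derive_expconv w y cf)).
rewrite expconv_le0// mulr0 pmulr_rge0 ?expR_gt0//; apply => //; last exact: ltW.
move=> y yc; rewrite -/k.
rewrite (_ : _ + _ = k * expR (k * y) * f y); last by ring.
by rewrite mulr_ge0 ?f0// mulr_ge0 ?expR_ge0// invr_ge0 mulr_ge0// ltW.
Qed.

Lemma expconv_vanish w f c x : 0 < w -> causal f ->
  (forall y, y <= c -> f y = 0) -> x <= c -> expconv w f x = 0.
Proof.
move=> w0 cf f0 xc; apply/eqP; rewrite eq_le; apply/andP; split; last first.
  by apply: expconv_ge0 xc => // y /f0 ->.
rewrite -oppr_ge0 -mulN1r -[_ * _](congr1 (@^~ x) (expconvZ w (-1) cf)).
apply: (expconv_ge0 w0 _ _ xc); first exact: causalZ.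
by move=> y /f0 ->; rewrite mulr0.
Qed.

End calculus.

(** * Convolution with the law of [l * xi ^+ 2] *)

Section expectation.
Context d (T : measurableType d) (R : realType) (P : probability T R).

Lemma bounded_integrable (f : T -> R) (M : R) :
  measurable_fun setT f -> (forall x, `|f x| <= M) ->
  P.-integrable setT (EFin \o f).
Proof.
move=> mf fM; apply: measurable_bounded_integrable => //=.
  by rewrite probability_setT ltry.
exists M; split; first by rewrite num_real.
by move=> y My x _; apply: (le_trans (fM x)); exact: ltW.
Qed.

Lemma is_derive_expectation (f df : R -> T -> R) (a u v : R) (G : T -> R) :
  u < a < v ->
  (forall x, u < x < v -> P.-integrable setT (EFin \o f x)) ->
  (forall (x : R) y, is_derive x 1 (f ^~ y) (df x y)) ->
  (forall y, 0 <= G y) -> P.-integrable setT (EFin \o G) ->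
  (forall x y, u < x < v -> `|df x y| <= G y) ->
  is_derive a 1 (fun x => \int[P]_y f x y) (\int[P]_y df a y).
Proof.
move=> ua fi fd G0 Gi dG.
have Iin x : `]u, v[%classic x -> u < x < v by rewrite /= in_itv.
have Ia : `]u, v[%classic a by rewrite /= in_itv.
have dE x y : partial1of2 f x y = df x y.
  by rewrite partial1of2E (@derive_val _ _ _ _ _ _ _ (fd x y)).
have fdI x y : `]u, v[%classic x -> setT y -> derivable (f ^~ y) x 1.
  by move=> _ _; have ? := fd x y; exact: ex_derive.
have fiI x (Ix : `]u, v[%classic x) := fi x (Iin x Ix).
have bG x y : `]u, v[%classic x -> setT y -> `|partial1of2 f x y| <= G y.
  by move=> Ix _; rewrite dE dG// Iin.
apply: DeriveDef.
  exact: (derivable_under_integral measurableT Ia fiI fdI G0 Gi bG).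
rewrite -derive1E (differentiation_under_integral measurableT Ia fiI fdI G0 Gi bG).
by apply: eq_Rintegral => y _; exact: dE.
Qed.

End expectation.

Section sqconv.
Context {R : realType}.
Local Notation mu := (@lebesgue_measure R).
Local Notation gauss := (normal_prob (0 : R) 1).
Implicit Types (f g h : R -> R) (x y c l w : R).

Lemma causal_bounded f x : causal f ->
  exists2 M : R, 0 <= M & forall z, z <= x -> `|f z| <= M.
Proof.
move=> [cf f0]; have x0 : 0 <= `|x| by [].
have [|c _ cmax] := @EVT_max R (fun z => `|f z|) 0 `|x| x0.
  apply: continuous_subspaceT => z; apply: continuous_comp; first exact: cf.
  exact: norm_continuous.
exists `|f c| => // z zx; have [z0|z0] := leP z 0; first by rewrite f0 ?normr0.
by apply: cmax; rewrite in_itv/= ltW//= (le_trans zx)// ler_norm.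
Qed.

(** Convolution with the law of [l * xi ^+ 2]. *)
Definition sqconv l f x := \int[gauss]_y f (x - l * y ^+ 2).

Lemma continuous_sq_arg x l : continuous (fun y : R => x - l * y ^+ 2).
Proof.
move=> y; apply: (@cvgB _ R^o); first exact: cvg_cst.
by apply: cvgM; [exact: cvg_cst|exact: exprn_continuous].
Qed.

Lemma continuous_sqconv_arg f x l : continuous f ->
  continuous (fun y : R => f (x - l * y ^+ 2)).
Proof.
by move=> cf y; apply: continuous_comp; [exact: continuous_sq_arg|exact: cf].
Qed.

Lemma sq_arg_le x l y : 0 <= l -> x - l * y ^+ 2 <= x.
Proof. by move=> l0; rewrite lerBlDr lerDl mulr_ge0// sqr_ge0. Qed.

Lemma integrable_sqconv f x l : 0 <= l -> causal f ->
  gauss.-integrable setT (EFin \o (fun y : R => f (x - l * y ^+ 2))).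
Proof.
move=> l0 cf; have [M _ fM] := causal_bounded x cf.
apply: (@bounded_integrable _ _ _ _ _ M) => [|y].
  by apply: continuous_measurable_fun => y; apply: continuous_sqconv_arg; case: cf.
by apply: fM; exact: sq_arg_le.
Qed.

Lemma sqconvD l f g : 0 <= l -> causal f -> causal g ->
  sqconv l (fun x => f x + g x) = (fun x => sqconv l f x + sqconv l g x).
Proof.
move=> l0 cf cg; apply/funext => x.
by rewrite /sqconv RintegralD//; exact: integrable_sqconv.
Qed.

Lemma sqconvZ l c f : 0 <= l -> causal f ->
  sqconv l (fun x => c * f x) = (fun x => c * sqconv l f x).
Proof.
move=> l0 cf; apply/funext => x.
by rewrite /sqconv RintegralZl//; exact: integrable_sqconv.
Qed.

Lemma sqconv_ge0 l f c x : 0 <= l -> (forall y, y <= c -> 0 <= f y) ->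
  x <= c -> 0 <= sqconv l f x.
Proof.
move=> l0 f0 xc; apply: Rintegral_ge0 => y _; apply: f0.
by apply: le_trans xc; exact: sq_arg_le.
Qed.

Lemma sqconv_vanish l f c x : 0 <= l -> (forall y, y <= c -> f y = 0) ->
  x <= c -> sqconv l f x = 0.
Proof.
move=> l0 f0 xc; rewrite /sqconv /Rintegral integral0_eq// => y _ /=.
by rewrite f0// (le_trans _ xc)// sq_arg_le.
Qed.

Lemma causal_sqconv l f : 0 <= l -> causal f -> causal (sqconv l f).
Proof.
move=> l0 cf; split=> [x|x x0]; last exact: (sqconv_vanish _ cf.2 x0).
have [M _ fM] := causal_bounded (x + 1) cf.
apply: (@continuity_under_integral _ _ _ gauss (fun x y => f (x - l * y ^+ 2))
  setT measurableT (x - 1) (x + 1) _ _ (cst M)) => //.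
- by move=> y _; exact: integrable_sqconv.
- apply: aeW => y _ z _.
  apply: (@continuous_comp _ _ _ (fun z => z - l * y ^+ 2) f z); last exact: cf.1.
  by apply: (@cvgB _ R^o); [exact: cvg_id|exact: cvg_cst].
- exact: finite_measure_integrable_cst.
- move=> y; rewrite /= in_itv/= => /andP[_ yx]; apply: aeW => z _.
  by apply: fM; rewrite (le_trans _ (ltW yx))// sq_arg_le.
- by rewrite inE/= in_itv/=; apply/andP; split; lra.
Qed.

Lemma is_derive_shift_arg f (df : R -> R) x a :
  (forall x, is_derive x 1 f (df x)) ->
  is_derive x 1 (fun x => f (x - a)) (df (x - a)).
Proof.
move=> fd; rewrite -[X in is_derive _ _ _ X]mulr1.
apply: (@is_derive1_comp _ f (fun x => x - a)).
have /is_derive_eq := is_deriveDf (is_derive_id x 1) (is_derive_cst (- a : R^o) x 1).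
by apply; rewrite addr0.
Qed.

Lemma is_derive_sqconv l f df x : 0 <= l -> causal f -> causal df ->
  (forall x, is_derive x 1 f (df x)) ->
  is_derive x 1 (sqconv l f) (sqconv l df x).
Proof.
move=> l0 cf cdf fd; have [M M0 dM] := causal_bounded (x + 1) cdf.
apply: (@is_derive_expectation _ _ _ gauss (fun x y => f (x - l * y ^+ 2))
  (fun x y => df (x - l * y ^+ 2)) x (x - 1) (x + 1) (cst M)) => //.
- by apply/andP; split; lra.
- by move=> y _; exact: integrable_sqconv.
- by move=> y z; exact: is_derive_shift_arg.
- exact: finite_measure_integrable_cst.
- move=> y z /andP[_ yx]; apply: dM.
  by rewrite (le_trans _ (ltW yx))// sq_arg_le.
Qed.

Lemma sqconvB l f g : 0 <= l -> causal f -> causal g ->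
  sqconv l (fun x => f x - g x) = (fun x => sqconv l f x - sqconv l g x).
Proof.
move=> l0 cf cg; apply/funext => x.
by rewrite /sqconv RintegralB//; exact: integrable_sqconv.
Qed.

(** The two convolutions commute: both sides solve the differential equation that
    characterises [expconv w (sqconv l f)], so no double integral is needed. *)
Lemma sqconv_expconv l w f : 0 <= l -> causal f ->
  sqconv l (expconv w f) = expconv w (sqconv l f).
Proof.
move=> l0 cf; have cT := causal_expconv w cf.
apply: expconv_unique; first exact: causal_sqconv.
  by move=> x x0; exact: (causal_sqconv l0 cT).2.
move=> x; have cd := causalZ (2 * w)^-1 (causalB cf cT).
have := is_derive_sqconv x l0 cT cd (fun y => is_derive_expconv w y cf).
by rewrite sqconvZ ?sqconvB//; exact: causalB.
Qed.

End sqconv.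

(** * Gaussian integration by parts *)

Section stein.
Context {R : realType}.
Local Notation mu := (@lebesgue_measure R).
Local Notation gauss := (normal_prob (0 : R) 1).
Implicit Types (f g h : R -> R) (x y c l w : R).

(* Beyond this radius [x - l * y ^+ 2 <= 0], hence causal integrands vanish. *)
Local Notation radius x l := (1 + `|x| / l).

Lemma radius_gt x l y : 0 < l -> radius x l <= `|y| -> x - l * y ^+ 2 <= 0.
Proof.
move=> l0 Ly; have xl : 0 <= `|x| / l by rewrite divr_ge0// ltW.
have y2 : radius x l <= y ^+ 2.
  rewrite -real_normK ?num_real// (le_trans Ly)// ler_eXnr//.
  by rewrite (le_trans _ Ly)// lerDl.
rewrite subr_le0 (le_trans (ler_norm x))// -ler_pdivrMl// mulrC.
by rewrite (le_trans _ y2)// lerDr.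
Qed.

Lemma integrable_sq_sqconv f x l : 0 < l -> causal f ->
  gauss.-integrable setT (EFin \o (fun y : R => y ^+ 2 * f (x - l * y ^+ 2))).
Proof.
move=> l0 cf; have [M M0 fM] := causal_bounded x cf.
apply: (@bounded_integrable _ _ R gauss _ (radius x l ^+ 2 * M)) => [|y].
  apply: continuous_measurable_fun => y; apply: cvgM.
    exact: exprn_continuous.
  exact: (continuous_sqconv_arg cf.1).
have [yL|yL] := leP (radius x l) `|y|.
  rewrite cf.2 ?radius_gt// mulr0 normr0 mulr_ge0// exprn_ge0//.
  by rewrite addr_ge0// divr_ge0// ltW.
rewrite normrM normrX ler_pM// ?exprn_ge0//.
  by rewrite lerXn2r ?nnegrE// ltW// (le_lt_trans _ yL).
by apply: fM; exact/sq_arg_le/ltW.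
Qed.

(** The integral of an exact derivative; compact support replaces boundary terms. *)
Lemma integral_gauss_derivative (K k : R -> R) (L : R) : 0 < L ->
  (forall y, is_derive y 1 K (k y * normal_pdf 0 1 y)) ->
  continuous k -> (forall y, L <= `|y| -> K y = 0 /\ k y = 0) ->
  gauss.-integrable setT (EFin \o k) -> \int[gauss]_y k y = 0.
Proof.
move=> L0 dK ck KL ki; rewrite /Rintegral (integral_gauss ki)/=.
have E y : ~ `[- L, L]%classic y -> L <= `|y|.
  move=> /=; rewrite in_itv/= => /negP; rewrite negb_and -!ltNge => /orP[yL|yL].
    by rewrite -normrN (le_trans _ (ler_norm _))// lerNr ltW.
  by rewrite (le_trans _ (ler_norm _))// ltW.
rewrite (_ : integral _ _ _ =
    \int[mu]_(y in `[(- L)%R, L%R]) (k y * normal_pdf 0 1 y)%R%:E)%E; last first.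
  rewrite [RHS]integral_mkcond/=; apply: eq_integral => y _.
  rewrite patchE; case: ifPn => // /negP; rewrite inE => /E /KL[_ ->].
  by rewrite mul0e.
rewrite (@continuous_FTC2 _ _ K (- L) L).
- rewrite (KL L _).1 ?ler_norm// (KL (- L) _).1 ?normrN ?ler_norm//.
  by rewrite subee.
- by lra.
- apply: continuous_subspaceT => y; apply: cvgM; first exact: ck.
  by apply: continuous_normal_pdf; rewrite oner_neq0.
- have cK := is_derive_continuous dK.
  split; first by move=> y _; have := dK y => ?; exact: ex_derive.
    by apply: cvg_at_right_filter; exact: cK.
  by apply: cvg_at_left_filter; exact: cK.
- by move=> y _; rewrite derive1E (@derive_val _ _ _ _ _ _ _ (dK y)).
Qed.

Lemma is_derive_normal_pdf y :
  is_derive y 1 (normal_pdf 0 1 : R -> R) (- y * normal_pdf 0 1 y).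
Proof.
rewrite (_ : normal_pdf 0 1 = fun z => normal_peak 1 * expR (- z ^+ 2 / 2));
  last by apply/funext => z; rewrite normal_pdf01E.
have dsq : is_derive y 1 (fun z : R => - z ^+ 2 / 2) (- y).
  rewrite (_ : (fun z : R => _) = (fun z : R => (- 2^-1) * (z * z))).
    have /is_derive_eq := is_deriveZf (- 2^-1)
      (is_deriveMf (is_derive_id y 1) (is_derive_id y 1)).
    by apply; field.
  by apply/funext => z; field.
have /is_derive_eq := is_deriveZf (normal_peak 1)
  (@is_derive1_comp _ (@expR R) _ y _ _ (is_derive_expR _) dsq).
by apply; ring.
Qed.

(** Gaussian integration by parts: [y * G (x - l * y ^+ 2)], with [G] the
    exponential convolution of [f], is the vector field whose Gaussian divergence
    is [G - y ^+ 2 * f]. This is the size-bias identity for [xi ^+ 2]. *)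
Lemma stein_sqconv l f x : 0 < l -> causal f ->
  \int[gauss]_y (y ^+ 2 * f (x - l * y ^+ 2)) = sqconv l (expconv l f) x.
Proof.
move=> l0 cf; set G := expconv l f; have cG : causal G by exact: causal_expconv.
apply/esym/eqP; rewrite -subr_eq0 -RintegralB//; last 2 first.
- exact: (integrable_sqconv x (ltW l0) cG).
- exact: (integrable_sq_sqconv x l0 cf).
apply/eqP; apply: (@integral_gauss_derivative
  (fun y => (y * G (x - l * y ^+ 2)) * normal_pdf 0 1 y) _ (radius x l)).
- by rewrite ltr_wpDr// divr_ge0// ltW.
- move=> y.
  have dsq : is_derive y 1 (fun z : R => x - l * z ^+ 2) (- 2 * l * y).
    rewrite (_ : (fun z : R => _) = (fun z : R => x + (- l) * (z * z))).
      have /is_derive_eq := is_deriveDf (is_derive_cst (x : R^o) y 1)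
        (is_deriveZf (- l) (is_deriveMf (is_derive_id y 1) (is_derive_id y 1))).
      by apply; ring.
    by apply/funext => z; ring.
  have /is_derive_eq := is_deriveMf (is_deriveMf (is_derive_id y 1)
    (@is_derive1_comp _ G _ y _ _ (is_derive_expconv l _ cf) dsq))
    (is_derive_normal_pdf y).
  by apply; rewrite -/G /comp /=; field; rewrite gt_eqF.
- move=> y; apply: (@cvgB _ R^o); first exact: (continuous_sqconv_arg cG.1).
  apply: cvgM; first exact: exprn_continuous.
  exact: (continuous_sqconv_arg cf.1).
- move=> y /(radius_gt l0) xy; rewrite cG.2// cf.2//.
  by rewrite !mulr0 mul0r subr0.
- have := integrableB measurableT (integrable_sqconv x (ltW l0) cG)
    (integrable_sq_sqconv x l0 cf).
  by [].
Qed.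

(** Writing [x] as [(x - l * y ^+ 2) + l * y ^+ 2] under the integral. *)
Lemma sqconvX l f x : 0 <= l -> causal f -> x * sqconv l f x =
  sqconv l (fun x => x * f x) x + l * sqconv l (expconv l f) x.
Proof.
rewrite le_eqVlt => /predU1P[<- cf|l0 cf].
  rewrite mul0r addr0 /sqconv -RintegralZl//; last first.
    exact: integrable_sqconv.
  by apply: eq_Rintegral => y _; rewrite mul0r subr0.
rewrite -stein_sqconv// -RintegralZl//; last exact: integrable_sq_sqconv.
rewrite /sqconv -RintegralZl//; last exact: integrable_sqconv (ltW l0) cf.
rewrite -RintegralD//.
- by apply: eq_Rintegral => y _; ring.
- exact: (integrable_sqconv x (ltW l0) (causalX cf)).
- have := integrableZl measurableT l (integrable_sq_sqconv x l0 cf).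
  by [].
Qed.

End stein.

(** * Slope of the density of a Gaussian quadratic form *)

Section sqconvs.
Context {R : realType}.
Implicit Types (f g h : R -> R) (x y c l w a b e : R) (ls : seq R).

(** Convolution with the law of [\sum_(l <- ls) l * xi_l ^+ 2], the [xi_l] being
    independent standard Gaussian. *)
Definition sqconvs ls f := foldr sqconv f ls.

Local Notation nonneg ls := (all (fun l => 0 <= l) ls).

Lemma causal_sqconvs ls f : nonneg ls -> causal f -> causal (sqconvs ls f).
Proof.
by move=> + cf; elim: ls => //= l ls IH /andP[l0 /IH]; exact: causal_sqconv.
Qed.

Lemma sqconvsD ls f g : nonneg ls -> causal f -> causal g ->
  sqconvs ls (fun x => f x + g x) = (fun x => sqconvs ls f x + sqconvs ls g x).
Proof.
move=> + cf cg; elim: ls => //= l ls IH /andP[l0 ls0].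
by rewrite IH// sqconvD//; exact: causal_sqconvs.
Qed.

Lemma sqconvsZ ls c f : nonneg ls -> causal f ->
  sqconvs ls (fun x => c * f x) = (fun x => c * sqconvs ls f x).
Proof.
move=> + cf; elim: ls => //= l ls IH /andP[l0 ls0].
by rewrite IH// sqconvZ//; exact: causal_sqconvs.
Qed.

Lemma sqconvs_ge0 ls f c x : nonneg ls -> (forall y, y <= c -> 0 <= f y) ->
  x <= c -> 0 <= sqconvs ls f x.
Proof.
move=> + f0; elim: ls x => //= [x _|l ls IH x /andP[l0 ls0]]; first exact: f0.
by apply: sqconv_ge0 => // y; exact: IH.
Qed.

Lemma sqconvs_vanish ls f c x : nonneg ls -> (forall y, y <= c -> f y = 0) ->
  x <= c -> sqconvs ls f x = 0.
Proof.
move=> + f0; elim: ls x => //= [x _|l ls IH x /andP[l0 ls0]]; first exact: f0.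
by apply: sqconv_vanish => // y; exact: IH.
Qed.

Lemma sqconvs_expconv ls w f : nonneg ls -> causal f ->
  sqconvs ls (expconv w f) = expconv w (sqconvs ls f).
Proof.
move=> + cf; elim: ls => //= l ls IH /andP[l0 ls0].
by rewrite IH// sqconv_expconv//; exact: causal_sqconvs.
Qed.

Lemma causal_sum ls (F : R -> R -> R) : (forall l, causal (F l)) ->
  causal (fun x => \sum_(l <- ls) F l x).
Proof.
move=> cF; elim: ls => [|l ls IH].
  under eq_fun do rewrite big_nil.
  by split=> // x; exact: cvg_cst.
by under eq_fun do rewrite big_cons; exact: causalD.
Qed.

Lemma sqconv_sum l ls (F : R -> R -> R) : 0 <= l -> (forall l, causal (F l)) ->
  sqconv l (fun x => \sum_(k <- ls) F k x) =
  (fun x => \sum_(k <- ls) sqconv l (F k) x).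
Proof.
move=> l0 cF; elim: ls => [|k ls IH].
  apply/funext => x; rewrite big_nil; apply: (@sqconv_vanish _ _ _ x) => // y _.
  by rewrite big_nil.
under eq_fun do rewrite big_cons.
rewrite sqconvD//; last exact: causal_sum.
by rewrite IH; apply/funext => x; rewrite big_cons.
Qed.

(** Size-bias identity for the form [Z] with weights [ls]: the law of [Z] biased by its
    own size is a mixture, with coefficients [l], of the laws of [Z] plus an independent
    exponential variable of mean [2 * l]. *)
Lemma sqconvsX ls f x : nonneg ls -> causal f -> x * sqconvs ls f x =
  sqconvs ls (fun x => x * f x) x +
  \sum_(l <- ls) l * expconv l (sqconvs ls f) x.
Proof.
move=> + cf; elim: ls x => [x _|l ls IH x /= /andP[l0 ls0]].
  by rewrite big_nil addr0.
set g := sqconvs ls f in IH *; have cg : causal g by exact: causal_sqconvs.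
have cTg k : causal (fun x => k * expconv k g x).
  by apply: causalZ; exact: causal_expconv.
rewrite sqconvX// big_cons -sqconv_expconv//.
rewrite (_ : (fun x => x * g x) = fun x => sqconvs ls (fun x => x * f x) x +
    \sum_(k <- ls) k * expconv k g x); last by apply/funext => y; exact: IH.
rewrite sqconvD//; last 2 first.
- exact/causal_sqconvs/causalX.
- exact: (causal_sum _ cTg).
rewrite (sqconv_sum _ l0 cTg) -addrA; congr (_ + _).
rewrite addrC; congr (_ + _); apply: eq_bigr => k _.
by rewrite sqconvZ ?sqconv_expconv//; exact: causal_expconv.
Qed.

End sqconvs.

Notation nonneg ls := (all (fun l => 0 <= l) ls).

Section mode.
Context {R : realType}.
Variables (ls : seq R) (a b e : R) (f : R -> R).
Hypotheses (b0 : 0 < b) (ba : b <= a) (ls0 : nonneg ls)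
  (lsa : all (fun l => l <= a) ls).
Hypotheses (cf : causal f) (f0 : forall x, 0 <= f x).
Hypotheses (e0 : 0 < e) (fe : forall x, x <= e -> f x = 0).

Let a0 : 0 < a. Proof. exact: lt_le_trans ba. Qed.

Let Pb := sqconvs ls (expconv b f).
Let P := expconv a Pb.

(** [smoothed_slope] is the derivative of the density (smoothed by [f]) of
    [a * chi2_2 + b * chi2_2 + \sum_(l <- ls) l * chi2_1], written without
    derivative thanks to the equation satisfied by [expconv a]. *)
Definition smoothed_slope x := (2 * a)^-1 * (Pb x - P x).
Local Notation q := smoothed_slope.

Let cTf : causal (expconv b f). Proof. exact: causal_expconv. Qed.
Let cPb : causal Pb. Proof. exact: causal_sqconvs. Qed.
Let cP : causal P. Proof. exact: causal_expconv. Qed.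
Let cq : causal q. Proof. exact/causalZ/causalB. Qed.

Let E := 2 * b + \sum_(l <- ls) l.

Let is_derive_P (x : R) : is_derive x 1 P (q x).
Proof. exact: is_derive_expconv. Qed.

Let qe x : x <= e -> q x = 0.
Proof.
move=> xe; have Te y : y <= e -> expconv b f y = 0.
  exact: (expconv_vanish b0 cf fe).
have Pbe y : y <= e -> Pb y = 0 by exact: sqconvs_vanish.
by rewrite /q Pbe// /P (expconv_vanish a0 cPb Pbe)// subrr mulr0.
Qed.

Let ls_sum_ge0 : 0 <= \sum_(l <- ls) l.
Proof.
by rewrite big_seq sumr_ge0// => l lls; exact: (allP ls0).
Qed.

(* The resolvent identity trades every exponential convolution of [Pb] for [P] and a
   convolution of the slope, with a coefficient whose sign is that of [a - l]. *)
Let expconvPb l x : l != 0 -> expconv l Pb x = P x + 2 * (a - l) * expconv l q x.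
Proof.
move=> l0; have := expconv_resolvent x (lt0r_neq0 a0) l0 cPb.
have -> : (fun y => Pb y - expconv a Pb y) = (fun y => 2 * a * q y).
  by apply/funext => y; rewrite /q -/P; field; rewrite lt0r_neq0.
rewrite expconvZ// => /eqP; rewrite subr_eq => /eqP ->; rewrite -/P.
by field; rewrite lt0r_neq0.
Qed.

(* The size-bias identity for [Pb], solved for the slope: the coefficients of the
   convolutions of [q] are nonnegative as [a] is the largest weight, and that of [P]
   is nonnegative up to [E], the mean of the variable whose law [Pb] smooths. *)
Let slope_equation x : 2 * a * (x * q x) =
  sqconvs ls (expconv b (fun x => x * f x)) x + (E - x) * P x +
  (4 * b * (a - b) * expconv b q x +
   \sum_(l <- ls) 2 * l * (a - l) * expconv l q x).
Proof.
have := sqconvsX x ls0 cTf; rewrite -/Pb.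
have -> : (fun x => x * expconv b f x) = (fun x =>
    expconv b (fun x => x * f x) x + 2 * b * expconv b (expconv b f) x).
  by apply/funext => y; rewrite expconvX// lt0r_neq0.
have cXf := causalX cf.
have c1 := causal_expconv b cXf; have c2 := causal_expconv b cTf.
rewrite sqconvsD//; last exact: causalZ.
rewrite sqconvsZ// (sqconvs_expconv b ls0 cTf) -/Pb expconvPb ?lt0r_neq0//.
have -> : \sum_(l <- ls) l * expconv l Pb x =
    (\sum_(l <- ls) l) * P x + \sum_(l <- ls) 2 * l * (a - l) * expconv l q x.
  rewrite mulr_suml -big_split/=; apply: eq_bigr => l _.
  have [->|l0] := eqVneq l 0; first by rewrite !(mulr0, mul0r) addr0.
  by rewrite expconvPb//; ring.
have -> : Pb x = P x + 2 * a * q x by rewrite /q; field; rewrite lt0r_neq0.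
by rewrite mulrDr => H; rewrite /E; lra.
Qed.

(* Gronwall's inequality will show that [N], the negative part of the slope, is at most
   a multiple of its own primitive [J], hence 0. *)
Let N x := Num.max (- q x) 0.
Let J := primitive N.

Let N0 x : 0 <= N x. Proof. by rewrite /N le_max lexx orbT. Qed.

Let cN : causal N.
Proof.
split=> [x|x x0]; last by rewrite /N cq.2// oppr0 maxxx.
apply: (@continuous_max _ _ (fun x => - q x) (fun=> 0)); last exact: cvg_cst.
by apply: (@cvgN _ R^o); exact: cq.1.
Qed.

Let dJ (x : R) : is_derive x 1 J (N x).
Proof. by apply: is_derive_primitive; case: cN. Qed.

Let J_le x y : x <= y -> J x <= J y.
Proof. by move=> xy; exact: (ger0_is_derive_le dJ (fun z _ => N0 z) xy (lexx y)). Qed.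

Let J_le0 x : x <= 0 -> J x = 0.
Proof. by move=> x0; apply: primitive_le0 => //; case: cN. Qed.

Let J0 x : 0 <= J x.
Proof.
have [x0|x0] := leP x 0; first by rewrite J_le0.
by rewrite -(J_le0 (lexx 0)) J_le// ltW.
Qed.

Let PJ_ge0 x : 0 <= P x + J x.
Proof.
have [x0|x0] := leP x 0; first by rewrite cP.2// J_le0// addr0.
have := @ger0_is_derive_le _ (fun x => P x + J x) _ x 0 x
  (fun z => is_deriveDf (is_derive_P z) (dJ z)) _ (ltW x0) (lexx x).
rewrite cP.2// J_le0// addr0; apply => y _.
by rewrite -lerBlDl sub0r /N le_max lexx.
Qed.

Let expconvJ_ge0 w x : 0 < w -> 0 <= 2 * w * expconv w q x + J x.
Proof.
move=> w0; have [x0|x0] := leP x 0.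
  by rewrite (causal_expconv w cq).2// J_le0// mulr0 addr0.
set k := (2 * w)^-1; have k0 : 0 < k by rewrite invr_gt0 mulr_gt0.
have := @ger0_is_derive_le _ _ _ x 0 x (fun z => is_deriveMf (is_derive_expRM k z)
  (is_deriveDf (is_derive_expconv w z cq) (is_deriveZf k (dJ z)))) _
  (ltW x0) (lexx x).
rewrite (causal_expconv w cq).2// J_le0// mulr0 addr0 mulr0.
rewrite pmulr_rge0 ?expR_gt0// => H.
have {}H : 0 <= expconv w q x + k * J x.
  apply: H => y _; rewrite -/k.
  rewrite (_ : _ + _ = k * expR (k * y) * ((q y + N y) + k * J y)); last by ring.
  rewrite mulr_ge0//; first by rewrite mulr_ge0 ?expR_ge0// ltW.
  rewrite addr_ge0//; first by rewrite -lerBlDl sub0r /N le_max lexx.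
  by rewrite mulr_ge0// ltW.
rewrite (_ : _ + _ = 2 * w * (expconv w q x + k * J x)).
  by rewrite mulr_ge0// mulr_ge0// ltW.
by rewrite /k; field; rewrite lt0r_neq0.
Qed.

Let C := E + 2 * (a - b) + \sum_(l <- ls) (a - l).

Let E0 : 0 <= E. Proof. by rewrite addr_ge0// mulr_ge0// ltW. Qed.

Let sum_a_ge0 : 0 <= \sum_(l <- ls) (a - l).
Proof.
by rewrite big_seq sumr_ge0// => l lls; rewrite subr_ge0; exact: (allP lsa).
Qed.

Let C0 : 0 <= C.
Proof.
have ab : 0 <= 2 * (a - b) by rewrite mulr_ge0// subr_ge0.
exact: addr_ge0 (addr_ge0 E0 ab) sum_a_ge0.
Qed.

Let slope_lower_bound x : 0 <= x <= E -> - (C * J x) <= 2 * a * (x * q x).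
Proof.
move=> /andP[x0 xE]; rewrite slope_equation.
have h1 : 0 <= sqconvs ls (expconv b (fun x => x * f x)) x.
  apply: (@sqconvs_ge0 _ _ _ x) => // y _.
  apply: (@expconv_ge0 _ _ _ y) => //; first exact: causalX.
  move=> z _; have [z0|z0] := leP z 0; first by rewrite cf.2// mulr0.
  by rewrite mulr_ge0// ltW.
have h2 : - ((E - x) * J x) <= (E - x) * P x.
  by rewrite -mulrN ler_wpM2l ?subr_ge0// lerNl -subr_ge0 opprK addrC.
have h3 : - (2 * (a - b) * J x) <= 4 * b * (a - b) * expconv b q x.
  have ab : 0 <= 2 * (a - b) by rewrite mulr_ge0// subr_ge0.
  have := mulr_ge0 ab (expconvJ_ge0 x b0).
  rewrite mulrDr => H; rewrite -subr_ge0 opprK; lra.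
have h4 : - ((\sum_(l <- ls) (a - l)) * J x) <=
    \sum_(l <- ls) 2 * l * (a - l) * expconv l q x.
  rewrite mulr_suml -sumrN big_seq [leRHS]big_seq; apply: ler_sum => l lls.
  have la : 0 <= a - l by rewrite subr_ge0; exact: (allP lsa).
  have [->|ln0] := eqVneq l 0.
    rewrite !(mulr0, mul0r) subr0 oppr_le0 mulr_ge0// ltW//.
  have l0 : 0 < l by rewrite lt0r ln0; exact: (allP ls0).
  have := mulr_ge0 la (expconvJ_ge0 x l0).
  rewrite mulrDr => H; rewrite -subr_ge0 opprK; lra.
have h5 : 0 <= x * J x by rewrite mulr_ge0.
rewrite /C; lra.
Qed.

(** The slope is nonnegative up to [E] because, where it would be negative, the
    size-bias identity bounds its negative part by a multiple of its primitive
    (Gronwall); [f] vanishes up to [e > 0] to keep away from the singular point 0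
    of that identity. *)
Lemma smoothed_slope_ge0 x : x <= 2 * b + \sum_(l <- ls) l -> 0 <= smoothed_slope x.
Proof.
rewrite -/E => xE; set K := C / (2 * a * e).
have K0 : 0 <= K by rewrite divr_ge0// mulr_ge0 ?ltW// mulr_gt0.
have NK y : y <= E -> N y <= K * J y.
  move=> yE; rewrite /N ge_max mulr_ge0// andbT.
  have [ye|ye] := leP y e; first by rewrite qe// oppr0 mulr_ge0.
  have [qy|qy] := leP 0 (q y); first by rewrite (@le_trans _ _ 0) ?oppr_le0// mulr_ge0.
  have y0 : 0 < y by exact: lt_trans ye.
  have yE2 : 0 <= y <= E by rewrite yE ltW.
  have H := slope_lower_bound yE2.
  rewrite /K mulrAC ler_pdivlMr ?mulr_gt0//.
  have : 2 * a * (e * - q y) <= 2 * a * (y * - q y).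
    by rewrite ler_pM2l ?mulr_gt0//; apply: ler_wpM2r; rewrite ?oppr_ge0; exact: ltW.
  lra.
have JE y : y <= E -> J y = 0.
  move=> yE; have [y0|y0] := leP y 0; first exact: J_le0.
  apply/eqP; rewrite eq_le J0 andbT.
  have := @ger0_is_derive_le _ _ _ E 0 y (fun z => is_deriveMf
    (is_derive_expRM (- K) z) (is_deriveZf (-1) (dJ z))) _ (ltW y0) yE.
  rewrite J_le0// !mulr0 pmulr_rge0 ?expR_gt0// mulN1r oppr_ge0; apply => z zE.
  rewrite (_ : _ + _ = expR (- K * z) * (K * J z - N z)); last by ring.
  by rewrite mulr_ge0 ?expR_ge0// subr_ge0 NK.
have := NK x xE; rewrite JE// mulr0 /N ge_max => /andP[+ _].
by rewrite oppr_le0.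
Qed.

End mode.

(** * Moments of the Gaussian law *)

Section moments.
Context {R : realType}.
Local Notation mu := (@lebesgue_measure R).
Local Notation gauss := (normal_prob (0 : R) 1).

Lemma measurable_sq : measurable_fun setT (fun y : R => y ^+ 2).
Proof. exact: measurable_funX. Qed.

(** Laplace transform of [xi ^+ 2]: up to a constant the tilted density is that of
    the normal law of variance [(1 + 2 * s)^-1]. *)
Lemma gauss_laplace (s : R) : - 2^-1 < s ->
  (\int[gauss]_y (expR (- s * y ^+ 2))%:E = (Num.sqrt (1 + 2 * s))^-1%:E)%E.
Proof.
move=> s2; have p0 : 0 < 1 + 2 * s by lra.
set v := (Num.sqrt (1 + 2 * s))^-1.
have v0 : 0 < v by rewrite invr_gt0 sqrtr_gt0.
have v2 : v ^+ 2 = (1 + 2 * s)^-1 by rewrite exprVn sqr_sqrtr// ltW.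
rewrite ge0_integral_gauss/=; last 2 first.
- apply/measurable_EFinP/measurableT_comp => //; apply: measurable_funM => //.
- by move=> y; rewrite lee_fin expR_ge0.
have pi2 : 0 < pi *+ 2 :> R by rewrite pmulrn_lgt0 ?pi_gt0.
have peakE : normal_peak 1 = v * normal_peak v.
  rewrite /normal_peak expr1n mul1r -mulrnAr sqrtrM ?sqr_ge0//.
  by rewrite sqrtr_sqr gtr0_norm// invfM mulrA divff ?mul1r// gt_eqF.
transitivity (\int[mu]_y (v%:E * (normal_pdf 0 v y)%:E))%E.
  apply: eq_integral => y _; rewrite -!EFinM; congr EFin.
  rewrite normal_pdf01E peakE normal_pdfE ?gt_eqF// /normal_fun subr0.
  rewrite mulrCA -!mulrA; congr (_ * (_ * _)); rewrite -expRD; congr expR.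
  by rewrite v2; field; rewrite gt_eqF.
rewrite ge0_integralZl//=.
- by rewrite integral_normal_pdf mule1.
- by apply/measurable_EFinP; exact: measurable_normal_pdf.
- by move=> y _; rewrite lee_fin normal_pdf_ge0.
- by rewrite lee_fin ltW.
Qed.

Lemma integrable_gauss_expR (s : R) : - 2^-1 < s ->
  gauss.-integrable setT (EFin \o (fun y : R => expR (- s * y ^+ 2))).
Proof.
move=> s2; apply/integrableP; split.
  apply/measurable_EFinP/measurableT_comp => //; exact: measurable_funM.
under eq_integral do rewrite /= ger0_norm ?expR_ge0//.
by rewrite gauss_laplace// ltry.
Qed.

Lemma integrable_gauss_sq :
  gauss.-integrable setT (EFin \o (fun y : R => y ^+ 2)).
Proof.
have s4 : - 2^-1 < - 4^-1 :> R by lra.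
have I := integrableZl measurableT 4 (integrable_gauss_expR s4).
apply: (le_integrable measurableT _ _ I) => /=.
  by apply/measurable_EFinP; exact: measurable_sq.
move=> y _; rewrite lee_fin ger0_norm ?sqr_ge0//.
rewrite ger0_norm ?mulr_ge0 ?expR_ge0//.
have := expR_ge1Dx (- - 4^-1 * y ^+ 2); lra.
Qed.

Lemma gauss_second_moment : \int[gauss]_y (y ^+ 2) = 1 :> R.
Proof.
pose f (s y : R) := expR (- s * y ^+ 2).
have fd (s y : R) : is_derive s 1 (f ^~ y) (- y ^+ 2 * expR (- s * y ^+ 2)).
  have -> : f ^~ y = fun s => expR ((- y ^+ 2) * s).
    by apply/funext => t; rewrite /f; congr expR; ring.
  have -> : - s * y ^+ 2 = - y ^+ 2 * s by ring.
  exact: is_derive_expRM.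
have s4 : - 2^-1 < - 4^-1 :> R by lra.
have I := integrableZl measurableT 8 (integrable_gauss_expR s4).
have d1 : is_derive (0 : R) 1 (fun s => \int[gauss]_y f s y)
    (\int[gauss]_y (- y ^+ 2 * expR (- 0 * y ^+ 2))).
  apply: (@is_derive_expectation _ _ _ gauss f
    (fun s y => - y ^+ 2 * expR (- s * y ^+ 2)) 0 (- 8^-1) (8^-1)
    (fun y => 8 * expR (- - 4^-1 * y ^+ 2))) => //.
  - by apply/andP; split; lra.
  - by move=> s /andP[s8 _]; apply: integrable_gauss_expR; lra.
  - move=> s y /andP[s8 _].
    have y0 : 0 <= (y : R) ^+ 2 by rewrite sqr_ge0.
    rewrite normrM normrN (ger0_norm y0) ger0_norm ?expR_ge0//.
    have e1 := expR_ge1Dx (8^-1 * y ^+ 2).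
    have e2 : expR (- s * y ^+ 2) <= expR (8^-1 * y ^+ 2).
      by rewrite ler_expR ler_wpM2r//; lra.
    have -> : 8 * expR (- - 4^-1 * y ^+ 2) =
        (8 * expR (8^-1 * y ^+ 2)) * expR (8^-1 * y ^+ 2).
      by rewrite -mulrA -expRD; congr (_ * expR _); field.
    by apply: ler_pM => //; rewrite ?expR_ge0//; lra.
have d2 : is_derive (0 : R) 1 (fun s => \int[gauss]_y f s y) (- 1).
  have ds : is_derive (0 : R) 1 (fun s : R => 1 + 2 * s) 2.
    have /is_derive_eq := is_deriveDf (is_derive_cst (1 : R^o) (0 : R) 1)
      (is_deriveZf 2 (is_derive_id (0 : R) 1)).
    by apply; rewrite add0r mulr1.
  have := @is_derive1_comp _ (@Num.sqrt R) (fun s : R => 1 + 2 * s) 0 _ _ _ ds.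
  rewrite mulr0 addr0 => /(_ _ (is_derive1_sqrt ltr01)).
  rewrite sqrtr1 => dsq.
  have {}dsq : is_derive (0 : R) 1 (Num.sqrt \o (fun s : R => 1 + 2 * s) : R -> R) (1 : R).
    by have /is_derive_eq := dsq; apply; rewrite mulr1 mulVf.
  have s10 : Num.sqrt (1 + 2 * 0) != 0 :> R by rewrite mulr0 addr0 sqrtr1 oner_neq0.
  have dV : is_derive (0 : R) 1 (fun s : R => (Num.sqrt (1 + 2 * s))^-1) (- 1).
    have /is_derive_eq := @is_deriveV _ (fun s : R => Num.sqrt (1 + 2 * s)) 0 _ _ s10 dsq; apply.
    by rewrite /= mulr0 addr0 sqrtr1 expr1n invr1 /GRing.scale/= mulr1.
  apply: near_eq_is_derive dV; near=> s.
  rewrite /Rintegral gauss_laplace//.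
  near: s; exact: lt_nbhsr.
have := @derive_val _ _ _ _ _ _ _ d1; rewrite (@derive_val _ _ _ _ _ _ _ d2).
under eq_Rintegral do rewrite oppr0 mul0r expR0 mulr1 -mulN1r.
rewrite RintegralZl//; last exact: integrable_gauss_sq.
by rewrite mulN1r => /eqP; rewrite eqr_opp => /eqP <-.
Unshelve. all: end_near. Qed.

End moments.

(** * Merging the weights of a quadratic form *)

Section fubini.
Context d1 d2 (T1 : measurableType d1) (T2 : measurableType d2) (R : realType)
  (P : probability T1 R) (Q : probability T2 R).
Variable F : T1 * T2 -> R.
Hypothesis Fi : (P \x Q)%E.-integrable setT (EFin \o F).

Lemma Rintegral_prod12 : (forall x, Q.-integrable setT (fun y => (F (x, y))%:E)) ->
  \int[(P \x Q)%E]_z F z = \int[P]_x \int[Q]_y F (x, y).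
Proof.
move=> iF; rewrite /Rintegral -(integral12_prod_meas1 Fi)/=; congr fine.
by apply: eq_integral => x _ /=; rewrite fineK//; exact: integrable_fin_num.
Qed.

Lemma Rintegral_prod21 : (forall y, P.-integrable setT (fun x => (F (x, y))%:E)) ->
  \int[(P \x Q)%E]_z F z = \int[Q]_y \int[P]_x F (x, y).
Proof.
move=> iF; rewrite /Rintegral -(integral21_prod_meas1 Fi)/=; congr fine.
by apply: eq_integral => x _ /=; rewrite fineK//; exact: integrable_fin_num.
Qed.

End fubini.

Lemma integrableM_range d (T : measurableType d) (R : realType)
    (P : probability T R) (h F : T -> R) (B : R) :
  P.-integrable setT (EFin \o h) -> (forall z, 0 <= h z) ->
  (forall z, 0 <= F z <= B) -> measurable_fun setT F ->
  P.-integrable setT (EFin \o (fun z => h z * F z)).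
Proof.
move=> hi h0 FB mF.
have I : P.-integrable setT (EFin \o (fun z => B * h z)).
  by have := integrableZl measurableT B hi.
apply: le_integrable I => //.
  apply/measurable_EFinP/measurable_funM => //.
  by case/integrableP: hi => /measurable_EFinP.
move=> z _; case/andP: (FB z) => F0 FB'.
have B0 : 0 <= B by exact: le_trans FB'.
by rewrite lee_fin !ger0_norm ?mulr_ge0// mulrC ler_wpM2r.
Qed.

Section merge.
Context {R : realType}.
Local Notation RB := (measurableTypeR R).
Local Notation gauss := (normal_prob (0 : R) 1).
Local Notation gauss2 := (gauss \x gauss)%E.
Implicit Types (f g h : R -> R) (x y c l w a b e B : R) (ls : seq R).

Let arg a b x (z : RB * RB) : R := x - a * (z.1 : R) ^+ 2 - b * (z.2 : R) ^+ 2.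

Lemma measurable_fst_sq : measurable_fun setT (fun z : RB * RB => (z.1 : R) ^+ 2).
Proof. by apply: measurable_funX; exact: measurable_fst. Qed.

Lemma measurable_snd_sq : measurable_fun setT (fun z : RB * RB => (z.2 : R) ^+ 2).
Proof. by apply: measurable_funX; exact: measurable_snd. Qed.

Let measurable_arg a b x : measurable_fun setT (arg a b x).
Proof.
apply: measurable_funB; last first.
  by apply: measurable_funM => //; exact: measurable_snd_sq.
apply: measurable_funB => //.
by apply: measurable_funM => //; exact: measurable_fst_sq.
Qed.

Let measurable_comp_arg f a b x : continuous f ->
  measurable_fun setT (fun z => f (arg a b x z)).
Proof.
move=> cf; apply: (@measurableT_comp _ _ _ _ _ _ f) => //.
exact: continuous_measurable_fun.
Qed.

Let arg_le a b x z : 0 <= a -> 0 <= b -> arg a b x z <= x.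
Proof.
move=> a0 b0; rewrite /arg -addrA gerDl -opprD oppr_le0.
by rewrite addr_ge0// mulr_ge0// sqr_ge0.
Qed.

Lemma sqconvC a b f : 0 <= a -> 0 <= b -> causal f ->
  sqconv a (sqconv b f) = sqconv b (sqconv a f).
Proof.
move=> a0 b0 cf; apply/funext => x; have [M _ fM] := causal_bounded x cf.
have I : gauss2.-integrable setT (EFin \o (fun z => f (arg a b x z))).
  apply: (@bounded_integrable _ _ R gauss2 _ M).
    exact: measurable_comp_arg cf.1.
  by move=> z; apply: fM; exact: arg_le.
transitivity (\int[gauss2]_z f (arg a b x z)).
  rewrite (Rintegral_prod12 I)// => y.
  exact: (integrable_sqconv (x - a * y ^+ 2) b0 cf).
rewrite (Rintegral_prod21 I) => [|y]; last first.
  rewrite /arg/=; under eq_fun do rewrite addrAC.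
  exact: (integrable_sqconv (x - b * y ^+ 2) a0 cf).
by apply: eq_Rintegral => y _; apply: eq_Rintegral => z _; rewrite /arg/= addrAC.
Qed.

Lemma is_derive_sqconvs ls f df x : nonneg ls -> causal f -> causal df ->
  (forall x, is_derive x 1 f (df x)) ->
  is_derive x 1 (sqconvs ls f) (sqconvs ls df x).
Proof.
move=> + cf cdf fd; elim: ls x => //= l ls IH x /andP[l0 ls0].
apply: is_derive_sqconv => //; [exact: causal_sqconvs|exact: causal_sqconvs|].
by move=> y; exact: IH.
Qed.

Lemma Rintegral_gauss_cst B : \int[gauss]_y B = B.
Proof. by rewrite Rintegral_cst//= (probability_setT gauss) mulr1. Qed.

Lemma sqconvs_range ls f B : nonneg ls -> causal f ->
  (forall x, 0 <= f x <= B) -> forall x, 0 <= sqconvs ls f x <= B.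
Proof.
move=> + cf fB; elim: ls => //= l ls IH /andP[l0 ls0] x.
have {}IH := IH ls0; apply/andP; split.
  by apply: (@sqconv_ge0 _ _ _ x) => // y _; case/andP: (IH y).
rewrite -[leRHS]Rintegral_gauss_cst; apply: le_Rintegral => //.
- by apply: integrable_sqconv => //; exact: causal_sqconvs.
- exact: finite_measure_integrable_cst.
- by move=> y _; case/andP: (IH (x - l * y ^+ 2)).
Qed.

Lemma integrable_fst_sq :
  gauss2.-integrable setT (EFin \o (fun z : RB * RB => (z.1 : R) ^+ 2)).
Proof.
have m : measurable_fun setT (EFin \o (fun z : RB * RB => (z.1 : R) ^+ 2)).
  by apply/measurable_EFinP; exact: measurable_fst_sq.
apply/integrable12ltyP => //=.
under eq_integral do rewrite integral_cst//= (probability_setT gauss) mule1.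
by case/integrableP: (@integrable_gauss_sq R).
Qed.

Lemma integrable_snd_sq :
  gauss2.-integrable setT (EFin \o (fun z : RB * RB => (z.2 : R) ^+ 2)).
Proof.
have m : measurable_fun setT (EFin \o (fun z : RB * RB => (z.2 : R) ^+ 2)).
  by apply/measurable_EFinP; exact: measurable_snd_sq.
apply/integrable21ltyP => //=.
under eq_integral do rewrite integral_cst//= (probability_setT gauss) mule1.
by case/integrableP: (@integrable_gauss_sq R).
Qed.

(* The expectation of [g (x - a * xi ^+ 2 - b * eta ^+ 2)], where the total weight
   [a + b] is kept equal to [c] while [a - b = t] varies. *)
Let path g c x t := \int[gauss2]_z g (arg ((c + t) / 2) ((c - t) / 2) x z).

Let integrable_arg g a b x B : continuous g -> (forall x, 0 <= g x <= B) ->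
  gauss2.-integrable setT (EFin \o (fun z => g (arg a b x z))).
Proof.
move=> cg gB; apply: (@bounded_integrable _ _ R gauss2 _ B).
  exact: measurable_comp_arg.
by move=> z; case/andP: (gB (arg a b x z)) => g0 gz; rewrite ger0_norm.
Qed.

Let pathE g a b x B : 0 <= a -> 0 <= b -> causal g -> (forall x, 0 <= g x <= B) ->
  path g (a + b) x (a - b) = sqconv a (sqconv b g) x.
Proof.
move=> a0 b0 cg gB; rewrite /path.
have -> : (a + b + (a - b)) / 2 = a by field.
have -> : (a + b - (a - b)) / 2 = b by field.
rewrite (Rintegral_prod12 (integrable_arg a b x cg.1 gB))// => y.
exact: (integrable_sqconv (x - a * y ^+ 2) b0 cg).
Qed.

Let is_derive_path g f (c x t B B' : R) : continuous g -> continuous f ->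
  (forall x, is_derive x 1 g (f x)) ->
  (forall x, 0 <= g x <= B') -> (forall x, 0 <= f x <= B) ->
  is_derive t 1 (path g c x) (\int[gauss2]_z (2^-1 *
    (z.2 ^+ 2 * f (arg ((c + t) / 2) ((c - t) / 2) x z) -
     (z.1 : R) ^+ 2 * f (arg ((c + t) / 2) ((c - t) / 2) x z)))).
Proof.
move=> cg cf dg gB fB.
have G : gauss2.-integrable setT
    (EFin \o (fun z : RB * RB => 2^-1 * B * ((z.2 : R) ^+ 2 + (z.1 : R) ^+ 2))).
  have := integrableZl measurableT (2^-1 * B)
    (integrableD measurableT integrable_snd_sq integrable_fst_sq).
  by [].
have B0 : 0 <= B by case/andP: (fB 0) => /le_trans; apply.
apply: (@is_derive_expectation _ _ _ gauss2
  (fun t z => g (arg ((c + t) / 2) ((c - t) / 2) x z))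
  (fun t z => 2^-1 * ((z.2 : R) ^+ 2 * f (arg ((c + t) / 2) ((c - t) / 2) x z) -
     (z.1 : R) ^+ 2 * f (arg ((c + t) / 2) ((c - t) / 2) x z)))
  t (t - 1) (t + 1) _ _ _ _ _ G).
- by apply/andP; split; lra.
- by move=> s _; exact: integrable_arg gB.
- move=> s z; set y := arg _ _ _ _.
  have da : is_derive s 1 (fun s => arg ((c + s) / 2) ((c - s) / 2) x z)
      (2^-1 * (z.2 ^+ 2 - (z.1 : R) ^+ 2)).
    rewrite (_ : (fun s => _) = (fun s => arg (c / 2) (c / 2) x z +
        2^-1 * (z.2 ^+ 2 - (z.1 : R) ^+ 2) * s)).
      have /is_derive_eq := is_deriveDf (is_derive_cst (arg (c / 2) (c / 2) x z : R^o) s 1)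
        (is_deriveZf (2^-1 * (z.2 ^+ 2 - (z.1 : R) ^+ 2) : R) (is_derive_id s 1)).
      by apply; rewrite add0r mulr1.
    by apply/funext => r; rewrite /arg; field.
  have /is_derive_eq := @is_derive1_comp _ g _ s _ _ (dg _) da.
  by apply; rewrite /y; ring.
- move=> z; rewrite mulr_ge0//; first by rewrite mulr_ge0// invr_ge0.
  by rewrite addr_ge0// sqr_ge0.
- move=> s z _; set y := arg _ _ _ _.
  have z1 : 0 <= (z.1 : R) ^+ 2 by exact: sqr_ge0.
  have z2 : 0 <= (z.2 : R) ^+ 2 by exact: sqr_ge0.
  case/andP: (fB y) => fy0 fyB.
  rewrite -mulrBl -mulrA normrM ger0_norm ?invr_ge0// ler_wpM2l ?invr_ge0//.
  rewrite normrM mulrC (ger0_norm fy0) ler_pM//.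
  by rewrite (le_trans (ler_normB _ _))// !ger0_norm.
Qed.

Let expconv_sub ls a b f x : 0 < b -> b <= a -> nonneg ls -> causal f ->
  expconv b (sqconvs ls f) x - expconv a (sqconvs ls f) x =
  2 * (a - b) * smoothed_slope ls a b f x.
Proof.
move=> b0 ba ls0 cf; have a0 : 0 < a by exact: lt_le_trans ba.
rewrite /smoothed_slope sqconvs_expconv//.
set h := sqconvs ls f; have ch : causal h by exact: causal_sqconvs.
have := expconv_resolvent x (lt0r_neq0 b0) (lt0r_neq0 a0) ch.
have -> : (fun y => h y - expconv b h y) = (fun y => h y + -1 * expconv b h y).
  by apply/funext => y; rewrite mulN1r.
have cT := causal_expconv b ch.
rewrite expconvD//; last exact: causalZ.
rewrite (expconvZ _ _ cT).
set u := expconv a (expconv b h) x; set v := expconv a h x; set t := expconv b h x.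
move=> /(congr1 (fun z => b * z)) H.
have {}H : a * (t - v) = (a - b) * (t - u).
  have -> : a * (t - v) = - (b * (v - t)) + (a - b) * (t - v) by ring.
  by rewrite H; field; rewrite lt0r_neq0.
have -> : t - v = a^-1 * ((a - b) * (t - u)) by rewrite -H mulKf// lt0r_neq0.
by field; rewrite lt0r_neq0.
Qed.

(** Move the weights from [(a, b)] to [(a + b, 0)] with a constant sum. At an
    intermediate pair [(a', b')], the derivative of the expectation is half the
    difference of its exponential convolutions of parameters [b'] and [a'] by Stein's
    identity, that is [a' - b'] times the slope, which is nonnegative below the mean
    because [a'] remains the largest weight. *)
Lemma merge_weights ls a b e f g B B' x :
  0 <= b -> b <= a -> nonneg ls -> all (fun l => l <= a) ls ->
  causal f -> (forall x, 0 <= f x <= B) ->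
  0 < e -> (forall x, x <= e -> f x = 0) ->
  causal g -> (forall x, 0 <= g x <= B') -> (forall x, is_derive x 1 g (f x)) ->
  x <= a + b + \sum_(l <- ls) l ->
  sqconvs (a :: b :: ls) g x <= sqconvs (a + b :: ls) g x.
Proof.
move=> b0 ba ls0 lsa cf fB e0 fe cg gB dg xE /=.
have a0 : 0 <= a by exact: le_trans ba.
set G := sqconvs ls g; set F := sqconvs ls f.
have cG : causal G by exact: causal_sqconvs.
have cF : causal F by exact: causal_sqconvs.
have FB := sqconvs_range ls0 cf fB.
have GB := sqconvs_range ls0 cg gB.
have dG y : is_derive y 1 G (F y) by exact: is_derive_sqconvs.
have sqconv0 h : sqconv 0 h = h.
  apply/funext => y; rewrite /sqconv; under eq_Rintegral do rewrite mul0r subr0.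
  exact: Rintegral_gauss_cst.
rewrite -(pathE x a0 b0 cG GB) -[in leRHS](sqconv0 G).
rewrite -(pathE x (addr_ge0 a0 b0) (lexx 0) cG GB) addr0 subr0.
apply: (ger0_is_derive_le_oo (fun t => is_derive_path _ x t cG.1 cF.1 dG GB FB));
  last by lra.
move=> t /andP[t1 t2]; set a' := (_ + t) / 2; set b' := (_ - t) / 2.
have b'0 : 0 < b' by rewrite /b'; lra.
have ba' : b' <= a' by rewrite /b' /a'; lra.
have aa' : a <= a' by rewrite /a'; lra.
have ab' : a' + b' = a + b by rewrite /a' /b'; field.
have a'0 : 0 < a' by exact: lt_le_trans ba'.
have FB' z : 0 <= F (arg a' b' x z) <= B by exact: FB.
have I1 : gauss2.-integrable setT
    (EFin \o (fun z : RB * RB => (z.1 : R) ^+ 2 * F (arg a' b' x z))).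
  apply: (integrableM_range integrable_fst_sq _ FB') => [z|]; first exact: sqr_ge0.
  exact: measurable_comp_arg cF.1.
have I2 : gauss2.-integrable setT
    (EFin \o (fun z : RB * RB => (z.2 : R) ^+ 2 * F (arg a' b' x z))).
  apply: (integrableM_range integrable_snd_sq _ FB') => [z|]; first exact: sqr_ge0.
  exact: measurable_comp_arg cF.1.
rewrite RintegralZl//; last exact: (integrableB measurableT I2 I1).
rewrite mulr_ge0 ?invr_ge0// RintegralB//.
rewrite (Rintegral_prod12 I2) => [|y]; last first.
  exact: (integrable_sq_sqconv (x - a' * y ^+ 2) b'0 cF).
rewrite (Rintegral_prod21 I1) => [|y]; last first.
  rewrite /arg/=; under eq_fun do rewrite addrAC.
  exact: (integrable_sq_sqconv (x - b' * y ^+ 2) a'0 cF).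
have cT w : causal (expconv w F) by exact: causal_expconv.
have -> : \int[gauss]_x0 \int[gauss]_y (((x0, y).2 : R) ^+ 2 * F (arg a' b' x (x0, y)))
    = expconv b' (sqconvs [:: a', b' & ls] f) x.
  rewrite /= -/F -(sqconv_expconv b' (ltW a'0) (causal_sqconv (ltW b'0) cF)).
  rewrite -(sqconv_expconv b' (ltW b'0) cF).
  apply: eq_Rintegral => y _ /=.
  by rewrite -(stein_sqconv (x - a' * y ^+ 2) b'0 cF).
have -> : \int[gauss]_y \int[gauss]_x0 (((x0, y).1 : R) ^+ 2 * F (arg a' b' x (x0, y)))
    = expconv a' (sqconvs [:: a', b' & ls] f) x.
  rewrite /= -/F (sqconvC (ltW a'0) (ltW b'0) cF).
  rewrite -(sqconv_expconv a' (ltW b'0) (causal_sqconv (ltW a'0) cF)).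
  rewrite -(sqconv_expconv a' (ltW a'0) cF).
  apply: eq_Rintegral => y _ /=.
  rewrite -(stein_sqconv (x - b' * y ^+ 2) a'0 cF).
  by apply: eq_Rintegral => z _; rewrite /arg/= addrAC.
rewrite (expconv_sub _ b'0 ba')//; last first.
  by rewrite /= (ltW a'0) (ltW b'0).
rewrite mulr_ge0//; first by rewrite mulr_ge0// subr_ge0.
apply: (smoothed_slope_ge0 b'0 ba' _ _ cf _ e0 fe) => //=.
- by rewrite (ltW a'0) (ltW b'0).
- by rewrite lexx ba'/=; apply: sub_all lsa => l /le_trans; apply.
- by move=> y; case/andP: (fB y).
- rewrite !big_cons; lra.
Qed.

(** Starting with the largest weight, merging keeps it the largest one. *)
Lemma merge_all_weights ls a e f g B B' x :
  0 <= a -> nonneg ls -> all (fun l => l <= a) ls ->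
  causal f -> (forall x, 0 <= f x <= B) ->
  0 < e -> (forall x, x <= e -> f x = 0) ->
  causal g -> (forall x, 0 <= g x <= B') -> (forall x, is_derive x 1 g (f x)) ->
  x <= a + \sum_(l <- ls) l ->
  sqconvs (a :: ls) g x <= sqconv (a + \sum_(l <- ls) l) g x.
Proof.
move=> + + + cf fB e0 fe cg gB dg.
elim: ls a => [a _ _ _ _|b ls IH a a0 /andP[b0 ls0] /andP[ba lsa]].
  by rewrite big_nil addr0.
rewrite big_cons addrA => xE.
apply: le_trans (IH (a + b) _ ls0 _ xE).
- exact: (merge_weights b0 ba ls0 lsa cf fB e0 fe cg gB dg).
- exact: addr_ge0.
- by apply: sub_all lsa => l /le_trans; apply; rewrite lerDl.
Qed.

(** A continuously differentiable substitute for the indicator of a half-line. It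
    vanishes near 0, as the slope lemma asks of its derivative [f]. *)
Lemma smooth_step e : 0 < e -> exists f g B c,
  [/\ causal f, forall x, 0 <= f x <= B & forall x, x <= e -> f x = 0] /\
  [/\ causal g, forall x, is_derive x 1 g (f x), forall x, 0 <= g x <= c,
      0 < c & forall x, 2 * e <= x -> g x = c].
Proof.
move=> e0; pose f x := Num.max ((x - e) * (2 * e - x)) 0.
have f0 x : 0 <= f x by rewrite /f le_max lexx orbT.
have fe x : x <= e -> f x = 0.
  move=> xe; rewrite /f; apply/max_idPr; rewrite mulr_le0_ge0//; lra.
have fe2 x : 2 * e <= x -> f x = 0.
  move=> xe; rewrite /f; apply/max_idPr; rewrite mulr_ge0_le0//; lra.
have cf : causal f.
  split=> [x|x x0]; last by rewrite fe// (le_trans x0)// ltW.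
  apply: (@continuous_max _ _ (fun x => (x - e) * (2 * e - x)) (fun=> 0));
    last exact: cvg_cst.
  apply: cvgM; apply: (@cvgB _ R^o); first exact: cvg_id.
  - exact: cvg_cst.
  - exact: cvg_cst.
  - exact: cvg_id.
have [cf1 cf2] := cf.
pose g := primitive f.
have dg (x : R) : is_derive x 1 g (f x) by exact: is_derive_primitive.
have cg : causal g.
  split; first exact: is_derive_continuous dg.
  by move=> x; exact: primitive_le0.
have gle x y : x <= y -> g x <= g y.
  by move=> xy; apply: (ger0_is_derive_le_oo dg).
have g0 x : 0 <= g x.
  have [x0|x0] := leP x 0; first by rewrite cg.2.
  by rewrite -(cg.2 0 (lexx 0)) gle// ltW.
have gc x : 2 * e <= x -> g x = g (2 * e).
  move=> ex; apply/eqP; rewrite eq_le (gle _ _ ex) andbT.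
  have := @ger0_is_derive_le_oo _ (fun x => -1 * g x) _ (2 * e) x
    (fun z => is_deriveZf (-1) (dg z)) _ ex.
  rewrite !mulN1r lerN2; apply => z /andP[/ltW ez _].
  by rewrite fe2// mulr0.
exists f, g, (e ^+ 2), (g (2 * e)); split; split => //.
(* The bump is at most [e ^+ 2 / 4]; the square below certifies a cruder bound. *)
- move=> x; rewrite f0/= /f ge_max sqr_ge0 andbT.
  have := sqr_ge0 (x - 3 / 2 * e); have := sqr_ge0 e.
  rewrite !expr2; lra.
- move=> x; rewrite g0/=; have [xe|ex] := leP x (2 * e); first exact: gle.
  by rewrite gc// ltW.
- rewrite lt0r g0 andbT; apply/eqP => ge0.
  have gz (z : R) : z <= 2 * e -> g z = 0.
    by move=> /gle; rewrite ge0 => gz; apply/eqP; rewrite eq_le gz g0.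
  have d0 : is_derive (3 / 2 * e) 1 g 0.
    have e32 : 3 / 2 * e < 2 * e by lra.
    have := is_derive_cst (0 : R^o) (3 / 2 * e) 1.
    apply: near_eq_is_derive; near=> z; rewrite gz//.
    by near: z; move/lt_nbhsl: e32; apply: filterS => y /ltW.
  have := @derive_val _ _ _ _ _ _ _ d0.
  rewrite (@derive_val _ _ _ _ _ _ _ (dg (3 / 2 * e))).
  apply/eqP; rewrite gt_eqF// /f lt_max; apply/orP; left.
  by rewrite mulr_gt0//; lra.
Unshelve. all: end_near. Qed.

End merge.

(** * Gaussian tuples and quadratic forms *)

Section gauss_tuple.
Context {R : realType}.
Local Notation RB := (measurableTypeR R).
Local Notation gauss := (normal_prob (0 : R) 1).

Definition cons_tuple n (z : RB * n.-tuple RB) : n.+1.-tuple RB :=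
  [tuple of z.1 :: z.2].

Lemma measurable_cons_tuple n : measurable_fun setT (@cons_tuple n).
Proof. exact: measurable_cons. Qed.

HB.instance Definition _ n := isMeasurableFun.Build _ _ _ _
  (@cons_tuple n) (@measurable_cons_tuple n).

(** Defined coordinate by coordinate, so that Tonelli's theorem gives inductions on
    the dimension; that it is the product law is [gauss_tuple_box]. *)
Fixpoint gauss_tuple n : probability (n.-tuple RB) R :=
  match n with
  | 0 => \d_([tuple] : 0.-tuple RB)
  | n'.+1 => distribution (gauss \x gauss_tuple n')%E (@cons_tuple n')
  end.

Lemma measurable_tuple_cons n (x : RB) :
  measurable_fun setT (fun t : n.-tuple RB => [tuple of x :: t] : n.+1.-tuple RB).
Proof. exact: measurable_cons. Qed.

Lemma ge0_integral_gauss_tupleS n (f : n.+1.-tuple RB -> \bar R) :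
  measurable_fun setT f -> (forall t, 0 <= f t)%E ->
  (\int[gauss_tuple n.+1]_t f t =
   \int[gauss]_x \int[gauss_tuple n]_t f [tuple of x :: t])%E.
Proof.
move=> mf f0; rewrite /= ge0_integral_pushforward//.
by rewrite preimage_setT fubini_tonelli1//=; exact: measurableT_comp.
Qed.

Lemma measurable_integral_gauss_tuple n (f : n.+1.-tuple RB -> \bar R) :
  measurable_fun setT f -> (forall t, 0 <= f t)%E ->
  measurable_fun setT (fun x : RB => \int[gauss_tuple n]_t f [tuple of x :: t])%E.
Proof.
move=> mf f0.
apply: (@measurable_fun_fubini_tonelli_F _ _ _ _ _ (gauss_tuple n)
  (fun z => f (cons_tuple z))) => //.
exact: measurableT_comp.
Qed.

Definition qform n (d : 'I_n -> R) (t : n.-tuple RB) : R :=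
  \sum_(i < n) d i * (tnth t i : R) ^+ 2.

Lemma qform_cons n (d : 'I_n.+1 -> R) (x : RB) (t : n.-tuple RB) :
  qform d [tuple of x :: t] =
  d ord0 * (x : R) ^+ 2 + qform (fun i => d (lift ord0 i)) t.
Proof.
rewrite /qform big_ord_recl tnth0; congr (_ + _).
by apply: eq_bigr => i _; rewrite tnthS.
Qed.

Lemma measurable_qform n (d : 'I_n -> R) : measurable_fun setT (qform d).
Proof.
apply: measurable_sum => i; apply: measurable_funM => //.
by apply: measurable_funX; exact: measurable_tnth.
Qed.

Lemma qform_ge0 n (d : 'I_n -> R) t : (forall i, 0 <= d i) -> 0 <= qform d t.
Proof. by move=> d0; apply: sumr_ge0 => i _; rewrite mulr_ge0// sqr_ge0. Qed.

Definition weights n (d : 'I_n -> R) := [seq d i | i <- enum 'I_n].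

Lemma weightsS n (d : 'I_n.+1 -> R) :
  weights d = d ord0 :: weights (fun i => d (lift ord0 i)).
Proof. by rewrite /weights enum_ordSl/= -map_comp. Qed.

Lemma nonneg_weights n (d : 'I_n -> R) : (forall i, 0 <= d i) -> nonneg (weights d).
Proof. by move=> d0; apply/allP => _ /mapP[i _ ->]. Qed.

Lemma sum_weights n (d : 'I_n -> R) : \sum_(l <- weights d) l = \sum_i d i.
Proof. by rewrite big_map big_enum. Qed.

Lemma integral_qform n (d : 'I_n -> R) (g : R -> R) B x :
  (forall i, 0 <= d i) -> causal g -> (forall x, 0 <= g x <= B) ->
  (\int[gauss_tuple n]_t (g (x - qform d t))%:E = (sqconvs (weights d) g x)%:E)%E.
Proof.
move=> + cg gB; have mg m (e : 'I_m -> R) y : measurable_fun setT (fun t => (g (y - qform e t))%:E).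
  apply/measurable_EFinP; apply: (@measurableT_comp _ _ _ _ _ _ g).
    by apply: continuous_measurable_fun; exact: cg.1.
  by apply: measurable_funB => //; exact: measurable_qform.
elim: n d x => [d x _|n IH d x d0].
  rewrite /= integral_dirac; [|exact: measurableT|exact: mg].
  rewrite [X in (X * _)%E](_ : _ = 1%E) ?mul1e; last by rewrite /dirac indicT.
  by rewrite /qform big_ord0 subr0 /weights enum_ord0.
rewrite ge0_integral_gauss_tupleS//; last first.
  by move=> t; rewrite lee_fin; case/andP: (gB (x - qform d t)).
transitivity ((sqconv (d ord0)
  (sqconvs (weights (fun i => d (lift ord0 i))) g) x)%:E); last by rewrite weightsS.
rewrite /sqconv /Rintegral.
have d0' i : 0 <= d (lift ord0 i) by [].
have ls0 := nonneg_weights d0'.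
have H y : (\int[gauss_tuple n]_t (g (x - qform d [tuple of y :: t]))%:E =
   (sqconvs (weights (fun i => d (lift ord0 i))) g (x - d ord0 * y ^+ 2))%:E)%E.
  rewrite -IH//; apply: eq_integral => t _.
  by rewrite qform_cons opprD addrA.
transitivity (\int[gauss]_y (sqconvs
    (weights (fun i => d (lift ord0 i))) g (x - d ord0 * (y : R) ^+ 2))%:E)%E.
  by apply: eq_integral => y _; exact: H.
rewrite fineK//; apply: integrable_fin_num => //.
exact: (integrable_sqconv x (d0 ord0) (causal_sqconvs ls0 cg)).
Qed.

Lemma sqconvs_move (a : R) ls1 ls2 g : 0 <= a -> nonneg ls1 -> nonneg ls2 ->
  causal g -> sqconvs (ls1 ++ a :: ls2) g = sqconvs (a :: ls1 ++ ls2) g.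
Proof.
move=> a0 + ls20 cg; elim: ls1 => //= b ls IH /andP[b0 ls0].
rewrite (IH ls0); have c12 : causal (sqconvs (ls ++ ls2) g).
  by apply: causal_sqconvs => //; rewrite all_cat ls0.
exact: sqconvC b0 a0 c12.
Qed.

(** Convolutions commute, so the largest weight can be put first. *)
Lemma sqconvs_le_sqconv_sum (ls : seq R) (f g : R -> R) (e B c x : R) :
  nonneg ls ->
  causal f -> (forall x, 0 <= f x <= B) ->
  0 < e -> (forall x, x <= e -> f x = 0) ->
  causal g -> (forall x, 0 <= g x <= c) -> (forall x : R, is_derive x 1 g (f x)) ->
  x <= \sum_(l <- ls) l ->
  sqconvs ls g x <= sqconv (\sum_(l <- ls) l) g x.
Proof.
move=> ls0 cf fB e0 fe cg gB dg.
have [->|] := eqVneq ls [::].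
  rewrite big_nil /sqconv => _ /=.
  by under eq_Rintegral do rewrite mul0r subr0; rewrite Rintegral_gauss_cst.
move=> lsn0; have : exists2 a, a \in ls & all (fun l => l <= a) ls.
  case: ls lsn0 ls0 => // l ls _ _.
  elim: ls l => [l|l' ls IH l]; first by exists l; rewrite ?mem_seq1//= lexx.
  have [a als /allP aM] := IH l'; have [la|al] := leP l a.
    exists a; first by rewrite inE als orbT.
    by apply/allP => k; rewrite inE => /predU1P[->//|]; exact: aM.
  exists l; first exact: mem_head.
  apply/allP => k; rewrite inE => /predU1P[->//|/aM /le_trans]; apply.
  exact: ltW.
move=> [a als aM] xE; case/splitPr: als ls0 aM xE {lsn0} => ls1 ls2.
rewrite !all_cat/= => /and3P[ls10 a0 ls20] /and3P[aM1 _ aM2] xE.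
have E : \sum_(l <- ls1 ++ a :: ls2) l = a + \sum_(l <- ls1 ++ ls2) l.
  by rewrite !big_cat big_cons/= addrCA.
rewrite sqconvs_move// E; rewrite E in xE.
by apply: (merge_all_weights _ _ _ cf fB e0 fe cg gB dg xE) => //;
  rewrite all_cat ?ls10 ?aM1.
Qed.

End gauss_tuple.

(** * Comparison with a rank one form *)

Section key.
Context {R : realType}.
Local Notation RB := (measurableTypeR R).
Local Notation gauss := (normal_prob (0 : R) 1).

Lemma measurable_sub_le d (T : measurableType d) (f : T -> R) (z : R) :
  measurable_fun setT f -> measurable [set t | f t <= z].
Proof.
move=> mf; have -> : [set t | f t <= z] = setT `&` f @^-1` `]-oo, z].
  by apply/seteqP; split => t /=; rewrite in_itv/=; [split|case].
by apply: mf.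
Qed.

Lemma mule_measure_indic d (T : measurableType d) (P : probability T R)
    (A : set T) (c : R) : measurable A -> 0 <= c ->
  (c%:E * P A = \int[P]_t (c * \1_A t)%:E)%E.
Proof.
move=> mA c0; under eq_integral do rewrite EFinM.
rewrite ge0_integralZl//=; last by apply/measurable_EFinP; exact: measurable_indic.
by rewrite integral_indic// setIT.
Qed.

Lemma markov_step d (T : measurableType d) (P : probability T R)
    (f : T -> R) (g : R -> R) (z c y : R) : measurable_fun setT f ->
  continuous g -> (forall x, 0 <= g x) -> (forall x, y - z <= x -> g x = c) ->
  0 <= c ->
  (c%:E * P [set t | (f t <= z)%R] <= \int[P]_t (g (y - f t)%R)%:E)%E.
Proof.
move=> mf cg g0 gc c0; set A := [set t | _].
have mA : measurable A by exact: measurable_sub_le.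
rewrite mule_measure_indic//.
apply: ge0_le_integral => //.
- by move=> t _; rewrite lee_fin mulr_ge0.
- by apply/measurable_EFinP/measurable_funM => //; exact: measurable_indic.
- apply/measurable_EFinP; apply: (@measurableT_comp _ _ _ _ _ _ g).
    exact: continuous_measurable_fun.
  exact: measurable_funB.
- move=> t _; rewrite lee_fin indicE; case: (boolP (t \in A)) => /=.
    by rewrite inE /A/= => ftz; rewrite mulr1 gc// lerB.
  by rewrite mulr0.
Qed.

Lemma le_measure_step d (T : measurableType d) (P : probability T R)
    (f : T -> R) (g : R -> R) (c y : R) : measurable_fun setT f ->
  causal g -> (forall x, 0 <= g x <= c) ->
  (\int[P]_t (g (y - f t)%R)%:E <= c%:E * P [set t | (f t <= y)%R])%E.
Proof.
move=> mf cg gB; set A := [set t | _].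
have c0 : 0 <= c by case/andP: (gB 0) => /le_trans; apply.
have mA : measurable A by exact: measurable_sub_le.
rewrite mule_measure_indic//.
apply: ge0_le_integral => //.
- by move=> t _; rewrite lee_fin; case/andP: (gB (y - f t)).
- apply/measurable_EFinP; apply: (@measurableT_comp _ _ _ _ _ _ g).
    by apply: continuous_measurable_fun; exact: cg.1.
  exact: measurable_funB.
- by apply/measurable_EFinP/measurable_funM => //; exact: measurable_indic.
- move=> t _; rewrite lee_fin indicE; case: (boolP (t \in A)) => /= tA.
    by rewrite mulr1; case/andP: (gB (y - f t)).
  rewrite mulr0 cg.2//; move: tA; rewrite notin_setE /A/= => /negP.
  by rewrite -ltNge subr_le0 => /ltW.
Qed.

(** Below the mean, concentrating all the weight on one coordinate only increases the
    distribution function. The comparison of smooth test functions holds up to the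
    mean; a smooth step from [e] to [2 * e] then loses [2 * e] in the argument, which
    the strict inequality [z < \sum_i d i] and continuity from above absorb. *)
Theorem qform_le_rank1 n (d : 'I_n -> R) (z : R) :
  (forall i, 0 <= d i) -> z < \sum_i d i ->
  (gauss_tuple n [set t | (qform d t <= z)%R] <=
   gauss [set y : RB | ((\sum_i d i) * (y : R) ^+ 2 <= z)%R])%E.
Proof.
move=> d0; set r := \sum_i d i => zr.
have mq := measurable_qform d.
have msq (c : R) : measurable_fun setT (fun y : RB => c * (y : R) ^+ 2).
  by apply: measurable_funM => //; exact: measurable_sq.
pose F (k : nat) := [set y : RB | r * (y : R) ^+ 2 <= z + (r - z) * k.+1%:R^-1].
have step k : (gauss_tuple n [set t | (qform d t <= z)%R] <= gauss (F k))%E.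
  set e := (r - z) / 2 * k.+1%:R^-1.
  have e0 : 0 < e by rewrite mulr_gt0 ?invr_gt0// divr_gt0// subr_gt0.
  have ze : z + 2 * e <= r.
    rewrite -lerBrDl /e mulrA mulrC [2 * _]mulrC divfK//.
    by rewrite ler_piMl ?subr_ge0 ?(ltW zr)// invf_le1// ler1n.
  have [f [g [B [c [[cf fB fe] [cg dg gB c0 gc]]]]]] := smooth_step e0.
  have := markov_step (gauss_tuple n) (z := z) (y := z + 2 * e) mq cg.1
    (fun x => (andP (gB x)).1) _ (ltW c0).
  rewrite addrAC subrr add0r => /(_ gc) H1.
  rewrite (integral_qform _ d0 cg gB) in H1.
  have H2 : sqconvs (weights d) g (z + 2 * e) <= sqconv r g (z + 2 * e).
    rewrite /r -sum_weights; apply: (sqconvs_le_sqconv_sum _ cf fB e0 fe cg gB dg).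
      exact: nonneg_weights.
    by rewrite sum_weights.
  have H3 := le_measure_step gauss (z + 2 * e) (msq r) cg gB.
  have r0 : 0 <= r by exact: sumr_ge0.
  have I : ((sqconv r g (z + 2 * e))%:E =
      \int[gauss]_y (g (z + 2 * e - r * (y : R) ^+ 2)%R)%:E)%E.
    rewrite /sqconv /Rintegral fineK//; apply: integrable_fin_num => //.
    exact: (integrable_sqconv _ r0 cg).
  have ez : 2 * e = (r - z) * k.+1%:R^-1 by rewrite /e mulrA [2 * _]mulrC divfK.
  rewrite -I ez in H3; rewrite ez in H1 H2.
  have H4 : (c%:E * gauss_tuple n [set t | (qform d t <= z)%R] <=
      c%:E * gauss (F k))%E.
    by apply: (le_trans H1); apply: le_trans H3; rewrite lee_fin.
  by rewrite lee_pmul2l// in H4.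
have FE : \bigcap_k F k = [set y : RB | r * (y : R) ^+ 2 <= z].
  apply/seteqP; split => [y Fy|y /= yz k _]; last first.
    rewrite /F/= (le_trans yz)// lerDl mulr_ge0 ?invr_ge0//.
    by rewrite subr_ge0 ltW.
  apply/ler_addgt0Pr => e e0; have := Fy (Num.truncn ((r - z) / e)) I.
  rewrite /F/= => /le_trans; apply; rewrite lerD2l ler_pdivrMr//.
  by rewrite mulrC -ler_pdivrMr// ltW// truncnS_gt.
have mF k : measurable (F k) by exact: measurable_sub_le.
have cvF : gauss (F k) @[k --> \oo] --> gauss (\bigcap_k F k).
  apply: nonincreasing_cvg_mu => //.
  - by rewrite (le_lt_trans (probability_le1 _ _))// ltry.
  - exact: bigcap_measurable.
  - apply/nonincreasing_seqP => k; apply/subsetPset => y /=; rewrite /F/=.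
    move=> /le_trans; apply; rewrite lerD2l ler_wpM2l ?subr_ge0 ?(ltW zr)//.
    by rewrite lef_pV2 ?posrE// ler_nat.
rewrite -FE; apply: (cvge_to_ge cvF).
by apply: nearW => k; exact: step.
Qed.

End key.

(** * Rotation invariance *)

Section shear.
Context {R : realType}.
Local Notation RB := (measurableTypeR R).
Local Notation mu := (@lebesgue_measure R).
Local Notation gauss := (normal_prob (0 : R) 1).
Local Open Scope ereal_scope.

Lemma ge0_integral_shift (f : RB -> \bar R) (a : R) :
  measurable_fun setT f -> (forall x, 0 <= f x) ->
  \int[mu]_x f (x + a)%R = \int[mu]_x f x.
Proof.
move=> mf f0; pose phi (x : RB) : RB := (x + a)%R.
have mphi : measurable_fun setT phi by exact: measurable_funD.
rewrite -[LHS]/(\int[mu]_(x in phi @^-1` setT) (f \o phi) x).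
rewrite -ge0_integral_pushforward//.
apply: eq_measure_integral => A mA _; apply/esym/lebesgue_measure_unique => //=.
move=> _ [[b c]] _ <-; rewrite /pushforward.
have -> : phi @^-1` `]b, c]%classic = `](b - a)%R, (c - a)%R]%classic.
  apply/seteqP; split => x /=; rewrite !in_itv/= /phi ltrBlDr lerBrDr;
    by move=> ->.
rewrite /= !lebesgue_measure_itv/= !lte_fin ltrD2r; case: ifP => // _.
by rewrite -!EFinB; congr EFin; rewrite opprB addrA subrK.
Qed.

Local Notation mxm := (mu \x mu).

Lemma integral_shear1 (H : RB * RB -> \bar R) (k : R) :
  measurable_fun setT H -> (forall z, 0 <= H z) ->
  \int[mxm]_z H (z.1 + k * z.2, z.2)%R = \int[mxm]_z H z.
Proof.
move=> mH H0.
have ms : measurable_fun setT (fun z : RB * RB => ((z.1 : R) + k * (z.2 : R), z.2)%R : RB * RB).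
  apply/measurable_fun_pairP; split; last exact: measurable_snd.
  by apply: measurable_funD => //; exact: measurable_funM.
rewrite (@fubini_tonelli2 _ _ _ _ R mu mu _ mH H0).
rewrite (@fubini_tonelli2 _ _ _ _ R mu mu _ (measurableT_comp mH ms) (fun z => H0 _)).
apply: eq_integral => y _; rewrite /fubini_G/=.
apply: (@ge0_integral_shift (fun x => H (x, y))) => //.
by apply: measurableT_comp => //; exact: measurable_pair2.
Qed.

Lemma integral_shear2 (H : RB * RB -> \bar R) (k : R) :
  measurable_fun setT H -> (forall z, 0 <= H z) ->
  \int[mxm]_z H (z.1, z.2 + k * z.1)%R = \int[mxm]_z H z.
Proof.
move=> mH H0.
have ms : measurable_fun setT (fun z : RB * RB => (z.1, (z.2 : R) + k * (z.1 : R))%R : RB * RB).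
  apply/measurable_fun_pairP; split; first exact: measurable_fst.
  by apply: measurable_funD => //; exact: measurable_funM.
rewrite (@fubini_tonelli1 _ _ _ _ R mu mu _ mH H0).
rewrite (@fubini_tonelli1 _ _ _ _ R mu mu _ (measurableT_comp mH ms) (fun z => H0 _)).
apply: eq_integral => x _; rewrite /fubini_F/=.
apply: (@ge0_integral_shift (fun y => H (x, y))) => //.
by apply: measurableT_comp => //; exact: measurable_pair1.
Qed.

Definition rot2 (c s : R) (z : RB * RB) : RB * RB :=
  ((c * z.1 - s * z.2)%R, (s * z.1 + c * z.2)%R).

Lemma measurable_rot2 c s : measurable_fun setT (rot2 c s).
Proof.
apply/measurable_fun_pairP; split => /=.
  by apply: measurable_funB; exact: measurable_funM.
by apply: measurable_funD; exact: measurable_funM.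
Qed.

(** A rotation is a product of three shears, each of which preserves the Lebesgue
    measure of the plane. *)
Lemma integral_rot2 (H : RB * RB -> \bar R) (c s : R) :
  (c ^+ 2 + s ^+ 2 = 1)%R -> s != 0%R ->
  measurable_fun setT H -> (forall z, 0 <= H z) ->
  \int[mxm]_z H (rot2 c s z) = \int[mxm]_z H z.
Proof.
move=> cs s0 mH H0; pose k := ((c - 1) / s)%R.
pose s1 (z : RB * RB) : RB * RB := ((z.1 : R) + k * (z.2 : R), z.2)%R.
pose s2 (z : RB * RB) : RB * RB := (z.1, (z.2 : R) + s * (z.1 : R))%R.
have ms1 : measurable_fun setT s1.
  apply/measurable_fun_pairP; split; last exact: measurable_snd.
  by apply: measurable_funD => //; exact: measurable_funM.
have ms2 : measurable_fun setT s2.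
  apply/measurable_fun_pairP; split; first exact: measurable_fst.
  by apply: measurable_funD => //; exact: measurable_funM.
have -> : rot2 c s = s1 \o s2 \o s1.
  apply/funext => -[x y]; rewrite /rot2 /s1 /s2 /= /k.
  have cs' : (c * c + s * s = 1)%R by rewrite -!expr2.
  congr pair; last by field.
  apply: (mulfI s0); transitivity
    (s * (c * x) + ((c * c + s * s) - 1) * y - s * s * y)%R.
    by rewrite cs'; ring.
  by field.
have m1 : measurable_fun setT (fun z => H (s1 z)) by exact: measurableT_comp.
have m12 : measurable_fun setT (fun z => H (s1 (s2 z))).
  exact: (measurableT_comp m1 ms2).
have H1 z : 0 <= H (s1 z) by [].
have H12 z : 0 <= H (s1 (s2 z)) by [].
by rewrite -(integral_shear1 k mH H0) -(integral_shear2 s m1 H1)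
  -(integral_shear1 k m12 H12).
Qed.

Lemma ge0_integral_gauss2 (H : RB * RB -> \bar R) :
  measurable_fun setT H -> (forall z, 0 <= H z) ->
  \int[gauss]_x \int[gauss]_y H (x, y) =
  \int[mxm]_z (H z * (normal_pdf 0 1 (z.1 : R) * normal_pdf 0 1 (z.2 : R))%:E).
Proof.
move=> mH H0.
have mp (f : RB * RB -> RB) : measurable_fun setT f ->
    measurable_fun setT (fun z => normal_pdf (0 : R) 1 (f z)).
  by apply: measurableT_comp; exact: measurable_normal_pdf.
have mHp : measurable_fun setT (fun z => H z *
    (normal_pdf 0 1 (z.1 : R) * normal_pdf 0 1 (z.2 : R))%:E).
  apply: emeasurable_funM => //; apply/measurable_EFinP/measurable_funM.
    exact: mp measurable_fst.
  exact: mp measurable_snd.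
have Hp0 z : 0 <= H z * (normal_pdf 0 1 (z.1 : R) * normal_pdf 0 1 (z.2 : R))%:E.
  by rewrite mule_ge0// lee_fin mulr_ge0// normal_pdf_ge0.
have mx x : measurable_fun setT (fun y => H (x, y)).
  by apply: measurableT_comp => //; exact: measurable_pair1.
rewrite fubini_tonelli1// ge0_integral_gauss//; last 2 first.
- exact: (@measurable_fun_fubini_tonelli_F _ _ _ _ _ gauss _ mH H0).
- by move=> x; exact: integral_ge0.
apply: eq_integral => x _; rewrite /fubini_F ge0_integral_gauss//; last exact: mx.
rewrite -ge0_integralZr//=.
- by apply: eq_integral => y _; rewrite -muleA -EFinM [(_ * normal_pdf 0 1 x)%R]mulrC.
- apply: emeasurable_funM => //.
  by apply/measurable_EFinP; exact: measurable_normal_pdf.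
- by move=> y _; rewrite mule_ge0// lee_fin normal_pdf_ge0.
- by rewrite lee_fin normal_pdf_ge0.
Qed.

Lemma gauss_rot2 (H : RB * RB -> \bar R) (c s : R) :
  (c ^+ 2 + s ^+ 2 = 1)%R -> s != 0%R ->
  measurable_fun setT H -> (forall z, 0 <= H z) ->
  \int[gauss]_x \int[gauss]_y H (rot2 c s (x, y)) =
  \int[gauss]_x \int[gauss]_y H (x, y).
Proof.
move=> cs s0 mH H0.
rewrite (ge0_integral_gauss2 mH H0).
rewrite (@ge0_integral_gauss2 (fun z => H (rot2 c s z)))//; last first.
  by apply: measurableT_comp => //; exact: measurable_rot2.
have mp (f : RB * RB -> RB) : measurable_fun setT f ->
    measurable_fun setT (fun z => normal_pdf (0 : R) 1 (f z)).
  by apply: measurableT_comp; exact: measurable_normal_pdf.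
pose Hp z := H z * (normal_pdf 0 1 (z.1 : R) * normal_pdf 0 1 (z.2 : R))%:E.
have mHp : measurable_fun setT Hp.
  apply: emeasurable_funM => //; apply/measurable_EFinP/measurable_funM.
    exact: mp measurable_fst.
  exact: mp measurable_snd.
have Hp0 z : 0 <= Hp z.
  by rewrite mule_ge0// lee_fin mulr_ge0// normal_pdf_ge0.
transitivity (\int[mxm]_z Hp (rot2 c s z)); last exact: integral_rot2.
apply: eq_integral => -[x y] _; congr (_ * _%:E).
rewrite !normal_pdf01E /rot2/= mulrACA -expRD [RHS]mulrACA -expRD.
congr (_ * expR _)%R.
transitivity (- (c ^+ 2 + s ^+ 2) * x ^+ 2 / 2 - (c ^+ 2 + s ^+ 2) * y ^+ 2 / 2)%R.
  by rewrite cs; ring.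
by ring.
Qed.

End shear.

Section orthogonal.
Context {R : realType}.
Local Notation RB := (measurableTypeR R).
Local Notation gauss := (normal_prob (0 : R) 1).

Definition unvec n (v : 'cV[R]_n) : n.-tuple RB := [tuple v i 0 | i < n].

Definition act n (O : 'M[R]_n) (t : n.-tuple RB) : n.-tuple RB :=
  unvec (O *m vec (t : n.-tuple R)).

Lemma vecK n (v : 'cV[R]_n) : vec (unvec v : n.-tuple R) = v.
Proof. by apply/colP => i; rewrite mxE tnth_mktuple. Qed.

Lemma unvecK n (t : n.-tuple RB) : unvec (vec (t : n.-tuple R)) = t.
Proof. by apply: eq_from_tnth => i; rewrite tnth_mktuple mxE. Qed.

Lemma act1 n (t : n.-tuple RB) : act 1%:M t = t.
Proof. by rewrite /act mul1mx unvecK. Qed.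

Lemma actM n (O1 O2 : 'M[R]_n) t : act (O1 *m O2) t = act O1 (act O2 t).
Proof. by rewrite /act vecK mulmxA. Qed.

Lemma measurable_act n (O : 'M[R]_n) : measurable_fun setT (act O).
Proof.
apply/measurable_fun_tnthP => i.
rewrite (_ : _ \o _ = fun t : n.-tuple RB => \sum_j O i j * (tnth t j : R)).
  apply: measurable_sum => j; apply: measurable_funM => //.
  exact: measurable_tnth.
apply/funext => t /=; rewrite tnth_mktuple mxE.
by apply: eq_bigr => j _; rewrite mxE.
Qed.

Lemma vec_cons n (x : RB) (t : n.-tuple RB) :
  vec ([tuple of x :: t] : n.+1.-tuple R) =
  col_mx (x : R)%:M (vec (t : n.-tuple R)) :> 'cV[R]_(1 + n).
Proof.
apply/colP => i; rewrite !mxE; case: splitP => j ij; rewrite mxE.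
  by rewrite ord1 eqxx mulr1n (_ : i = ord0) ?tnth0//; apply: val_inj; rewrite /= ij ord1.
by rewrite (_ : i = lift ord0 j) ?tnthS//; apply: val_inj; rewrite /= ij.
Qed.

Lemma unvec_col_mx n (x : R) (v : 'cV[R]_n) :
  unvec (col_mx x%:M v : 'cV[R]_(1 + n)) = [tuple of (x : RB) :: unvec v].
Proof. by rewrite -[RHS]unvecK vec_cons vecK. Qed.

(** Every orthogonal matrix preserves the standard Gaussian law, but it is enough to
    know it for products of plane rotations and permutations, since these already
    diagonalise symmetric matrices. *)
Definition gauss_orthogonal n (O : 'M[R]_n) : Prop :=
  O^T *m O = 1%:M /\
  forall F : n.-tuple RB -> \bar R, measurable_fun setT F ->
    (forall t, 0 <= F t)%E ->
    (\int[gauss_tuple n]_t F (act O t) = \int[gauss_tuple n]_t F t)%E.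

Lemma gauss_orthogonal1 n : gauss_orthogonal (1%:M : 'M[R]_n).
Proof.
split; first by rewrite trmx1 mul1mx.
by move=> F mF F0; apply: eq_integral => t _; rewrite act1.
Qed.

Lemma gauss_orthogonalM n (O1 O2 : 'M[R]_n) :
  gauss_orthogonal O1 -> gauss_orthogonal O2 -> gauss_orthogonal (O1 *m O2).
Proof.
move=> [oO1 I1] [oO2 I2]; split.
  by rewrite trmx_mul mulmxA -(mulmxA O2^T) oO1 mulmx1.
move=> F mF F0; under eq_integral do rewrite actM.
rewrite (I2 (fun t => F (act O1 t)))//; first exact: I1.
by apply: measurableT_comp => //; exact: measurable_act.
Qed.

Lemma gauss_orthogonal_block n (O : 'M[R]_n) : gauss_orthogonal O ->
  gauss_orthogonal (block_mx 1 0 0 O : 'M[R]_(1 + n)).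
Proof.
move=> [oO IO]; split.
  rewrite tr_block_mx !trmx0 trmx1 mulmx_block !mul0mx !mulmx0 !mul1mx !addr0 add0r.
  by rewrite oO -scalar_mx_block.
have actE (x : RB) (t : n.-tuple RB) : act (block_mx 1 0 0 O : 'M[R]_(1 + n)) [tuple of x :: t] =
    [tuple of x :: act O t].
  by rewrite /act vec_cons mul_block_col mul1mx !mul0mx addr0 add0r unvec_col_mx.
move=> F mF F0.
have mFa : measurable_fun setT (fun t => F (act (block_mx 1 0 0 O : 'M[R]_(1 + n)) t)).
  by apply: measurableT_comp => //; exact: measurable_act.
rewrite (ge0_integral_gauss_tupleS mF F0).
rewrite (ge0_integral_gauss_tupleS mFa (fun t => F0 _)).
apply: eq_integral => x _; under eq_integral do rewrite actE.
rewrite (IO (fun t => F [tuple of x :: t]))//.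
by apply: measurableT_comp => //; exact: measurable_tuple_cons.
Qed.

Definition plane_rotation n (c s : R) : 'M[R]_(1 + (1 + n)) :=
  block_mx c%:M (row_mx (- s)%:M 0) (col_mx s%:M 0) (block_mx c%:M 0 0 1%:M).

Lemma plane_rotation_col n (c s x y : R) (v : 'cV[R]_n) :
  plane_rotation n c s *m col_mx x%:M (col_mx y%:M v) =
  col_mx (c * x - s * y)%:M (col_mx (s * x + c * y)%:M v).
Proof.
rewrite mul_block_col mul_row_col mul_col_mx mul_block_col !mul0mx !addr0 add0r.
rewrite mul1mx add_col_mx add0r -!scalar_mxM -!raddfD/=.
by rewrite mulNr.
Qed.

Lemma mulmx_col_ext n m (M1 M2 : 'M[R]_(m, n)) :
  (forall v : 'cV_n, M1 *m v = M2 *m v) -> M1 = M2.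
Proof.
move=> H; apply/matrixP => i j; have := congr1 (fun v : 'cV[R]_m => v i 0) (H (delta_mx j 0)).
by rewrite -!colE !mxE.
Qed.

Lemma gauss_orthogonal_plane n (c s : R) : c ^+ 2 + s ^+ 2 = 1 -> s != 0 ->
  gauss_orthogonal (plane_rotation n c s).
Proof.
move=> cs s0; split.
  have -> : (plane_rotation n c s)^T = plane_rotation n c (- s).
    rewrite /plane_rotation tr_block_mx tr_row_mx tr_col_mx tr_block_mx.
    by rewrite !tr_scalar_mx !trmx0 opprK.
  apply: mulmx_col_ext => v; rewrite mul1mx -mulmxA.
  rewrite -(vsubmxK v) -(vsubmxK (dsubmx v)) (mx11_scalar (usubmx v)).
  rewrite (mx11_scalar (usubmx (dsubmx v))) !plane_rotation_col.
  set x := usubmx v 0 0; set y := usubmx _ 0 0.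
  congr (col_mx _%:M (col_mx _%:M _)).
    by transitivity ((c ^+ 2 + s ^+ 2) * x); [ring|rewrite cs mul1r].
  by transitivity ((c ^+ 2 + s ^+ 2) * y); [ring|rewrite cs mul1r].
pose G := plane_rotation n c s.
pose cons2 (p : (RB * RB) * n.-tuple RB) : n.+2.-tuple RB :=
  [tuple of p.1.1 :: [tuple of p.1.2 :: p.2]].
have mcons2 : measurable_fun setT cons2.
  apply: measurable_cons.
    by apply: measurableT_comp; exact: measurable_fst.
  apply: measurable_cons; last exact: measurable_snd.
  by apply: measurableT_comp; [exact: measurable_snd|exact: measurable_fst].
have cons2E F : measurable_fun setT F -> (forall t, 0 <= F t)%E ->
    (\int[gauss_tuple n.+2]_t F t = \int[gauss]_x \int[gauss]_y
      \int[gauss_tuple n]_t F (cons2 ((x, y), t)))%E.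
  move=> mF F0; rewrite (ge0_integral_gauss_tupleS mF F0).
  apply: eq_integral => x _.
  rewrite (@ge0_integral_gauss_tupleS _ _ (fun t => F [tuple of x :: t]))//.
  by apply: measurableT_comp => //; exact: measurable_tuple_cons.
move=> F mF F0.
have mFa : measurable_fun setT (fun t => F (act G t)).
  by apply: measurableT_comp => //; exact: measurable_act.
rewrite (cons2E _ mF F0) (cons2E _ mFa (fun t => F0 _)).
pose H (z : RB * RB) := (\int[gauss_tuple n]_t F (cons2 (z, t)))%E.
have mH : measurable_fun setT H.
  apply: (@measurable_fun_fubini_tonelli_F _ _ _ _ _ (gauss_tuple n)
    (fun p => F (cons2 p))) => //.
  exact: measurableT_comp.
have H0 z : (0 <= H z)%E by exact: integral_ge0.
rewrite -(gauss_rot2 cs s0 mH H0).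
apply: eq_integral => x _; apply: eq_integral => y _; apply: eq_integral => t _.
congr F; rewrite /cons2 /act vec_cons.
have -> : vec ([tuple of y :: t] : n.+1.-tuple R) = col_mx (y : R)%:M (vec (t : n.-tuple R)).
  exact: vec_cons.
rewrite plane_rotation_col unvec_col_mx; congr [tuple of _ :: _].
by rewrite unvec_col_mx unvecK.
Qed.

End orthogonal.

(** * Diagonalisation by matrices preserving the Gaussian law *)

Section spectral.
Context {R : realType}.

(** Over the complex numbers there is an eigenvector [u + i * v], of eigenvalue
    [a + i * b]. Symmetry computes [u *m S *m v^T] in two ways, which forces
    [b * (|u| ^+ 2 + |v| ^+ 2) = 0], so [u] and [v] are real eigenvectors. *)
Lemma real_symmetric_eigenvector n (S : 'M[R]_n.+1) : S^T = S ->
  exists (a : R) (v : 'cV[R]_n.+1), v != 0 /\ S *m v = a *: v.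
Proof.
move=> symS; pose toC := real_complex R.
have [z /eigenvalueP[w wS w0]] :=
  @spectral.eigenvalue_closed (complex R) n.+1 (map_mx toC S) isT.
pose u := map_mx (@complex.Re R) w; pose v := map_mx (@complex.Im R) w.
pose a := complex.Re z; pose b := complex.Im z.
have ReD (x y : complex R) : complex.Re (x + y) = complex.Re x + complex.Re y.
  by case: x y => [? ?] [].
have ImD (x y : complex R) : complex.Im (x + y) = complex.Im x + complex.Im y.
  by case: x y => [? ?] [].
have ReM (x : complex R) (s : R) : complex.Re (x * toC s) = complex.Re x * s.
  by case: x => x1 x2 /=; rewrite mulr0 subr0.
have ImM (x : complex R) (s : R) : complex.Im (x * toC s) = complex.Im x * s.
  by case: x => x1 x2 /=; rewrite mulr0 add0r.
have wk k : \sum_j w 0 j * toC (S j k) = z * w 0 k.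
  have := congr1 (fun m : 'rV_n.+1 => m 0 k) wS; rewrite !mxE => <-.
  by apply: eq_bigr => j _; rewrite mxE.
have uS : u *m S = a *: u - b *: v.
  apply/rowP => k; have := congr1 (@complex.Re R) (wk k).
  rewrite (big_morph (@complex.Re R) ReD erefl) !mxE => H.
  transitivity (\sum_j complex.Re (w 0 j * toC (S j k))).
    by apply: eq_bigr => j _; rewrite mxE ReM.
  by rewrite H /a /b; case: (z) => z1 z2; case: (w 0 k).
have vS : v *m S = a *: v + b *: u.
  apply/rowP => k; have := congr1 (@complex.Im R) (wk k).
  rewrite (big_morph (@complex.Im R) ImD erefl) !mxE => H.
  transitivity (\sum_j complex.Im (w 0 j * toC (S j k))).
    by apply: eq_bigr => j _; rewrite mxE ImM.
  by rewrite H /a /b; case: (z) => z1 z2; case: (w 0 k).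
have sq0 (x : 'rV[R]_n.+1) : 0 <= (x *m x^T) 0 0.
  by rewrite mxE sumr_ge0// => j _; rewrite mxE -expr2 sqr_ge0.
have sq_eq0 (x : 'rV[R]_n.+1) : (x *m x^T) 0 0 = 0 -> x = 0.
  rewrite mxE => /eqP; rewrite psumr_eq0 => [/allP H|j _]; last first.
    by rewrite mxE -expr2 sqr_ge0.
  apply/rowP => j; have := H j; rewrite mem_index_enum !mxE => /(_ isT).
  by rewrite mulf_eq0 orbb => /eqP.
have uv0 : ~ (u = 0 /\ v = 0).
  move=> [u0 v0]; move/eqP: w0; apply; apply/rowP => k; rewrite mxE.
  have := congr1 (fun m : 'rV[R]_n.+1 => m 0 k) u0.
  have := congr1 (fun m : 'rV[R]_n.+1 => m 0 k) v0; rewrite !mxE.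
  by case: (w 0 k) => ? ? /= -> ->.
have b0 : b = 0.
  have E1 : u *m S *m v^T = a *: (u *m v^T) - b *: (v *m v^T).
    by rewrite uS mulmxBl -!scalemxAl.
  have E2 : u *m S *m v^T = a *: (u *m v^T) + b *: (u *m u^T).
    rewrite -mulmxA -{1}symS -trmx_mul vS.
    have -> : (a *: v + b *: u)^T = a *: v^T + b *: u^T.
      by apply/matrixP => i j; rewrite !mxE.
    by rewrite mulmxDr -!scalemxAr.
  have : b *: (u *m u^T + v *m v^T) = 0.
    have /addrI E := etrans (esym E1) E2.
    by rewrite scalerDr -E addNr.
  have := sq0 u; have := sq0 v; have := sq_eq0 u; have := sq_eq0 v.
  move: (u *m u^T) (v *m v^T) => X Y v0 u0 Y0 X0.
  move=> /(congr1 (fun m : 'M[R]_1 => m 0 0)); rewrite !mxE => /eqP.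
  rewrite mulf_eq0 => /predU1P[//|]; rewrite paddr_eq0// => /andP[/eqP uu /eqP vv].
  by case: uv0; split; [exact: u0|exact: v0].
move: uS vS; rewrite b0 !scale0r subr0 addr0 => uS vS.
have tr (x : 'rV[R]_n.+1) : x *m S = a *: x -> S *m x^T = a *: x^T.
  by move=> xS; rewrite -{1}symS -trmx_mul xS; apply/matrixP => i j; rewrite !mxE.
have [u0|u0] := eqVneq u 0.
  exists a, v^T; split; last exact: tr.
  by rewrite trmx_eq0; apply/eqP => v0; exact: uv0.
by exists a, u^T; split; [rewrite trmx_eq0|exact: tr].
Qed.

Local Notation e1 := (col_mx 1%:M 0 : 'cV[R]_(1 + _)).

(** By induction: rotate the tail of [u] onto its first axis, then rotate the plane of
    the first two axes. The sign [e] appears in dimension 1, where there is nothing to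
    rotate. *)
Lemma gauss_orthogonal_unit n (u : 'cV[R]_(1 + n)) : u^T *m u = 1%:M ->
  exists2 O, gauss_orthogonal O & exists2 e : R, e ^+ 2 = 1 & O *m e1 = e *: u.
Proof.
elim: n u => [u uu|n IH u uu].
  exists 1%:M; first exact: gauss_orthogonal1.
  have u2 : u 0 0 ^+ 2 = 1.
    have := congr1 (fun m : 'M[R]_1 => m 0 0) uu.
    by rewrite !mxE big_ord1 mxE expr2 eqxx.
  exists (u 0 0) => //; rewrite mul1mx.
  apply/colP => i; rewrite !mxE (ord1 i) -expr2 u2.
  by case: splitP => // j _; rewrite mxE (ord1 j) eqxx.
have [x [w uE]] : exists (x : R) (w : 'cV[R]_(1 + n)), u = col_mx x%:M w.
  by exists (usubmx u 0 0), (dsubmx u); rewrite -mx11_scalar vsubmxK.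
have xw : (x ^+ 2)%:M + w^T *m w = 1%:M.
  by rewrite -uu uE tr_col_mx mul_row_col tr_scalar_mx -scalar_mxM expr2.
pose q := (w^T *m w) 0 0.
have wwq : w^T *m w = q%:M by rewrite [LHS]mx11_scalar.
have xq : x ^+ 2 + q = 1.
  have := congr1 (fun m : 'M[R]_1 => m 0 0) xw.
  by rewrite /= wwq !mxE eqxx !mulr1n.
have qE : q = \sum_i w i 0 ^+ 2.
  by rewrite /q mxE; apply: eq_bigr => i _; rewrite mxE expr2.
have q0 : 0 <= q by rewrite qE sumr_ge0// => i _; exact: sqr_ge0.
have [q0'|qn0] := eqVneq q 0.
  have w0 : w = 0.
    apply/colP => i; move: q0'; rewrite qE => /eqP.
    rewrite psumr_eq0 => [/allP H|j _]; last exact: sqr_ge0.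
    have := H i; rewrite mem_index_enum mxE => /(_ isT).
    by rewrite sqrf_eq0 => /eqP.
  exists 1%:M; first exact: gauss_orthogonal1.
  have x2 : x ^+ 2 = 1 by rewrite -xq q0' addr0.
  exists x => //; rewrite mul1mx uE w0 scale_col_mx scaler0.
  by rewrite -[x *: _]mul_scalar_mx -scalar_mxM -expr2 x2.
pose l := Num.sqrt q.
have l0 : l != 0 by rewrite sqrtr_eq0 -ltNge lt0r qn0.
have l2 : l ^+ 2 = q by rewrite sqr_sqrtr.
have [| O oO [e e2 Oe]] := IH (l^-1 *: w).
  have -> : (l^-1 *: w)^T = l^-1 *: w^T by apply/matrixP => i j; rewrite !mxE.
  rewrite -scalemxAl -scalemxAr scalerA wwq -mul_scalar_mx -scalar_mxM.
  by rewrite -expr2 exprVn l2 mulVf.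
have e0 : e != 0 by rewrite -sqrf_eq0 e2 oner_eq0.
have cs : x ^+ 2 + (l * e) ^+ 2 = 1 by rewrite exprMn e2 mulr1 l2.
exists (block_mx 1 0 0 O *m plane_rotation n x (l * e)).
  apply: gauss_orthogonalM; first exact: gauss_orthogonal_block.
  by apply: gauss_orthogonal_plane => //; rewrite mulf_neq0.
exists 1; first by rewrite expr1n.
rewrite scale1r uE -mulmxA.
have -> : (col_mx 1%:M 0 : 'cV[R]_(1 + (1 + n))) = col_mx 1%:M (col_mx 0%:M 0).
  by rewrite raddf0 col_mx0.
rewrite plane_rotation_col !mulr0 subr0 addr0 !mulr1.
rewrite mul_block_col mul1mx !mul0mx addr0 add0r; congr col_mx.
have -> : col_mx (l * e)%:M 0 = (l * e) *: e1 :> 'cV[R]_(1 + n).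
  by rewrite scale_col_mx scaler0 -mul_scalar_mx -scalar_mxM mulr1.
rewrite -scalemxAr Oe !scalerA.
have -> : l * e * e / l = 1 by rewrite -[l * e * e]mulrA -expr2 e2 mulr1 divff.
by rewrite scale1r.
Qed.

Lemma unit_eigenvector n (S : 'M[R]_(1 + n)) : S^T = S ->
  exists (a : R) (v : 'cV[R]_(1 + n)), v^T *m v = 1%:M /\ S *m v = a *: v.
Proof.
move=> symS; have [a [v [v0 Sv]]] := real_symmetric_eigenvector symS.
pose q := (v^T *m v) 0 0.
have vvq : v^T *m v = q%:M by rewrite [LHS]mx11_scalar.
have qE : q = \sum_i v i 0 ^+ 2.
  by rewrite /q mxE; apply: eq_bigr => i _; rewrite mxE expr2.
have q0 : 0 <= q by rewrite qE sumr_ge0// => i _; exact: sqr_ge0.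
have qn0 : q != 0.
  apply: contra v0 => /eqP; rewrite qE => /eqP.
  rewrite psumr_eq0 => [/allP H|j _]; last exact: sqr_ge0.
  apply/eqP/colP => i; have := H i; rewrite mem_index_enum mxE => /(_ isT).
  by rewrite sqrf_eq0 => /eqP.
pose l := Num.sqrt q.
have l2 : l ^+ 2 = q by rewrite sqr_sqrtr.
exists a, (l^-1 *: v); split; last by rewrite -scalemxAr Sv !scalerA mulrC.
have -> : (l^-1 *: v)^T = l^-1 *: v^T by apply/matrixP => i j; rewrite !mxE.
rewrite -scalemxAl -scalemxAr scalerA vvq -mul_scalar_mx -scalar_mxM.
by rewrite -expr2 exprVn l2 mulVf.
Qed.

(** Deflation: a unit eigenvector is sent to the first axis, where symmetry leaves a
    block diagonal matrix. *)
Theorem gauss_orthogonal_diagonalisation n (S : 'M[R]_n) : S^T = S ->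
  exists2 O, gauss_orthogonal O & exists d : 'rV[R]_n, O^T *m S *m O = diag_mx d.
Proof.
elim: n S => [S _|n IH S symS].
  exists 1%:M; first exact: gauss_orthogonal1.
  by exists 0; apply/matrixP => -[].
have [a [v [vv Sv]]] := unit_eigenvector symS.
have [ O gO [e e2 Oe]] := gauss_orthogonal_unit vv.
have oO := gO.1.
pose S1 : 'M[R]_(1 + n) := O^T *m S *m O.
have symS1 : S1^T = S1 by rewrite /S1 !trmx_mul trmxK symS mulmxA.
have S1e : S1 *m e1 = a *: e1.
  by rewrite /S1 -!mulmxA Oe -scalemxAr Sv scalerA mulrC -scalerA -Oe -scalemxAr
    mulmxA oO mul1mx.
have S1E : S1 = block_mx a%:M 0 0 (drsubmx S1).
  move: S1e; rewrite -[in X in X -> _](submxK S1) mul_block_col !mulmx0 !mulmx1 !addr0.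
  rewrite scale_col_mx scaler0 => /eq_col_mx[ulE dlE].
  rewrite -[LHS]submxK ulE dlE -[a *: _]mul_scalar_mx mulmx1; congr block_mx.
  by rewrite -[ursubmx S1]trmxK trmx_ursub symS1 dlE trmx0.
have [| O' gO' [d dE]] := IH (drsubmx S1).
  by rewrite trmx_drsub symS1.
exists (O *m block_mx 1 0 0 O').
  by apply: gauss_orthogonalM => //; exact: gauss_orthogonal_block.
exists (row_mx a%:M d); rewrite trmx_mul.
rewrite (_ : _ *m S *m _ = (block_mx 1 0 0 O')^T *m S1 *m block_mx 1 0 0 O').
  rewrite S1E tr_block_mx !trmx0 trmx1 !mulmx_block !mul0mx !mulmx0 !mul1mx !mulmx1.
  rewrite !addr0 !add0r !mul0mx dE.
  have E := diag_mx_row (a%:M : 'rV[R]_1) d.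
  apply: etrans (esym E); congr block_mx.
  by apply/matrixP => i j; rewrite !mxE !ord1 eqxx.
by rewrite /S1 !mulmxA.
Qed.

End spectral.

(** * The joint law of two independent Gaussian vectors *)

Section law.
Context {R : realType}.
Local Notation RB := (measurableTypeR R).
Local Notation gauss := (normal_prob (0 : R) 1).
Context d (T : measurableType d) (P : probability T R).

Definition box n (B : 'I_n -> set RB) : set (n.-tuple RB) :=
  [set t | forall i, B i (tnth t i)].

Lemma measurable_box n (B : 'I_n -> set RB) : (forall i, measurable (B i)) ->
  measurable (box B).
Proof.
move=> mB; rewrite (_ : box B = \bigcap_(i in [set: 'I_n]) ((fun t => tnth t i) @^-1` B i)).
  apply: fin_bigcap_measurable => //= i _.
  by rewrite -[X in measurable X]setTI; exact: measurable_tnth.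
by apply/seteqP; split => t tB i //=; exact: tB.
Qed.

Lemma gauss_tuple_box n (B : 'I_n -> set RB) : (forall i, measurable (B i)) ->
  (gauss_tuple n (box B) = \prod_(i < n) gauss (B i))%E.
Proof.
elim: n B => [B mB|n IH B mB].
  rewrite big_ord0 /= (_ : box B = setT); last by apply/seteqP; split => // t _ [].
  by rewrite /dirac indicT.
rewrite big_ord_recl -IH// /= /distribution /pushforward.
rewrite (_ : _ @^-1` _ = B ord0 `*` box (fun i => B (lift ord0 i))).
  by rewrite product_measure1E//; exact: measurable_box.
apply/seteqP; split => [[x t] /= Bxt|[x t] /= [Bx Bt] i].
  split; first by have := Bxt ord0; rewrite tnth0.
  by move=> i; have := Bxt (lift ord0 i); rewrite tnthS.
have [->|[j ->]] : i = ord0 \/ exists j, i = lift ord0 j.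
  by case: (unliftP ord0 i) => [j ->|->]; [right; exists j|left].
- by rewrite tnth0.
- by rewrite tnthS.
Qed.

Lemma measurable_tuple_RB n (X : {RV P >-> n.-tuple R}) :
  measurable_fun setT (X : T -> n.-tuple RB).
Proof. have := @measurable_funPT _ _ _ _ X. by []. Qed.

(** Boxes form a pi-system generating the product sigma-algebra. *)
Lemma std_gaussian_law n (X : {RV P >-> n.-tuple R}) : std_gaussian_vector X ->
  forall A : set (n.-tuple RB), measurable A ->
  P (X @^-1` A) = gauss_tuple n A.
Proof.
move=> GX; have mX := measurable_tuple_RB X.
pose X' : {mfun T >-> n.-tuple RB} := HB.pack (X : T -> n.-tuple RB)
  (isMeasurableFun.Build _ _ _ _ (X : T -> n.-tuple RB) mX).
pose G := [set A | exists2 B : 'I_n -> set RB, (forall i, measurable (B i)) & A = box B].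
move=> A mA.
apply: (measure_unique G (fun=> setT) _ _ _ _ (distribution P X') (gauss_tuple n)) mA => //.
- apply/seteqP; split.
    apply: smallest_sub; first exact: smallest_sigma_algebra.
    move=> C; rewrite -bigcup_seq => -[i _ [B mB <-]]; apply: sub_sigma_algebra.
    exists (fun j => if j == i then B else setT).
      by move=> j; case: ifP.
    apply/seteqP; split => [t [_ Bt] j|t Bt].
      by case: eqP => // ->.
    by split => //; have := Bt i; rewrite eqxx.
  apply: smallest_sub; first exact: sigma_algebra_measurable.
  by move=> C [B mB ->]; exact: measurable_box.
- move=> _ _ [B mB ->] [C mC ->]; exists (fun i => B i `&` C i).
    by move=> i; exact: measurableI.
  apply/seteqP; split => [t [Bt Ct] i|t BC]; first by split.
  by split => i; case: (BC i).
- by move=> _; exists (fun=> setT) => //; apply/seteqP; split.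
- by rewrite bigcup_const//; exists 0%N.
- by move=> C [B mB ->]; exact: etrans (GX B mB) (esym (gauss_tuple_box mB)).
- by move=> _; rewrite (le_lt_trans (probability_le1 _ _))// ltry.
Qed.

Lemma independent_gaussian_law n (X1 X2 : {RV P >-> n.-tuple R}) :
  std_gaussian_vector X1 -> std_gaussian_vector X2 -> independent_RV X1 X2 ->
  forall E : set (n.-tuple RB * n.-tuple RB), measurable E ->
  P [set w | E (X2 w, X1 w)] = (\int[gauss_tuple n]_t gauss_tuple n (xsection E t))%E.
Proof.
move=> G1 G2 I12 E mE.
have mX : measurable_fun setT ((fun w => (X2 w, X1 w)) : T -> n.-tuple RB * n.-tuple RB).
  by apply/measurable_fun_pairP; split; exact: measurable_tuple_RB.
pose X : {mfun T >-> (n.-tuple RB * n.-tuple RB)%type} := HB.pack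
  ((fun w => (X2 w, X1 w)) : T -> n.-tuple RB * n.-tuple RB)
  (isMeasurableFun.Build _ _ _ _ _ mX).
rewrite -[RHS]/((gauss_tuple n \x gauss_tuple n)%E E).
rewrite (@product_measure_unique _ _ _ _ R (gauss_tuple n) (gauss_tuple n)
  (distribution P X))// => A B mA mB.
have H := I12 B A mB mA.
rewrite (std_gaussian_law G1 mB) (std_gaussian_law G2 mA) in H.
by apply: etrans (etrans H (muleC _ _)); rewrite setIC.
Qed.

End law.

(** * Affine and quadratic changes of variables *)

Section affine.
Context {R : realType}.
Local Notation RB := (measurableTypeR R).
Local Notation mu := (@lebesgue_measure R).
Local Notation gauss := (normal_prob (0 : R) 1).

Definition reflect_scale (b k : R) (t : RB) : RB := (b - t) / k.

Lemma measurable_reflect_scale b k : measurable_fun setT (reflect_scale b k).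
Proof. by apply: measurable_funM => //; exact: measurable_funB. Qed.

HB.instance Definition _ b k := isMeasurableFun.Build _ _ _ _
  (reflect_scale b k) (measurable_reflect_scale b k).

Lemma lebesgue_reflect_scale (b k : R) (A : set RB) : 0 < k -> measurable A ->
  (mu (reflect_scale b k @^-1` A) = k%:E * mu A)%E.
Proof.
move=> k0 mA; have kV0 : 0 <= k^-1 by rewrite invr_ge0 ltW.
pose m : {measure set RB -> \bar R} := mscale (NngNum kV0)
  (measure_function_pushforward__canonical__measure_function_Measure mu
    (measurable_reflect_scale b k)).
have -> : mu A = m A.
  apply: lebesgue_measure_unique => // _ [[a c]] _ <-.
  transitivity (k^-1%:E * mu (reflect_scale b k @^-1` `]a, c]))%E; last by [].
  rewrite (_ : _ @^-1` _ = `[b - k * c, b - k * a[%classic); last first.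
    apply/seteqP; split => t /=; rewrite !in_itv/= /reflect_scale ltr_pdivlMr//
      ler_pdivrMr// => /andP[h1 h2]; apply/andP; split; lra.
  rewrite !lebesgue_measure_itv/= !lte_fin ltrD2l ltrN2 ltr_pM2l//.
  case: ifP => _; last by rewrite mule0.
  by rewrite -!EFinB -EFinM; congr EFin; field; rewrite gt_eqF.
rewrite -[m A]/(k^-1%:E * mu (reflect_scale b k @^-1` A))%E.
by rewrite muleA -EFinM divff ?mul1e// gt_eqF.
Qed.

Lemma integral_reflect_scale (b k : R) (D : set RB) (f : RB -> \bar R) :
  0 < k -> measurable D -> measurable_fun setT f -> mu.-integrable D f ->
  (\int[mu]_(t in reflect_scale b k @^-1` D) f (reflect_scale b k t) =
   k%:E * \int[mu]_(x in D) f x)%E.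
Proof.
move=> k0 mD mf fi.
have k0' : 0 <= k by exact: ltW.
have E (A : set RB) : measurable A -> A `<=` D ->
    pushforward mu (reflect_scale b k) A = mscale (NngNum k0') mu A.
  by move=> mA _; rewrite /pushforward /mscale/= lebesgue_reflect_scale.
have E2 (g : RB -> \bar R) : measurable_fun setT g -> (forall x, 0 <= g x)%E ->
    (\int[mu]_(t in reflect_scale b k @^-1` D) g (reflect_scale b k t) =
     k%:E * \int[mu]_(x in D) g x)%E.
  move=> mg g0.
  rewrite -[LHS](@ge0_integral_pushforward _ _ _ _ R _
    (measurable_reflect_scale b k) mu D g)//; last exact: measurable_funTS.
  rewrite (eq_measure_integral (mscale (NngNum k0') mu)) => [|A mA AD]; last exact: E.
  by rewrite ge0_integral_mscale//; exact: measurable_funTS.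
rewrite integralE [in RHS]integralE muleBr//; last first.
  by apply: fin_num_adde_defl; rewrite fin_numN; exact: integrable_neg_fin_num.
rewrite -(E2 _ (measurable_funepos mf) (fun x => funepos_ge0 f x)).
rewrite -(E2 _ (measurable_funeneg mf) (fun x => funeneg_ge0 f x)).
by rewrite -/(f \o reflect_scale b k) funepos_comp funeneg_comp.
Qed.

(** For every nonzero [y], the set of scales [c] with [c * y ^+ 2 \in N] is null. By
    Tonelli, [c * y ^+ 2 \in N] for almost no [y], for almost every scale [c]; and the
    sets of such [y] for two positive scales are dilations of each other. *)
Lemma lebesgue_null_sq (N : set RB) : measurable N -> mu N = 0%E ->
  mu ((fun y : RB => (y : R) ^+ 2) @^-1` N) = 0%E.
Proof.
move=> mN N0; set M := _ @^-1` N.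
have mM : measurable M.
  by rewrite -[M]setTI; exact: (@measurable_sq R).
have mp : measurable_fun setT (fun z : RB * RB => ((z.1 : R) * (z.2 : R) ^+ 2 : RB)).
  apply: measurable_funM; first exact: measurable_fst.
  by apply: measurable_funX; exact: measurable_snd.
pose E := (fun z : RB * RB => ((z.1 : R) * (z.2 : R) ^+ 2 : RB)) @^-1` N.
have mE : measurable E by rewrite -[E]setTI; exact: mp.
pose f (z : RB * RB) : \bar R := (\1_E z)%:E.
have mf : measurable_fun setT f by apply/measurable_EFinP; exact: measurable_indic.
have f0 z : (0 <= f z)%E by rewrite lee_fin.
have I1 c : (\int[mu]_y f (c, y) = mu (xsection E c))%E.
  rewrite -[in RHS](setTI (xsection E c)) setIC -integral_indic//; last exact: measurable_xsection.
  by apply: eq_integral => y _; rewrite /f !indicE mem_xsection.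
have I2 y : (\int[mu]_c f (c, y) = mu (ysection E y))%E.
  rewrite -[in RHS](setTI (ysection E y)) setIC -integral_indic//; last exact: measurable_ysection.
  by apply: eq_integral => c _; rewrite /f !indicE mem_ysection.
have Ny (y : RB) : y != 0 :> R -> mu (ysection E y) = 0%E.
  move=> y0.
  have y2 : 0 < (y : R) ^- 2 by rewrite invr_gt0 exprn_even_gt0.
  have mN' : measurable (reflect_scale 0 1 @^-1` N).
    by rewrite -[X in measurable X]setTI; exact: measurable_reflect_scale.
  have := lebesgue_reflect_scale 0 y2 mN'.
  rewrite (lebesgue_reflect_scale 0 ltr01 mN) N0 !mule0 => <-.
  congr (mu _); apply/seteqP; split => c;
    rewrite /ysection/= /E/= /reflect_scale inE/= invrK !sub0r divr1 mulNr opprK//.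
have I0 : (\int[mu]_c mu (xsection E c) = 0)%E.
  under eq_integral do rewrite -I1.
  have := @fubini_tonelli _ _ _ _ R mu mu _ mf f0; rewrite /fubini_F /fubini_G => ->.
  under eq_integral do rewrite I2.
  rewrite (ae_eq_integral (cst 0%E))//; first by rewrite integral_cst// mul0e.
    exact: measurable_fun_ysection.
  exists [set (0 : R)]; split; [exact: measurable_set1|exact: lebesgue_measure_set1|].
  move=> y /= /not_implyP[_ Ey]; apply: contrapT => y0; apply: Ey; apply: Ny.
  exact/eqP.
have mG : measurable_fun setT (fun c => mu (xsection E c)) by exact: measurable_fun_xsection.
have : (\int[mu]_c `|mu (xsection E c)| = 0)%E.
  by under eq_integral do rewrite gee0_abs//.
move/(ae_eq_integral_abs mu measurableT mG) => [Z [mZ Z0 ZE]].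
have [c c0 cE] : exists2 c : R, 0 < c & mu (xsection E c) = 0%E.
  apply: contrapT => noc.
  have sub : `]0, 1]%classic `<=` Z.
    move=> c /=; rewrite in_itv/= => /andP[c0 _]; apply: ZE => /= cE.
    by apply: noc; exists c => //; exact: cE.
  have m01 : measurable (`]0, 1]%classic : set RB) by exact: measurable_itv.
  have : (mu `]0%R, 1%R] <= 0)%E.
    by rewrite -Z0; apply: le_measure => //; exact: mem_set.
  rewrite lebesgue_measure_itv/= lte_fin ltr01 oppr0 adde0.
  by rewrite leNgt lte01.
have s0 : 0 < (Num.sqrt c)^-1 by rewrite invr_gt0 sqrtr_gt0.
have := lebesgue_reflect_scale 0 s0 mM.
rewrite (_ : _ @^-1` M = xsection E c); last first.
  apply/seteqP; split => y; rewrite /xsection /M /E /reflect_scale /= inE/=;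
    by rewrite invrK sub0r exprMn sqrrN sqr_sqrtr ?ltW// mulrC.
rewrite cE => /esym/eqP; rewrite mule_eq0 eqe gt_eqF//= => /eqP.
by [].
Qed.

Lemma gauss_null_sq (N : set RB) : measurable N -> mu N = 0%E ->
  gauss ((fun y : RB => (y : R) ^+ 2) @^-1` N) = 0%E.
Proof.
move=> mN N0; have := @gauss_dominates R => /null_content_dominatesP; apply.
  by rewrite -[X in measurable X]setTI; exact: (@measurable_sq R).
exact: lebesgue_null_sq.
Qed.

End affine.

(** * The distribution function of [xi ^+ 2] *)

Section sqcdf.
Context {R : realType}.
Local Notation RB := (measurableTypeR R).
Local Notation mu := (@lebesgue_measure R).
Local Notation gauss := (normal_prob (0 : R) 1).
Implicit Types x : R.

(** The distribution function written [chi2_cdf 0] for the pair [(xi, eta)], see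
    [chi2_cdf0E]. *)
Definition sqcdf x : \bar R := gauss [set y : RB | (y : R) ^+ 2 <= x].

Lemma measurable_sq_le x : measurable [set y : RB | (y : R) ^+ 2 <= x].
Proof. apply: measurable_sub_le; exact: measurable_sq. Qed.

Lemma sqcdf_ge0 x : (0 <= sqcdf x)%E. Proof. by []. Qed.

Lemma sqcdf_le x y : x <= y -> (sqcdf x <= sqcdf y)%E.
Proof.
move=> xy; apply: le_measure; rewrite ?inE; [exact: measurable_sq_le..|].
by move=> z /=/le_trans; apply.
Qed.

Lemma sqcdf_fin x : sqcdf x \is a fin_num.
Proof. by apply: fin_num_measure; exact: measurable_sq_le. Qed.

Lemma measurable_sqcdf : measurable_fun setT (sqcdf : RB -> \bar R).
Proof.
rewrite (_ : sqcdf = EFin \o (fun x => fine (sqcdf x))); last first.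
  by apply/funext => x /=; rewrite fineK// sqcdf_fin.
apply/measurable_EFinP; apply: nondecreasing_measurable => // x y xy.
by apply: fine_le; [exact: sqcdf_fin|exact: sqcdf_fin|exact: sqcdf_le].
Qed.

Lemma gauss0 : gauss [set (0 : R)] = 0%E.
Proof.
have /null_content_dominatesP := @gauss_dominates R; apply.
  exact: measurable_set1.
exact: lebesgue_measure_set1.
Qed.

Lemma sqcdf_le0 x : x <= 0 -> sqcdf x = 0%E.
Proof.
move=> x0; apply/eqP; rewrite eq_le sqcdf_ge0 andbT.
rewrite -gauss0.
apply: le_measure; rewrite ?inE; [exact: measurable_sq_le|exact: measurable_set1|].
move=> y /= yx; have : (y : R) ^+ 2 <= 0 by exact: le_trans x0.
by rewrite le_eqVlt ltNge sqr_ge0 orbF sqrf_eq0 => /eqP.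
Qed.

Definition gauss_primitive x := \int[mu]_(t in `]-oo, x]) normal_pdf 0 1 t.

Lemma is_derive_gauss_primitive (x : R) : is_derive x 1 gauss_primitive (normal_pdf 0 1 x).
Proof.
have I : mu.-integrable `]-oo, x + 1] (EFin \o (normal_pdf (0 : R) 1)).
  exact: integrableS (integrable_normal_pdf 0 1).
have xx : x < x + 1 by rewrite ltrDl.
have c : {for x, continuous (normal_pdf (0 : R) 1)}.
  by apply: continuous_normal_pdf; rewrite oner_neq0.
have [d1 d2] := continuous_FTC1 xx I (ltNyr _) c.
by rewrite -d2 derive1E; exact: derivableP.
Qed.

Lemma sqcdf_sq s : 0 <= s ->
  sqcdf (s ^+ 2) = (gauss_primitive s + -1 * gauss_primitive (-1 * s))%:E.
Proof.
move=> s0; rewrite mulN1r mulN1r.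
have [->|sn0] := eqVneq s 0.
  by rewrite oppr0 subrr expr0n/= sqcdf_le0.
have s0' : 0 < s by rewrite lt0r sn0.
have -> : sqcdf (s ^+ 2) = (\int[mu]_(t in `[(- s)%R, s]) (normal_pdf 0 1 t)%:E)%E.
  rewrite /sqcdf /normal_prob; congr integral; apply/seteqP; split => y /=.
    rewrite in_itv/= -ler_norml -(real_normK (num_real (y : R))) => h.
    by rewrite -(ler_pXn2r (isT : (0 < 2)%N)) ?nnegrE.
  by rewrite in_itv/= -ler_norml => ?; rewrite -(real_normK (num_real (y : R))) lerXn2r ?nnegrE.
rewrite (@continuous_FTC2 _ _ gauss_primitive).
- by rewrite EFinB.
- by lra.
- by apply: continuous_subspaceT => y; apply: continuous_normal_pdf; rewrite oner_neq0.
- have cK := is_derive_continuous is_derive_gauss_primitive.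
  split; first by move=> y _; have := is_derive_gauss_primitive y => ?; exact: ex_derive.
    by apply: cvg_at_right_filter; exact: cK.
  by apply: cvg_at_left_filter; exact: cK.
- by move=> y _; rewrite derive1E (@derive_val _ _ _ _ _ _ _ (is_derive_gauss_primitive y)).
Qed.

(** Concavity of [sqcdf], as the existence of tangents. In the variable [s] with
    [x = s ^+ 2], the function minus [k * s ^+ 2] has derivative [2 * (pdf s - k * s)],
    whose sign changes only at [s0], because the Gaussian density decreases. *)
Lemma sqcdf_tangent x0 : 0 < x0 -> exists k b, [/\ 0 <= k, sqcdf x0 = b%:E &
  forall x, 0 <= x -> (sqcdf x <= (b + k * (x - x0))%:E)%E].
Proof.
move=> x00; set s0 := Num.sqrt x0; have s00 : 0 < s0 by rewrite sqrtr_gt0.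
have s0E : s0 ^+ 2 = x0 by rewrite sqr_sqrtr// ltW.
pose p : R -> R := normal_pdf 0 1.
have p0 s : 0 <= p s by exact: normal_pdf_ge0.
have pN s : p (-1 * s) = p s by rewrite /p !normal_pdf01E mulN1r sqrrN.
have ple s t : 0 <= s -> s <= t -> p t <= p s.
  move=> s0' st; rewrite /p !normal_pdf01E ler_wpM2l ?normal_peak_ge0// ler_expR.
  rewrite ler_pM2r// lerN2 lerXn2r// ?nnegrE//; exact: le_trans st.
pose b (s : R) := gauss_primitive s + -1 * gauss_primitive (-1 * s).
pose k := p s0 / s0.
have k0 : 0 <= k by rewrite divr_ge0// ltW.
have db (s : R) : is_derive s 1 b (2 * p s).
  have dN : is_derive s 1 (fun s : R => gauss_primitive (-1 * s)) (p (-1 * s) * -1).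
    apply: (@is_derive1_comp _ gauss_primitive (fun s : R => -1 * s)).
      exact: is_derive_gauss_primitive.
    by have /is_derive_eq := is_deriveZf (-1) (is_derive_id s 1); apply; rewrite mulr1.
  have /is_derive_eq := is_deriveDf (is_derive_gauss_primitive s) (is_deriveZf (-1) dN).
  by apply; rewrite pN -/p; ring.
pose D (s : R) := b s + - k * (s * s).
have dD (s : R) : is_derive s 1 D (2 * (p s - k * s)).
  have /is_derive_eq := is_deriveDf (db s)
    (is_deriveZf (- k) (is_deriveMf (is_derive_id s 1) (is_derive_id s 1))).
  by apply; ring.
have Dmax s : 0 <= s -> D s <= D s0.
  move=> s0'; have [ss0|ss0] := leP s s0.
    apply: (ger0_is_derive_le_oo dD) => // z /andP[sz zs].
    have z0 : 0 <= z by exact: le_trans (ltW sz).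
    rewrite mulr_ge0// subr_ge0 (le_trans _ (ple _ _ z0 (ltW zs)))//.
    by rewrite /k mulrAC ler_pdivrMr// ler_wpM2l// ltW.
  have dND (t : R) : is_derive t 1 (fun t : R => -1 * D t) (-1 * (2 * (p t - k * t))).
    exact: is_deriveZf.
  have := ger0_is_derive_le_oo dND _ (ltW ss0).
  rewrite !mulN1r lerN2; apply => z /andP[sz zs].
  rewrite mulN1r oppr_ge0 mulr_ge0_le0// subr_le0.
  rewrite (le_trans (ple _ _ (ltW s00) (ltW sz)))//.
  by rewrite /k mulrAC ler_pdivlMr// ler_wpM2l// ltW.
exists k, (b s0); split => //; first by rewrite -s0E sqcdf_sq// ltW.
move=> x xge0; rewrite -[x in sqcdf x](sqr_sqrtr xge0) sqcdf_sq ?sqrtr_ge0//.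
rewrite lee_fin -/(b _); have := Dmax _ (sqrtr_ge0 x).
rewrite /D -!expr2 s0E (sqr_sqrtr xge0) => H; lra.
Qed.

Lemma integral_probability_cst d (T : measurableType d) (P : probability T R) c :
  (\int[P]__ c%:E = c%:E)%E.
Proof.
rewrite integral_cst// [X in (_ * X)%E](_ : _ = 1%E) ?mule1//.
exact: probability_setT.
Qed.

(** Jensen's inequality, from the tangent at the mean. *)
Lemma sqcdf_jensen d (T : measurableType d) (P : probability T R) (S : T -> R) (m : R) :
  measurable_fun setT S -> (forall t, 0 <= S t) -> 0 < m ->
  (\int[P]_t (S t)%:E = m%:E)%E ->
  (\int[P]_t sqcdf (S t) <= sqcdf m)%E.
Proof.
move=> mS S0 m0 Sm; have [k [b [k0 bE tg]]] := sqcdf_tangent m0.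
have mF : measurable_fun setT (fun t => sqcdf (S t)).
  by apply: (measurableT_comp measurable_sqcdf).
have intS : P.-integrable setT (EFin \o S).
  apply/integrableP; split; first exact/measurable_EFinP.
  under eq_integral do rewrite /= ger0_norm//.
  by rewrite Sm ltry.
have H : (\int[P]_t sqcdf (S t) <= \int[P]_t (b + k * (S t - m))%:E)%E.
  apply: ge0_le_integral => //.
  - by apply/measurable_EFinP; apply: measurable_funD => //; apply: measurable_funM => //;
      exact: measurable_funB.
  - by move=> t _; exact: tg.
apply: (le_trans H); rewrite bE.
have -> : (\int[P]_t (b + k * (S t - m))%:E =
    \int[P]_t ((b - k * m)%:E + k%:E * (S t)%:E))%E.
  by apply: eq_integral => t _; rewrite -EFinM -EFinD; congr EFin; ring.
rewrite integralD//=; last 2 first.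
- exact: finite_measure_integrable_cst.
- exact: integrableZl.
rewrite integralZl// Sm.
rewrite integral_probability_cst.
by rewrite -EFinM -EFinD lee_fin; lra.
Qed.

(** The tangent at [x / rho] has a nonnegative value at 0, as [sqcdf 0 = 0]. *)
Lemma sqcdf_scale (rho x : R) : 1 <= rho -> (sqcdf x <= rho%:E * sqcdf (x / rho))%E.
Proof.
move=> rho1; have rho0 : 0 < rho by exact: lt_le_trans rho1.
have [x0|x0] := leP x 0; first by rewrite sqcdf_le0// mule_ge0// lee_fin ltW.
have y0 : 0 < x / rho by rewrite divr_gt0.
have [k [b [k0 bE tg]]] := sqcdf_tangent y0.
have := tg 0 (lexx 0); rewrite sqcdf_le0// lee_fin sub0r => kb.
apply: (le_trans (tg x (ltW x0))); rewrite bE -EFinM lee_fin.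
have -> : x - x / rho = (rho - 1) * (x / rho) by field; rewrite gt_eqF.
have : (rho - 1) * (k * (x / rho)) <= (rho - 1) * b.
  by rewrite ler_wpM2l ?subr_ge0//; lra.
lra.
Qed.

End sqcdf.

(** * The ratio of two quadratic forms *)

Section sections.
Context {R : realType}.
Context d1 d2 (T1 : measurableType d1) (T2 : measurableType d2).
Variables (P1 : probability T1 R) (P2 : probability T2 R).

Lemma xsectionP (E : set (T1 * T2)) x : xsection E x = [set y | E (x, y)].
Proof. by apply/seteqP; split => y; rewrite /xsection/= inE. Qed.

Lemma ysectionP (E : set (T1 * T2)) y : ysection E y = [set x | E (x, y)].
Proof. by apply/seteqP; split => x; rewrite /ysection/= inE. Qed.

Lemma measurable_slice1 (E : set (T1 * T2)) x :
  measurable E -> measurable [set y | E (x, y)].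
Proof. by move=> mE; rewrite -xsectionP; exact: measurable_xsection. Qed.

Lemma measurable_slice2 (E : set (T1 * T2)) y :
  measurable E -> measurable [set x | E (x, y)].
Proof. by move=> mE; rewrite -ysectionP; exact: measurable_ysection. Qed.

Lemma measurable_measure_slice1 (E : set (T1 * T2)) :
  measurable E -> measurable_fun setT (fun x => P2 [set y | E (x, y)]).
Proof.
move=> mE; under eq_fun do rewrite -xsectionP.
exact: measurable_fun_xsection.
Qed.

Lemma measurable_measure_slice2 (E : set (T1 * T2)) :
  measurable E -> measurable_fun setT (fun y => P1 [set x | E (x, y)]).
Proof.
move=> mE; under eq_fun do rewrite -ysectionP.
exact: measurable_fun_ysection.
Qed.

Lemma integral_measure_slice (E : set (T1 * T2)) : measurable E ->
  (\int[P1]_x P2 [set y | E (x, y)] = \int[P2]_y P1 [set x | E (x, y)])%E.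
Proof.
move=> mE; pose f z : \bar R := (\1_E z)%:E.
have mf : measurable_fun setT f by apply/measurable_EFinP; exact: measurable_indic.
have f0 z : (0 <= f z)%E by rewrite lee_fin.
have := @fubini_tonelli _ _ _ _ R P1 P2 f mf f0; rewrite /fubini_F /fubini_G => H.
transitivity (\int[P1]_x \int[P2]_y f (x, y))%E.
  apply: (@eq_integral _ _ _ P1) => x _.
  by rewrite -[in LHS](setTI [set y | _]) setIC -integral_indic//; exact: measurable_slice1.
rewrite H; apply: eq_integral => y _.
by rewrite -[in RHS](setTI [set x | _]) setIC -integral_indic//; exact: measurable_slice2.
Qed.

End sections.

Section ratio.
Context {R : realType}.
Local Notation RB := (measurableTypeR R).
Local Notation gauss := (normal_prob (0 : R) 1).

(** Distribution function of [xi ^+ 2 / (xi ^+ 2 + r)], with the denominator cleared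
    so that the events involved are sublevel sets of polynomials. *)
Definition ratio_cdf (r u : R) : \bar R :=
  gauss [set x : RB | (x : R) ^+ 2 <= u * ((x : R) ^+ 2 + r)].

Lemma measurable_ratio (r u : R) :
  measurable [set x : RB | (x : R) ^+ 2 <= u * ((x : R) ^+ 2 + r)].
Proof.
rewrite (_ : [set _ | _] = [set x : RB | (x : R) ^+ 2 - u * ((x : R) ^+ 2 + r) <= 0]).
  apply: measurable_sub_le; apply: measurable_funB; first exact: measurable_sq.
  apply: measurable_funM => //; apply: measurable_funD => //; exact: measurable_sq.
by apply/seteqP; split => x /=; rewrite subr_le0.
Qed.

Lemma ratio_cdf_ge0 r u : (0 <= ratio_cdf r u)%E. Proof. by []. Qed.

Lemma ratio_cdf_le1 r u : (ratio_cdf r u <= 1)%E.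
Proof. by apply: probability_le1; exact: measurable_ratio. Qed.

Lemma ratio_cdf_le r u v : 0 <= r -> u <= v -> (ratio_cdf r u <= ratio_cdf r v)%E.
Proof.
move=> r0 uv; apply: le_measure; rewrite ?inE; [exact: measurable_ratio..|].
move=> x /= /le_trans; apply; apply: ler_wpM2r => //.
by apply: addr_ge0 => //; exact: sqr_ge0.
Qed.

Lemma measurable_ratio_cdf (r : R) : 0 <= r ->
  measurable_fun setT (ratio_cdf r : RB -> \bar R).
Proof.
have fin u : ratio_cdf r u \is a fin_num.
  by apply: fin_num_measure; exact: measurable_ratio.
move=> r0; rewrite (_ : ratio_cdf r = EFin \o (fun u => fine (ratio_cdf r u))).
  apply/measurable_EFinP; apply: nondecreasing_measurable => // u v uv.
  by apply: fine_le; [exact: fin|exact: fin|exact: ratio_cdf_le].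
by apply/funext => x /=; rewrite fineK.
Qed.

Lemma ratio_cdf_lt0 r u : 0 <= r -> u < 0 -> ratio_cdf r u = 0%E.
Proof.
move=> r0 u0; apply/eqP; rewrite eq_le ratio_cdf_ge0 andbT -gauss0.
apply: le_measure; rewrite ?inE; [exact: measurable_ratio|exact: measurable_set1|].
move=> x /= h; have : (x : R) ^+ 2 <= 0.
  apply: (le_trans h); apply: mulr_le0_ge0; first exact: ltW.
  by apply: addr_ge0 => //; exact: sqr_ge0.
by rewrite le_eqVlt ltNge sqr_ge0 orbF sqrf_eq0 => /eqP.
Qed.

Lemma ratio_cdf1 r : 0 <= r -> ratio_cdf r 1 = 1%E.
Proof.
move=> r0; rewrite /ratio_cdf (_ : [set _ | _] = setT) ?probability_setT//.
by apply/seteqP; split => // x _ /=; rewrite mul1r lerDl.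
Qed.

Lemma ratio_cdfE r u : 0 <= r -> u < 1 -> ratio_cdf r u = sqcdf (r * u / (1 - u)).
Proof.
move=> r0 u1; congr (gauss _); apply/seteqP; split => x /=;
  rewrite ler_pdivlMr ?subr_gt0// => h; lra.
Qed.

Lemma gauss_tupleS n (E : set (n.+1.-tuple RB)) : measurable E ->
  gauss_tuple n.+1 E =
  (\int[gauss_tuple n]_t gauss [set x : RB | E [tuple of x :: t]])%E.
Proof.
move=> mE; have mC : measurable (@cons_tuple R n @^-1` E).
  by rewrite -[X in measurable X]setTI; exact: measurable_cons_tuple.
rewrite -(integral_measure_slice gauss (gauss_tuple n) mC) /= /distribution /pushforward.
by apply: eq_integral => x _ /=; rewrite xsectionP.
Qed.

Lemma measurable_qform_le n (e : 'I_n -> R) z : measurable [set t | qform e t <= z].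
Proof. by apply: measurable_sub_le; exact: measurable_qform. Qed.

Lemma mean_qform n (d : 'I_n -> R) : (forall i, 0 <= d i) ->
  (\int[gauss_tuple n]_t (qform d t)%:E = (\sum_i d i)%:E)%E.
Proof.
elim: n d => [|n IH] d d0.
  rewrite big_ord0; under eq_integral do rewrite /qform big_ord0.
  by rewrite integral0.
have d0' i : 0 <= d (lift ord0 i) by [].
have mq m (e : 'I_m -> R) : measurable_fun setT (fun t => (qform e t)%:E).
  by apply/measurable_EFinP; exact: measurable_qform.
rewrite ge0_integral_gauss_tupleS//; last by move=> t; rewrite lee_fin qform_ge0.
rewrite big_ord_recl; set s := \sum_i _.
have s0 : 0 <= s by exact: sumr_ge0.
transitivity (\int[gauss]_x ((d ord0)%:E * (x ^+ 2)%:E + s%:E))%E.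
  apply: eq_integral => x _; under eq_integral do rewrite qform_cons EFinD.
  rewrite ge0_integralD//; last 3 first.
  - by move=> t _; rewrite lee_fin; apply: mulr_ge0 => //; exact: sqr_ge0.
  - by move=> t _; rewrite lee_fin qform_ge0.
  - exact: mq.
  by rewrite IH// integral_probability_cst EFinM.
rewrite integralD//=; last 2 first.
- by apply: integrableZl => //; exact: integrable_gauss_sq.
- exact: finite_measure_integrable_cst.
rewrite integralZl//; last exact: integrable_gauss_sq.
have -> : (\int[gauss]_x (x ^+ 2)%:E = 1)%E.
  have := @gauss_second_moment R; rewrite /Rintegral => h.
  rewrite -[LHS]fineK ?h//; exact: integrable_fin_num (@integrable_gauss_sq R).
by rewrite mule1 integral_probability_cst EFinD.
Qed.

(** The event says that the quotient of the forms with weights [l i ^+ 2] and [l i] is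
    at most [u]; it becomes likelier when only the leading coordinate is kept in the
    numerator. Averaging over the other coordinates then replaces their form by its
    mean [r], because [sqcdf] is concave. *)
Lemma qform_ratio_le n (l : 'I_n.+1 -> R) (u : R) :
  (forall i, 0 <= l i) -> l ord0 = 1 -> u <= 1 ->
  (gauss_tuple n.+1 [set t | (qform (fun i => l i ^+ 2 - u * l i) t <= 0)%R] <=
   ratio_cdf (\sum_i l (lift ord0 i)) u)%E.
Proof.
move=> l0 l1; set r := \sum_i _.
have r0 : 0 <= r by exact: sumr_ge0.
rewrite le_eqVlt => /orP[/eqP ->|u1].
  by rewrite ratio_cdf1//; apply: probability_le1; exact: measurable_qform_le.
(* For negative [u] the event forces the leading coordinate to be 0, hence the choice
   [c = 0]. *)
pose c := Num.max u 0 / (1 - u).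
have u1' : 0 < 1 - u by rewrite subr_gt0.
have c0 : 0 <= c by rewrite divr_ge0 ?(ltW u1')// le_max lexx orbT.
have u_max : u <= Num.max u 0 by rewrite le_max lexx.
pose S := qform (fun i => l (lift ord0 i)).
have S0 t : 0 <= S t by apply: qform_ge0 => i.
have mS : measurable_fun setT S by exact: measurable_qform.
have mcS : measurable_fun setT (fun t => c * S t) by apply: measurable_funM.
have mF : measurable_fun setT (fun t => sqcdf (c * S t)).
  by apply: (measurableT_comp measurable_sqcdf).
have H1 : (gauss_tuple n.+1 [set t | (qform (fun i => l i ^+ 2 - u * l i) t <= 0)%R] <=
    \int[gauss_tuple n]_t sqcdf (c * S t))%E.
  rewrite gauss_tupleS; last exact: measurable_qform_le.
  set B := [set t | _].
  have mC : measurable (@cons_tuple R n @^-1` B).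
    rewrite -[X in measurable X]setTI; apply: measurable_cons_tuple => //.
    exact: measurable_qform_le.
  apply: ge0_le_integral => //; first exact: (measurable_measure_slice2 gauss mC).
  move=> t _; apply: le_measure; rewrite ?inE; [|exact: measurable_sq_le|].
    exact: (measurable_slice2 t mC).
  move=> x /=; rewrite /B/= qform_cons l1 expr1n mulr1 => h.
  have : - Num.max u 0 * S t <= qform (fun i => l (lift ord0 i) ^+ 2 - u * l (lift ord0 i)) t.
    rewrite /S /qform mulr_sumr; apply: ler_sum => i _.
    rewrite mulrA ler_wpM2r ?sqr_ge0// mulNr -subr_ge0 opprK.
    have := sqr_ge0 (l (lift ord0 i)); have := ler_wpM2r (l0 (lift ord0 i)) u_max.
    by lra.
  rewrite /c mulrAC ler_pdivlMr//; lra.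
apply: (le_trans H1).
have [m0|m0] := leP (c * r) 0.
  have cr0 : c * r = 0 by apply/eqP; rewrite eq_le m0 mulr_ge0.
  have cS t : c * S t = 0.
    move/eqP: cr0; rewrite mulf_eq0 => /orP[/eqP ->|]; first by rewrite mul0r.
    move=> /eqP rE; rewrite /S /qform big1 ?mulr0// => i _.
    have : l (lift ord0 i) <= r by rewrite /r (bigD1 i)//= lerDl sumr_ge0.
    by rewrite rE => li; have /eqP -> : l (lift ord0 i) == 0 by [rewrite eq_le li l0]; rewrite mul0r.
  under eq_integral do rewrite cS sqcdf_le0//.
  by rewrite integral0.
apply: (le_trans (sqcdf_jensen mcS _ m0 _)).
- by move=> t; rewrite mulr_ge0.
- under eq_integral do rewrite EFinM.
  rewrite ge0_integralZl//; last 2 first.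
  + exact/measurable_EFinP.
  + by move=> t _; rewrite lee_fin.
  by rewrite mean_qform.
have [u0|u0] := leP 0 u.
  by rewrite ratio_cdfE// /c (max_idPl u0) mulrAC [r * u]mulrC.
by move: m0; rewrite /c (max_idPr (ltW u0)) mul0r mul0r ltxx.
Qed.

End ratio.

(** * Sums of the ratio and a quadratic form *)

Section compare.
Context {R : realType}.
Local Notation RB := (measurableTypeR R).
Local Notation gauss := (normal_prob (0 : R) 1).

Lemma measurable_ratio_prod d (T : measurableType d) (f : T -> R) (r v : R) :
  measurable_fun setT f ->
  measurable [set z : T * RB | (z.2 : R) ^+ 2 <= (v - f z.1) * ((z.2 : R) ^+ 2 + r)].
Proof.
move=> mf; rewrite (_ : [set _ | _] =
  [set z : T * RB | (z.2 : R) ^+ 2 - (v - f z.1) * ((z.2 : R) ^+ 2 + r) <= 0]).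
  have m2 : measurable_fun setT (fun z : T * RB => (z.2 : R) ^+ 2).
    by apply: measurable_funX; exact: measurable_snd.
  apply: measurable_sub_le; apply: measurable_funB => //.
  apply: measurable_funM; last exact: measurable_funD.
  apply: measurable_funB => //.
  by apply: (measurableT_comp mf); exact: measurable_fst.
by apply/seteqP; split => z /=; rewrite subr_le0.
Qed.

Lemma measurable_ratio_cdf_comp d (T : measurableType d) (f : T -> R) (r v : R) :
  measurable_fun setT f -> measurable_fun setT (fun t => ratio_cdf r (v - f t)).
Proof.
by move=> mf; exact: (measurable_measure_slice1 gauss (measurable_ratio_prod r v mf)).
Qed.

(** By Tonelli, [xi ^+ 2 / (xi ^+ 2 + r)] can be conditioned upon instead, so a
    comparison of distribution functions below [v] carries over to the sums. The ratio
    is positive unless [xi = 0], which is why [z < v] suffices. *)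
Lemma ratio_cdf_compare d1 d2 (T1 : measurableType d1) (T2 : measurableType d2)
    (P1 : probability T1 R) (P2 : probability T2 R) (f1 : T1 -> R) (f2 : T2 -> R)
    (r v k : R) :
  measurable_fun setT f1 -> measurable_fun setT f2 -> 0 <= r -> 0 <= k ->
  (forall z, (z < v)%R -> P1 [set t | (f1 t <= z)%R] <= k%:E * P2 [set t | (f2 t <= z)%R])%E ->
  (\int[P1]_t ratio_cdf r (v - f1 t) <= k%:E * \int[P2]_t ratio_cdf r (v - f2 t))%E.
Proof.
move=> mf1 mf2 r0 k0 H.
have m1 := measurable_ratio_prod r v mf1; have m2 := measurable_ratio_prod r v mf2.
have := integral_measure_slice P1 gauss m1; rewrite /= -/(ratio_cdf _ _) => ->.
have := integral_measure_slice P2 gauss m2; rewrite /= -/(ratio_cdf _ _) => ->.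
have M1 := measurable_measure_slice2 P1 m1; have M2 := measurable_measure_slice2 P2 m2.
rewrite -ge0_integralZl//.
apply: ae_ge0_le_integral => //.
  by move=> x _; apply: mule_ge0.
  exact: emeasurable_funM.
exists [set (0 : R)]; split; [exact: measurable_set1|exact: gauss0|].
move=> x /= /not_implyP[_ nle]; apply: contrapT => /= /eqP x0; apply: nle.
have x2 : 0 < (x : R) ^+ 2 by rewrite lt0r sqr_ge0 sqrf_eq0 x0.
have d0 : 0 < (x : R) ^+ 2 + r by rewrite ltr_wpDr.
have E d (T : measurableType d) (f : T -> R) :
    [set t | (x : R) ^+ 2 <= (v - f t) * ((x : R) ^+ 2 + r)] =
    [set t | f t <= v - (x : R) ^+ 2 / ((x : R) ^+ 2 + r)].
  by apply/seteqP; split => t /=; rewrite -ler_pdivrMr// => h; lra.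
rewrite !E; apply: H.
by rewrite gtrBl divr_gt0.
Qed.

Lemma qform_le_sqcdf n (l : 'I_n.+1 -> R) z : (forall i, 0 <= l i) -> l ord0 = 1 ->
  (gauss_tuple n.+1 [set t | (qform l t <= z)%R] <= sqcdf z)%E.
Proof.
move=> l0 l1; rewrite gauss_tupleS; last exact: measurable_qform_le.
set B := [set t | _].
have mC : measurable (@cons_tuple R n @^-1` B).
  rewrite -[X in measurable X]setTI; apply: measurable_cons_tuple => //.
  exact: measurable_qform_le.
rewrite -(fineK (sqcdf_fin z)) -[leRHS](integral_probability_cst (gauss_tuple n)).
apply: ge0_le_integral => //; first exact: (measurable_measure_slice2 gauss mC).
move=> t _; rewrite fineK ?sqcdf_fin//.
apply: le_measure; rewrite ?inE; [|exact: measurable_sq_le|].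
  exact: (measurable_slice2 t mC).
move=> x /=; rewrite /B/= qform_cons l1 mul1r; apply: le_trans.
by rewrite lerDl qform_ge0.
Qed.

(** All the coordinates but the first are discarded; the factor [rho] and the rescaled
    argument come from the concavity of [sqcdf]. *)
Lemma low_bound n (l : 'I_n.+1 -> R) (tau : R) : (forall i, 0 <= l i) -> l ord0 = 1 ->
  let r := (\sum_i l (lift ord0 i))%R in let rho := (1 + r)%R in
  (\int[gauss_tuple n.+1]_t ratio_cdf r (tau - qform l t) <=
   rho%:E * \int[gauss]_y ratio_cdf r (tau - rho * (y : R) ^+ 2))%E.
Proof.
move=> l0 l1; cbv zeta; set r := \sum_i _; set rho := 1 + r.
have r0 : 0 <= r by exact: sumr_ge0.
have rho1 : 1 <= rho by rewrite lerDl.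
have rho0 : 0 < rho by exact: lt_le_trans rho1.
apply: (@ratio_cdf_compare _ _ _ _ (gauss_tuple n.+1) gauss (qform l)
  (fun y : RB => rho * (y : R) ^+ 2)) => //.
- exact: measurable_qform.
- by apply: measurable_funM => //; exact: measurable_sq.
- exact: ltW.
move=> z _; apply: (le_trans (qform_le_sqcdf z l0 l1)).
apply: (le_trans (sqcdf_scale z rho1)).
apply: lee_pmul => //; first by rewrite lee_fin ltW.
rewrite /sqcdf (_ : [set y : RB | (y : R) ^+ 2 <= z / rho] =
  [set y : RB | rho * (y : R) ^+ 2 <= z])//.
by apply/seteqP; split => y /=; rewrite ler_pdivlMr// mulrC.
Qed.

(** Given the first coordinate [y] and the ratio, the other coordinates must stay below
    [tau - y ^+ 2], which is at most their mean [r], so that they may be concentrated on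
    a single one. *)
Lemma mid_bound n (l : 'I_n.+1 -> R) (tau : R) : (forall i, 0 <= l i) -> l ord0 = 1 ->
  let r := \sum_i l (lift ord0 i) in tau <= r ->
  (\int[gauss_tuple n.+1]_t ratio_cdf r (tau - qform l t) <=
   \int[gauss]_y \int[gauss]_e ratio_cdf r (tau - ((y : R) ^+ 2 + r * (e : R) ^+ 2)))%E.
Proof.
move=> l0 l1; cbv zeta; set r := \sum_i _; move=> tr.
have r0 : 0 <= r by exact: sumr_ge0.
have mq := measurable_ratio_cdf_comp r tau (measurable_qform l).
rewrite ge0_integral_gauss_tupleS//.
pose q (z : RB * RB) := (z.1 : R) ^+ 2 + r * (z.2 : R) ^+ 2.
have mQ : measurable_fun setT q.
  apply: measurable_funD; first by apply: measurable_funX; exact: measurable_fst.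
  by apply: measurable_funM => //; apply: measurable_funX; exact: measurable_snd.
have mR := measurable_ratio_cdf_comp r tau mQ.
apply: ge0_le_integral => //.
- by move=> x _; exact: integral_ge0.
- exact: (measurable_integral_gauss_tuple mq (fun=> ratio_cdf_ge0 _ _)).
- exact: (@measurable_fun_fubini_tonelli_F _ _ _ _ _ gauss _ mR (fun=> ratio_cdf_ge0 _ _)).
move=> x _.
have -> : (\int[gauss_tuple n]_t ratio_cdf r (tau - qform l [tuple of x :: t]) =
  \int[gauss_tuple n]_t ratio_cdf r ((tau - (x : R) ^+ 2) -
    qform (fun i => l (lift ord0 i)) t))%E.
  by apply: eq_integral => t _; rewrite qform_cons l1 mul1r opprD addrA.
have -> : (\int[gauss]_e ratio_cdf r (tau - ((x : R) ^+ 2 + r * (e : R) ^+ 2)) =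
  \int[gauss]_e ratio_cdf r ((tau - (x : R) ^+ 2) - r * (e : R) ^+ 2))%E.
  by apply: eq_integral => t _; rewrite opprD addrA.
rewrite -[leRHS]mul1e.
apply: (@ratio_cdf_compare _ _ _ _ (gauss_tuple n) gauss
  (qform (fun i => l (lift ord0 i))) (fun y : RB => r * (y : R) ^+ 2)) => //.
- exact: measurable_qform.
- by apply: measurable_funM => //; exact: measurable_sq.
move=> z zt; rewrite mul1e; apply: qform_le_rank1 => //.
by apply: (lt_le_trans zt); rewrite lerBlDr (le_trans tr)// lerDl sqr_ge0.
Qed.

End compare.

(** * The exponential bound *)

Section chernoff.
Context {R : realType}.
Local Notation RB := (measurableTypeR R).
Local Notation gauss := (normal_prob (0 : R) 1).

(** From [1 - 6^-1 <= expR (- 6^-1)], as [(6 / 5) ^+ 6 < 3]. *)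
Lemma expR1_le3 : expR 1 <= 3 :> R.
Proof.
have h : 5 / 6 <= expR (- 6^-1) :> R.
  by apply: le_trans (expR_ge1Dx _); lra.
have e6 : expR 1 = (expR (- 6^-1)) ^- 6 :> R.
  by rewrite -expRM_natl -expRN; congr expR; field.
rewrite e6 invf_ple ?posrE ?exprn_gt0 ?expR_gt0//.
have : (5 / 6) ^+ 6 <= (expR (- 6^-1)) ^+ 6 :> R.
  by apply: lerXn2r; rewrite ?nnegrE ?expR_ge0//; lra.
by apply: le_trans; lra.
Qed.

(** Convexity of the exponential between 0 and [x]. *)
Lemma expR_chord (x l : R) : 0 <= l <= 1 -> expR (l * x) <= 1 + (expR x - 1) * l.
Proof.
move=> /andP[l0 l1].
have h1 : 1 + (x - l * x) <= expR (x - l * x) by exact: expR_ge1Dx.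
have h2 : 1 + (- (l * x)) <= expR (- (l * x)) by exact: expR_ge1Dx.
have l1' : 0 <= 1 - l by rewrite subr_ge0.
have := lerD (ler_wpM2l l0 h1) (ler_wpM2l l1' h2).
rewrite (_ : l * (1 + (x - l * x)) + _ = 1); last by ring.
rewrite expRD mulrA -mulrDl expRN ler_pdivlMr ?expR_gt0// mul1r.
by move=> /le_trans; apply; rewrite le_eqVlt; apply/orP; left; apply/eqP; ring.
Qed.

Lemma gauss_tuple_laplace n (l : 'I_n -> R) (s : R) : 0 <= s -> (forall i, 0 <= l i) ->
  (\int[gauss_tuple n]_t (expR (- s * qform l t))%:E =
   (\prod_i (Num.sqrt (1 + 2 * (s * l i)))^-1)%:E)%E.
Proof.
move=> s0; have mE m (e : 'I_m -> R) c :
    measurable_fun setT (fun t => (expR (c * qform e t))%:E).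
  apply/measurable_EFinP/measurableT_comp => //; apply: measurable_funM => //.
  exact: measurable_qform.
elim: n l => [|n IH] l l0.
  rewrite big_ord0; under eq_integral do rewrite /qform big_ord0 mulr0 expR0.
  exact: integral_probability_cst.
rewrite ge0_integral_gauss_tupleS//.
rewrite big_ord_recl; set p := \prod_(i < n) _.
have p0 : 0 <= p by apply: prodr_ge0 => i _; rewrite invr_ge0 sqrtr_ge0.
have sl0 : 0 <= s * l ord0 by rewrite mulr_ge0.
transitivity (\int[gauss]_x (p%:E * (expR (- (s * l ord0) * x ^+ 2))%:E))%E.
  apply: eq_integral => x _.
  under eq_integral do rewrite qform_cons mulrDr expRD mulrA mulNr EFinM.
  rewrite ge0_integralZl//; last exact: mE.
  by rewrite IH// muleC.
rewrite ge0_integralZl//; first by rewrite gauss_laplace; [rewrite -EFinM mulrC|lra].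
apply/measurable_EFinP/measurableT_comp => //; apply: measurable_funM => //.
Qed.

(** Chernoff's bound with parameter [s]. As every [l i] is at most [1], the product of
    the Laplace transforms is at most the power [- (\sum_i l i) / 2] of [a = 1 + 2 * s].
    The choice [a = 6 / tau] is the best one when the weights sum to [6], and it gives
    [expR 3 * (tau / 6) ^+ 3], at most [tau ^+ 3 / 8]. *)
Lemma qform_chernoff n (l : 'I_n -> R) (tau : R) : (forall i, 0 <= l i <= 1) ->
  7 <= \sum_i l i -> 0 < tau <= 1 ->
  (gauss_tuple n [set t | (qform l t <= tau)%R] <= (tau ^+ 2 / 8)%:E)%E.
Proof.
move=> l01 sl /andP[t0 t1].
have l0 i : 0 <= l i by case/andP: (l01 i).
pose a := 6 / tau; pose s := (a - 1) / 2.
have a6 : 6 <= a by rewrite ler_pdivlMr// ler_piMr.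
have a0 : 0 < a by lra.
have s0 : 0 <= s by rewrite /s; lra.
have mQ := measurable_qform l.
have H1 : (gauss_tuple n [set t | (qform l t <= tau)%R] <=
    \int[gauss_tuple n]_t ((expR (s * tau))%:E * (expR (- s * qform l t))%:E))%E.
  rewrite -[leLHS]mul1e mule_measure_indic//; last exact: measurable_qform_le.
  apply: ge0_le_integral => //.
  - by apply/measurable_EFinP/measurable_funM => //; apply: measurable_indic;
      exact: measurable_qform_le.
  - apply: measurable_funeM; apply/measurable_EFinP/measurableT_comp => //.
    exact: measurable_funM.
  move=> t _; rewrite -EFinM lee_fin mul1r -expRD.
  rewrite indicE; case: (boolP (t \in _)) => /=; last by rewrite expR_ge0.
  rewrite inE/= => h; rewrite -expR0 ler_expR mulNr -mulrBr mulr_ge0// subr_ge0//.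
apply: (le_trans H1).
rewrite ge0_integralZl//; last first.
  by apply/measurable_EFinP/measurableT_comp => //; exact: measurable_funM.
rewrite gauss_tuple_laplace// -EFinM lee_fin.
have e3 : expR (s * tau) <= 27.
  have -> : s * tau = 3 - tau / 2 by rewrite /s /a; field; rewrite gt_eqF.
  apply: (@le_trans _ _ (expR (1 *+ 3))); first by rewrite ler_expR; lra.
  rewrite -mulr_natl expRM_natl; apply: (@le_trans _ _ (3 ^+ 3)); last by lra.
  by apply: lerXn2r; rewrite ?nnegrE ?expR_ge0// expR1_le3.
have pr : \prod_i (Num.sqrt (1 + 2 * (s * l i)))^-1 <= (a ^+ 3)^-1.
  rewrite prodfV lef_pV2 ?posrE; last 2 first.
  - by apply: prodr_gt0 => i _; rewrite sqrtr_gt0; have := mulr_ge0 s0 (l0 i); lra.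
  - exact: exprn_gt0.
  apply: (@le_trans _ _ (\prod_i expR (l i * (ln a / 2)))); last first.
    apply: ler_prod => i _; rewrite expR_ge0/=.
    rewrite -[leLHS]ger0_norm ?expR_ge0// -sqrtr_sqr.
    rewrite ler_psqrt ?nnegrE ?sqr_ge0//; last by have := mulr_ge0 s0 (l0 i); lra.
    rewrite -expRM_natl.
    have -> : 2%:R * (l i * (ln a / 2)) = l i * ln a by field.
    apply: (le_trans (expR_chord _ (l01 i))).
    rewrite lnK ?posrE// /s; lra.
  rewrite -expR_sum -mulr_suml.
  rewrite -[a in a ^+ 3]lnK ?posrE// -expRM_natl ler_expR.
  have la : 0 <= ln a by apply: ln_ge0; lra.
  have : 7 * ln a <= (\sum_i l i) * ln a by rewrite ler_wpM2r.
  by lra.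
have p0 : 0 <= \prod_i (Num.sqrt (1 + 2 * (s * l i)))^-1.
  by apply: prodr_ge0 => i _; rewrite invr_ge0 sqrtr_ge0.
apply: (le_trans (ler_pM (expR_ge0 _) p0 e3 pr)).
have -> : (a ^+ 3)^-1 = tau ^+ 3 / 216 by rewrite /a; field; rewrite gt_eqF.
have : tau ^+ 3 <= tau ^+ 2 by rewrite exprSr ler_piMr// sqr_ge0.
lra.
Qed.

(** The ratio is nonnegative, so the form alone is at most [tau]. *)
Lemma high_bound n (l : 'I_n -> R) (r tau : R) : (forall i, 0 <= l i <= 1) ->
  0 <= r -> 7 <= \sum_i l i -> 0 < tau <= 1 ->
  (\int[gauss_tuple n]_t ratio_cdf r (tau - qform l t) <= (tau ^+ 2 / 8)%:E)%E.
Proof.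
move=> l01 r0 sl tau01; apply: le_trans (qform_chernoff l01 sl tau01).
rewrite -[leRHS]mul1e mule_measure_indic//; last exact: measurable_qform_le.
apply: ge0_le_integral => //.
- exact: measurable_ratio_cdf_comp (measurable_qform _).
- by apply/measurable_EFinP/measurable_funM => //; apply: measurable_indic;
    exact: measurable_qform_le.
move=> t _; rewrite mul1r indicE; case: (boolP (t \in _)) => /= h.
  exact: ratio_cdf_le1.
by rewrite ratio_cdf_lt0// subr_lt0 ltNge; move: h; rewrite notin_setE/= => /negP.
Qed.

End chernoff.

(** * Integrals against the density of [xi ^+ 2 + alpha * eta ^+ 2] *)

Section chi2.
Context {R : realType}.
Local Notation RB := (measurableTypeR R).
Local Notation mu := (@lebesgue_measure R).
Local Notation gauss := (normal_prob (0 : R) 1).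

Lemma lebesgue_null_translate (N : set RB) (a : R) : measurable N -> mu N = 0%E ->
  measurable [set x : RB | N ((x : R) + a)] /\ mu [set x : RB | N ((x : R) + a)] = 0%E.
Proof.
move=> mN N0; rewrite (_ : [set x : RB | N ((x : R) + a)] =
  reflect_scale 0 1 @^-1` (reflect_scale a 1 @^-1` N)); last first.
  by apply/seteqP; split => x /=; rewrite /reflect_scale !divr1 sub0r opprK addrC.
have mp b (A : set RB) : measurable A -> measurable (reflect_scale b 1 @^-1` A).
  by move=> mA; rewrite -[X in measurable X]setTI; exact: measurable_reflect_scale.
have m1 := mp a _ mN; split; first exact: mp.
by rewrite !lebesgue_reflect_scale// N0 !mule0.
Qed.

Lemma measurable_quad_formT (alpha : R) : measurable_fun setT (quad_form alpha).
Proof. exact: measurable_funPT. Qed.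

(** The law of [xi ^+ 2 + alpha * eta ^+ 2] has a density: conditionally on [eta] it
    is a translate of the law of [xi ^+ 2]. *)
Lemma chi2_law_dominates (alpha : R) : chi2_law alpha `<< mu.
Proof.
apply/null_content_dominatesP => N mN N0.
have mE : measurable (quad_form alpha @^-1` N).
  by rewrite -[X in measurable X]setTI; exact: measurable_quad_formT.
transitivity (\int[gauss]_x gauss [set e : RB | N (quad_form alpha (x, e))])%E.
  by apply: eq_integral => x _; rewrite /= xsectionP.
rewrite (integral_measure_slice gauss gauss mE).
rewrite (eq_integral (cst 0%E)); first by rewrite integral0.
move=> e _ /=; have [mM M0] := lebesgue_null_translate (alpha * (e : R) ^+ 2) mN N0.
exact: (gauss_null_sq mM M0).
Qed.

Lemma chi2_cdf0E (x : R) : chi2_cdf 0 x = sqcdf x.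
Proof.
rewrite /chi2_cdf (_ : [set z | _] = [set y : RB | (y : R) ^+ 2 <= x] `*` setT).
  have := product_measure1E gauss gauss (measurable_sq_le x) measurableT.
  by rewrite [X in (_ * X)%E](_ : _ = 1%E) ?mule1//; exact: (probability_setT gauss).
by apply/seteqP; split => -[y e] /=; rewrite /quad_form mul0r addr0// => -[].
Qed.

Lemma integral_chi2_law (alpha : R) (h : RB -> \bar R) : 0 <= alpha ->
  measurable_fun setT h -> (forall q, 0 <= h q)%E ->
  (\int[gauss]_y \int[gauss]_e h ((y : R) ^+ 2 + alpha * (e : R) ^+ 2)%R =
   \int[chi2_law alpha]_(q in `[0%R, +oo[) h q)%E.
Proof.
move=> a0 mh h0.
have mD : measurable (`[0%R, +oo[%classic : set RB) by exact: measurable_itv.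
rewrite ge0_integral_pushforward//; last exact: measurable_funTS.
rewrite (_ : quad_form alpha @^-1` _ = setT); last first.
  apply/seteqP; split => // z _ /=; rewrite in_itv/= andbT.
  by apply: addr_ge0; [exact: sqr_ge0|apply: mulr_ge0 => //; exact: sqr_ge0].
have mhq : measurable_fun setT (fun z => h (quad_form alpha z)).
  by apply: (measurableT_comp mh); exact: measurable_quad_formT.
by have := @fubini_tonelli1 _ _ _ _ R gauss gauss _ mhq (fun=> h0 _).
Qed.

(** The change of variables [q = (tau - t) / k] in an integral against the density. It
    serves for [g_mid] with [k = 1] and [alpha = r], and for [g_low] with [k = rho] and
    [alpha = 0]. *)
Lemma integral_chi2_pdf (alpha r tau k : R) :
  0 <= alpha -> 0 <= r -> 0 < k -> 0 < tau <= 1 ->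
  (\int[mu]_(t in `[0%R, tau])
     (chi2_cdf 0 (r * t / (1 - t)) * chi2_pdf alpha ((tau - t) / k)) =
   k%:E * \int[gauss]_y \int[gauss]_e
     ratio_cdf r (tau - k * ((y : R) ^+ 2 + alpha * (e : R) ^+ 2)))%E.
Proof.
move=> a0 r0 k0 /andP[t0 t1].
pose h (q : RB) := ratio_cdf r (tau - k * (q : R)).
have mh : measurable_fun setT h.
  by apply: measurable_ratio_cdf_comp; apply: measurable_funM.
pose D : set RB := `[0%R, (tau / k)%R]%classic.
have mD : measurable D by exact: measurable_itv.
pose p : RB -> \bar R := chi2_pdf alpha.
have dom := chi2_law_dominates alpha.
have pI : mu.-integrable setT p by exact: Radon_Nikodym_integrable.
have mp : measurable_fun setT p by exact: (measurable_int mu).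
have mhp : measurable_fun setT (fun q => h q * p q)%E by exact: emeasurable_funM.
have hfin q : h q \is a fin_num by apply: fin_num_measure; exact: measurable_ratio.
have h_abs q : (`|h q| <= 1)%E by rewrite gee0_abs// ratio_cdf_le1.
have hpI : mu.-integrable D (fun q => h q * p q)%E.
  apply: (le_integrable mD _ _ (integrableS measurableT mD (@subsetT _ _) pI)).
    exact: measurable_funTS.
  by move=> q _; rewrite abseM -[leRHS]mul1e lee_wpmul2r.
have hI : (chi2_law alpha).-integrable D h.
  apply: (integrableS measurableT mD (@subsetT _ _)).
  have c1 : (chi2_law alpha).-integrable setT (EFin \o cst (1 : R)).
    exact: finite_measure_integrable_cst.
  apply: (le_integrable measurableT mh _ c1).
  by move=> q _; rewrite /= gee0_abs// normr1 ratio_cdf_le1.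
have -> : (\int[gauss]_y \int[gauss]_e
    ratio_cdf r (tau - k * ((y : R) ^+ 2 + alpha * (e : R) ^+ 2)) =
    \int[mu]_(q in D) (h q * p q))%E.
  rewrite (@integral_chi2_law alpha h)//.
  rewrite (Radon_Nikodym_change_of_variables dom mD hI).
  rewrite [LHS]integral_mkcond [RHS]integral_mkcond; apply: eq_integral => q _.
  rewrite !patchE; case: ifPn => q1; case: ifPn => q2 //.
    move: q1 q2; rewrite inE notin_setE /D/= !in_itv/= andbT => q0 /negP.
    rewrite q0/= -ltNge ltr_pdivrMr// => q1.
    by rewrite /h ratio_cdf_lt0// subr_lt0 mulrC.
  move: q1 q2; rewrite inE notin_setE /D/= !in_itv/= andbT => /negP q1 /andP[q0 _].
  by rewrite q0 in q1.
rewrite -(integral_reflect_scale tau k0 mD mhp hpI).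
have -> : reflect_scale tau k @^-1` D = `[0%R, tau]%classic.
  apply/seteqP; split => t; rewrite /D/= !in_itv/= /reflect_scale;
    rewrite ler_pM2r ?invr_gt0// pmulr_lge0 ?invr_gt0//; lra.
have hE t : h (reflect_scale tau k t) = ratio_cdf r t.
  by rewrite /h /reflect_scale mulrC divfK ?gt_eqF// opprB addrC subrK.
pose c := chi2_cdf 0 (r * 1 / (1 - 1)).
have FE t : t \in `[0%R, tau] -> chi2_cdf 0 (r * t / (1 - t)) =
    if t == 1 then c else ratio_cdf r t.
  rewrite in_itv/= => /andP[_ tt]; case: eqVneq => [->//|tn1].
  by rewrite chi2_cdf0E ratio_cdfE// lt_neqAle tn1 (le_trans tt).
have mpt : measurable_fun setT (fun t => p (reflect_scale tau k t)).
  by apply: (measurableT_comp mp); exact: measurable_reflect_scale.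
transitivity (\int[mu]_(t in `[0%R, tau])
    ((if ((t : R) == 1)%R then c else ratio_cdf r t) * p (reflect_scale tau k t)))%E.
  by apply: eq_integral => t; rewrite inE/= => tI; rewrite FE.
have mI : measurable (`[0%R, tau]%classic : set RB) by exact: measurable_itv.
(* At [t = 1] the quotient is 0 by convention, hence the two integrands may differ
   there. *)
apply: ae_eq_integral => //.
- apply: measurable_funTS; apply: emeasurable_funM => //.
  apply: measurable_fun_ifT => //; last exact: measurable_ratio_cdf.
  exact: measurable_fun_eqr.
- apply: measurable_funTS; apply: emeasurable_funM => //.
  by under eq_fun do rewrite hE; exact: measurable_ratio_cdf.
exists [set (1 : R)]; split; [exact: measurable_set1|exact: lebesgue_measure_set1|].
move=> t /= /not_implyP[_ ne]; apply: contrapT => /eqP t1'; apply: ne.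
by rewrite (negbTE t1') hE.
Qed.

End chi2.

(** * The spectrum of the Gram matrix *)

Section permutation.
Context {R : realType}.
Local Notation RB := (measurableTypeR R).

Lemma act_perm n (s : 'S_n) (t : n.-tuple RB) i :
  tnth (act (perm_mx s) t) i = tnth t (s i).
Proof. by rewrite tnth_mktuple -row_permE !mxE. Qed.

(** The permuted coordinates are again independent standard Gaussian variables. *)
Lemma gauss_orthogonal_perm n (s : 'S_n) : gauss_orthogonal (perm_mx s : 'M[R]_n).
Proof.
split; first by rewrite tr_perm_mx -perm_mxM mulVg perm_mx1.
move=> F mF F0; have mO := measurable_act (perm_mx s : 'M[R]_n).
pose X : {RV (gauss_tuple n) >-> n.-tuple R} := HB.pack
  (act (perm_mx s) : n.-tuple RB -> n.-tuple R)
  (isMeasurableFun.Build _ _ (n.-tuple RB) (n.-tuple R) _ mO).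
have GX : std_gaussian_vector X.
  move=> B mB.
  rewrite (_ : [set _ | _] = box (fun j => B ((s^-1)%g j))); last first.
    apply/seteqP; split => t /= tB i.
      by have := tB ((s^-1)%g i); rewrite act_perm permKV.
    by rewrite act_perm; have := tB (s i); rewrite permK.
  rewrite (gauss_tuple_box (fun j => mB ((s^-1)%g j))).
  by rewrite [RHS](reindex_inj (@perm_inj _ (s^-1)%g)).
have L := std_gaussian_law GX.
pose X' : {mfun (n.-tuple RB) >-> (n.-tuple RB)} := HB.pack
  (act (perm_mx s) : n.-tuple RB -> n.-tuple RB)
  (isMeasurableFun.Build _ _ (n.-tuple RB) (n.-tuple RB) _ mO).
transitivity (\int[distribution (gauss_tuple n) X']_t F t)%E.
  by rewrite ge0_integral_pushforward// preimage_setT.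
by rewrite [LHS](eq_measure_integral (gauss_tuple n)) => // A mA _; exact: L.
Qed.

End permutation.

Section spectrum.
Context {R : realType}.
Local Notation RB := (measurableTypeR R).

Lemma enorm_ge0 n (x : 'cV[R]_n) : 0 <= enorm x.
Proof. exact: sqrtr_ge0. Qed.

Lemma enorm_sq n (x : 'cV[R]_n) : enorm x ^+ 2 = \sum_i x i 0 ^+ 2.
Proof. by rewrite sqr_sqrtr// sumr_ge0// => i _; exact: sqr_ge0. Qed.

Lemma enorm_sqE n (x : 'cV[R]_n) : enorm x ^+ 2 = (x^T *m x) 0 0.
Proof. by rewrite enorm_sq mxE; apply: eq_bigr => i _; rewrite mxE expr2. Qed.

Lemma enorm_eq0 n (x : 'cV[R]_n) : enorm x = 0 -> x = 0.
Proof.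
move=> x0; have := enorm_sq x; rewrite x0 expr0n/= => /esym/eqP.
rewrite psumr_eq0 => [/allP h|i _]; last exact: sqr_ge0.
apply/colP => i; have := h i (mem_index_enum _); rewrite sqrf_eq0 mxE => /eqP.
by [].
Qed.

Lemma frobenius_sq m n (A : 'M[R]_(m, n)) : frobenius A ^+ 2 = \tr (A^T *m A).
Proof.
rewrite sqr_sqrtr; last by do 2 (apply: sumr_ge0 => ? _); exact: sqr_ge0.
rewrite exchange_big; apply: eq_bigr => j _; rewrite mxE.
by apply: eq_bigr => i _; rewrite mxE expr2.
Qed.

Lemma quadratic_diag n (d : 'rV[R]_n) (y : 'cV[R]_n) :
  (y^T *m diag_mx d *m y) 0 0 = \sum_i d 0 i * y i 0 ^+ 2.
Proof.
rewrite -mulmxA mul_diag_mx mxE; apply: eq_bigr => i _; rewrite !mxE.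
by rewrite mulrCA expr2.
Qed.

(** Orthogonal coordinates in which both quadratic forms of the ratio are diagonal,
    the largest eigenvalue coming first. *)
Lemma gram_diagonalisation m n (A : 'M[R]_(m, n.+1)) :
  exists2 O, gauss_orthogonal O & exists2 d : 'rV[R]_n.+1,
    O^T *m (A^T *m A) *m O = diag_mx d & forall i, 0 <= d 0 i <= d 0 0.
Proof.
have symS : (A^T *m A)^T = A^T *m A by rewrite trmx_mul trmxK.
have [ O gO [d dE]] := gauss_orthogonal_diagonalisation symS.
have d0 i : 0 <= d 0 i.
  have -> : d 0 i = enorm (A *m O *m delta_mx i 0) ^+ 2.
    rewrite enorm_sqE !trmx_mul !mulmxA -(mulmxA _ A^T A) -(mulmxA _ O^T).
    rewrite -(mulmxA _ (O^T *m _) O) dE quadratic_diag (bigD1 i)//= big1.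
      by rewrite mxE !eqxx expr1n mulr1 addr0.
    by move=> j ji; rewrite mxE (negbTE ji) expr0n/= mulr0.
  exact: sqr_ge0.
pose i0 := [arg max_(i > 0) d 0 i]%O.
have i0_max i : d 0 i <= d 0 i0.
  by rewrite /i0; case: arg_maxP => // j _; exact.
pose s := tperm 0 i0 : 'S_n.+1.
exists (O *m perm_mx s).
  by apply: gauss_orthogonalM => //; exact: gauss_orthogonal_perm.
exists (\row_i d 0 (s i)); last by move=> i; rewrite !mxE d0 tpermL i0_max.
rewrite trmx_mul !mulmxA -(mulmxA _ A^T A) -(mulmxA _ O^T) -(mulmxA _ (O^T *m _) O) dE.
have sV : (s^-1)%g = s by exact: tpermV.
rewrite tr_perm_mx sV -{2}sV -col_permE -row_permE.
apply/matrixP => i j; rewrite !mxE.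
by rewrite (inj_eq perm_inj).
Qed.

Section coordinates.
Context m n (A : 'M[R]_(m, n.+1)) (O : 'M[R]_n.+1) (d : 'rV[R]_n.+1).
Hypotheses (oO : O^T *m O = 1%:M) (dE : O^T *m (A^T *m A) *m O = diag_mx d)
  (dle : forall i, 0 <= d 0 i <= d 0 0).

Let oO' : O *m O^T = 1%:M. Proof. exact: mulmx1C. Qed.

Lemma enorm_gram1 y : enorm (A *m (O *m y)) ^+ 2 = \sum_i d 0 i * y i 0 ^+ 2.
Proof.
rewrite -quadratic_diag -dE enorm_sqE !trmx_mul !mulmxA.
by rewrite -!mulmxA.
Qed.

Lemma enorm_gram2 y :
  enorm (A^T *m A *m (O *m y)) ^+ 2 = \sum_i d 0 i ^+ 2 * y i 0 ^+ 2.
Proof.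
have -> : A^T *m A *m (O *m y) = O *m (diag_mx d *m y).
  by rewrite -dE !mulmxA oO' mul1mx.
rewrite enorm_sqE trmx_mul -mulmxA (mulmxA O^T) oO mul1mx -enorm_sqE enorm_sq.
by apply: eq_bigr => i _; rewrite mul_diag_mx mxE exprMn.
Qed.

Lemma frobenius_gram : frobenius A ^+ 2 = \sum_i d 0 i.
Proof.
rewrite frobenius_sq -mxtrace_diag -dE [RHS]mxtrace_mulC (mulmxA O) oO' mul1mx.
by [].
Qed.

Lemma spectral_norm_gram : spectral_norm A = Num.sqrt (d 0 0).
Proof.
have d0 : 0 <= d 0 0 by case/andP: (dle 0).
have ubA x : enorm x <= 1 -> enorm (A *m x) <= Num.sqrt (d 0 0).
  move=> x1; rewrite -[enorm _]ger0_norm ?enorm_ge0// -sqrtr_sqr ler_wsqrtr//.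
  rewrite -[x]mul1mx -oO' -mulmxA enorm_gram1.
  apply: (@le_trans _ _ (d 0 0 * enorm (O^T *m x) ^+ 2)).
    rewrite enorm_sq mulr_sumr; apply: ler_sum => i _.
    by rewrite ler_wpM2r ?sqr_ge0//; case/andP: (dle i).
  rewrite ler_piMr// enorm_sqE trmx_mul trmxK -mulmxA (mulmxA O) oO' mul1mx -enorm_sqE.
  by rewrite -(expr1n _ 2) lerXn2r ?nnegrE ?enorm_ge0.
apply/le_anti/andP; split.
  apply: ge_sup; last by move=> _ [x x1 <-]; exact: ubA.
  exists (enorm (A *m 0)); exists 0 => //=.
  by rewrite /enorm big1 ?sqrtr0// => i _; rewrite mxE expr0n.
apply: ub_le_sup; first by exists (Num.sqrt (d 0 0)) => _ [x x1 <-]; exact: ubA.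
have e1 (f : 'I_n.+1 -> R) : \sum_i f i * (delta_mx 0 0 : 'cV[R]_n.+1) i 0 ^+ 2 = f 0.
  rewrite (bigD1 0)//= big1 ?mxE ?eqxx ?expr1n ?mulr1 ?addr0// => i i0.
  by rewrite mxE (negbTE i0) expr0n mulr0.
exists (O *m delta_mx 0 0).
  rewrite /=; have -> : enorm (O *m delta_mx 0 0 : 'cV[R]_n.+1) = Num.sqrt 1; last by rewrite sqrtr1.
  rewrite -[LHS]ger0_norm ?enorm_ge0// -sqrtr_sqr; congr Num.sqrt.
  rewrite enorm_sqE trmx_mul -mulmxA (mulmxA O^T) oO mul1mx -enorm_sqE enorm_sq.
  by rewrite -[RHS](e1 (fun=> 1)); apply: eq_bigr => i _; rewrite mul1r.
rewrite -[LHS]ger0_norm ?enorm_ge0// -sqrtr_sqr; congr Num.sqrt.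
by rewrite enorm_gram1 e1.
Qed.

End coordinates.

End spectrum.

(** * Reduction to quadratic forms and conclusion *)

Section assembly.
Context {R : realType}.
Local Notation RB := (measurableTypeR R).
Local Notation gauss := (normal_prob (0 : R) 1).

(** Clearing the denominator. The second inequality matters only when
    [A *m x1 = 0], and is implied by the first one otherwise. *)
Lemma Tcb_leE m n (A : 'M[R]_(m, n)) (theta N : R) (x1 x2 : 'cV[R]_n) :
  0 < theta -> 0 <= N ->
  (Tcb A theta x1 x2 <= N) <->
  (enorm (A^T *m A *m x1) ^+ 2 <=
     ((N / theta) ^+ 2 - enorm (A *m x2) ^+ 2) * enorm (A *m x1) ^+ 2 /\
   enorm (A *m x2) ^+ 2 <= (N / theta) ^+ 2).
Proof.
move=> theta0 N0; rewrite /Tcb -ler_pdivlMl// [theta^-1 * N]mulrC.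
have K0 : 0 <= N / theta by rewrite divr_ge0// ltW.
rewrite -[X in (_ <= X) <-> _](ger0_norm K0) -sqrtr_sqr ler_sqrt ?sqr_ge0//.
set K := (N / theta) ^+ 2; rewrite expr_div_n; set D := enorm (A *m x1).
set n1 := enorm (A^T *m A *m x1) ^+ 2; set q := enorm (A *m x2) ^+ 2.
have [D0|D0] := eqVneq D 0.
  have Ax0 := enorm_eq0 D0.
  have -> : n1 = 0.
    rewrite /n1 -mulmxA Ax0 mulmx0 enorm_sq big1// => i _.
    by rewrite mxE expr0n.
  by rewrite D0 expr0n/= mul0r mulr0 add0r; split => [//|[]].
have D2 : 0 < D ^+ 2 by rewrite lt0r sqr_ge0 sqrf_eq0 D0.
rewrite -lerBrDr ler_pdivrMr//; split => [h|[]//]; split => //.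
rewrite -subr_ge0 -(pmulr_lge0 _ D2); apply: le_trans h; exact: sqr_ge0.
Qed.

Lemma measurable_enorm_sq m n (B : 'M[R]_(m, n)) :
  measurable_fun setT (fun t : n.-tuple RB => enorm (B *m vec (t : n.-tuple R)) ^+ 2).
Proof.
under eq_fun do rewrite enorm_sq.
apply: measurable_sum => i; apply: measurable_funX.
under eq_fun do rewrite mxE.
apply: measurable_sum => j; apply: measurable_funM => //.
under eq_fun do rewrite mxE.
exact: measurable_tnth.
Qed.

Lemma gauss_orthogonal_preimage n (O : 'M[R]_n) (B : set (n.-tuple RB)) :
  gauss_orthogonal O -> measurable B ->
  gauss_tuple n (act O @^-1` B) = gauss_tuple n B.
Proof.
move=> [_ I] mB; have mO := measurable_act O.
have mOB : measurable (act O @^-1` B) by rewrite -[X in measurable X]setTI; exact: mO.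
rewrite -[LHS]mul1e -[RHS]mul1e (mule_measure_indic (gauss_tuple n) mOB)//.
rewrite (mule_measure_indic (gauss_tuple n) mB)//.
rewrite -(I (fun t => (1 * \1_B t)%:E))//.
apply/measurable_EFinP/measurable_funM => //; exact: measurable_indic.
Qed.

Lemma qform_vec n (e : 'I_n -> R) (t : n.-tuple RB) :
  qform e t = \sum_i e i * (vec (t : n.-tuple R)) i 0 ^+ 2.
Proof. by apply: eq_bigr => i _; rewrite mxE. Qed.

(** In the eigencoordinates, with eigenvalues normalised by the largest one [e 0 0], and
    given the second vector, the event bounds the ratio of quadratic forms of the first
    vector by [theta ^- 2] minus the form [l] of the second one. *)
Lemma Tcb_probability_le d (T : measurableType d) (P : probability T R) m n
    (A : 'M[R]_(m, n.+1)) (X1 X2 : {RV P >-> n.+1.-tuple R}) (theta : R)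
    (O : 'M[R]_n.+1) (e : 'rV[R]_n.+1) :
  std_gaussian_vector X1 -> std_gaussian_vector X2 -> independent_RV X1 X2 ->
  1 <= theta -> gauss_orthogonal O -> O^T *m (A^T *m A) *m O = diag_mx e ->
  (forall i, 0 <= e 0 i <= e 0 0) -> 0 < e 0 0 ->
  let l i := e 0 i / e 0 0 in
  (P [set w | (Tcb A theta (vec (X1 w)) (vec (X2 w)) <= spectral_norm A)%R] <=
   \int[gauss_tuple n.+1]_t
     ratio_cdf (\sum_i l (lift ord0 i))%R (theta ^- 2 - qform l t))%E.
Proof.
move=> G1 G2 I12 theta1 gO eE ele e00; cbv zeta; pose l i := e 0 i / e 0 0.
rewrite -/l.
have theta0 : 0 < theta by exact: lt_le_trans theta1.
have oO := gO.1.
pose K := (spectral_norm A / theta) ^+ 2.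
have KE : K = e 0 0 * theta ^- 2.
  by rewrite /K (spectral_norm_gram oO eE ele) expr_div_n sqr_sqrtr// ltW.
have l01 i : 0 <= l i <= 1.
  by rewrite /l ler_pdivlMr// mul0r ler_pdivrMr// mul1r.
have l0 i : 0 <= l i by case/andP: (l01 i).
have l1 : l ord0 = 1 by rewrite /l divff// gt_eqF.
have eiE i : e 0 i = e 0 0 * l i by rewrite /l mulrC divfK// gt_eqF.
have tau1 : theta ^- 2 <= 1 by rewrite invf_le1 ?exprn_gt0// exprn_ege1.
pose nA (t : n.+1.-tuple RB) := enorm (A *m vec (t : n.+1.-tuple R)) ^+ 2.
pose nS (t : n.+1.-tuple RB) := enorm (A^T *m A *m vec (t : n.+1.-tuple R)) ^+ 2.
have mnA : measurable_fun setT nA by exact: measurable_enorm_sq.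
have mnS : measurable_fun setT nS by exact: measurable_enorm_sq.
pose E : set (n.+1.-tuple RB * n.+1.-tuple RB) :=
  [set z | nS z.2 - (K - nA z.1) * nA z.2 <= 0] `&` [set z | nA z.1 <= K].
have mE : measurable E.
  have m1 : measurable_fun setT (fun z : n.+1.-tuple RB * n.+1.-tuple RB => nA z.1).
    by apply: (measurableT_comp mnA); exact: measurable_fst.
  have m2 : measurable_fun setT (fun z : n.+1.-tuple RB * n.+1.-tuple RB => nA z.2).
    by apply: (measurableT_comp mnA); exact: measurable_snd.
  have m3 : measurable_fun setT (fun z : n.+1.-tuple RB * n.+1.-tuple RB => nS z.2).
    by apply: (measurableT_comp mnS); exact: measurable_snd.
  apply: measurableI; last exact: measurable_sub_le.
  apply: measurable_sub_le; apply: measurable_funB => //.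
  by apply: measurable_funM => //; exact: measurable_funB.
have -> : [set w | Tcb A theta (vec (X1 w)) (vec (X2 w)) <= spectral_norm A] =
    [set w | E (X2 w, X1 w)].
  have N0 : 0 <= spectral_norm A by rewrite (spectral_norm_gram oO eE ele) sqrtr_ge0.
  apply/seteqP; split => w /=.
    by move=> /(Tcb_leE _ _ _ theta0 N0)[h1 h2]; split; rewrite /E/= ?subr_le0.
  move=> [h1 h2]; apply/(Tcb_leE _ _ _ theta0 N0); split => //.
  by rewrite -subr_le0.
rewrite (independent_gaussian_law G1 G2 I12 mE).
have mx t : measurable (xsection E t) by exact: measurable_xsection.
have mF : measurable_fun setT (fun t => gauss_tuple n.+1 (xsection E t)).
  exact: measurable_fun_xsection.
rewrite -(gO.2 _ mF (fun=> measure_ge0 _ _)).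
apply: ge0_le_integral.
- exact: measurableT.
- by move=> t _; exact: measure_ge0.
- by apply: (measurableT_comp mF); exact: measurable_act.
- exact: measurable_ratio_cdf_comp (measurable_qform _).
move=> t _; have mxt := mx (act O t).
rewrite -(gauss_orthogonal_preimage gO mxt).
have ut : theta ^- 2 - qform l t <= 1.
  by rewrite lerBlDr (le_trans tau1)// lerDl qform_ge0.
apply: le_trans (qform_ratio_le l0 l1 ut).
apply: le_measure; rewrite ?inE; [|exact: measurable_qform_le|].
  by rewrite -[X in measurable X]setTI; apply: measurable_act.
have nAE y : nA (act O y) = e 0 0 * qform l y.
  rewrite /nA /act vecK (enorm_gram1 eE) qform_vec mulr_sumr.
  by apply: eq_bigr => i _; rewrite eiE mulrA.
have nSE y : nS (act O y) = e 0 0 ^+ 2 * qform (fun i => l i ^+ 2) y.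
  rewrite /nS /act vecK (enorm_gram2 oO eE) qform_vec mulr_sumr.
  by apply: eq_bigr => i _; rewrite eiE exprMn mulrA.
move=> y; rewrite /= /xsection/= inE => -[/= h _].
move: h; rewrite nSE !nAE KE -mulrBr mulrACA -expr2 -mulrBr.
move: (theta ^- 2 - qform l t) => u.
have -> : qform (fun i => l i ^+ 2 - u * l i) y =
    qform (fun i => l i ^+ 2) y - u * qform l y.
  rewrite /qform mulr_sumr -sumrB; apply: eq_bigr => i _.
  by rewrite mulrBl -(mulrA u).
by rewrite pmulr_rle0// exprn_gt0.
Qed.

End assembly.

Theorem theorem1 (R : realType) (d : measure_display) (T : measurableType d)
    (P : probability T R) (m n : nat) (A : 'M[R]_(m, n))
    (X1 X2 : {RV P >-> n.-tuple R}) (theta : R) :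
  A != 0 ->
  std_gaussian_vector X1 -> std_gaussian_vector X2 -> independent_RV X1 X2 ->
  1 <= theta ->
  let rho := effective_rank A in
  let p := P [set w | Tcb A theta (vec (X1 w)) (vec (X2 w))
                      <= spectral_norm A] in
  [/\ 7 <= rho -> (p <= (g_high theta)%:E)%E,
      1 + theta ^- 2 <= rho <= 7 -> (p <= g_mid theta rho)%E
    & 1 <= rho < 1 + theta ^- 2 -> (p <= g_low theta rho)%E].
Proof.
case: n A X1 X2 => [A X1 X2|n A X1 X2]; first by rewrite thinmx0 eqxx.
move=> A0 G1 G2 I12 theta1 rho p.
have theta0 : 0 < theta by exact: lt_le_trans theta1.
have [ O gO [e eE ele]] := gram_diagonalisation A.
have frobE := frobenius_gram gO.1 eE.
have e00 : 0 < e 0 0.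
  rewrite lt0r (andP (ele 0)).1 andbT; apply: contraNneq A0 => e0.
  have ei i : e 0 i = 0 by have := ele i; rewrite e0 => h; apply/le_anti; rewrite andbC.
  rewrite big1 // in frobE; move: frobE.
  rewrite sqr_sqrtr; last by do 2 (apply: sumr_ge0 => ? _); exact: sqr_ge0.
  move/eqP; rewrite psumr_eq0; last by move=> i _; apply: sumr_ge0 => ? _; exact: sqr_ge0.
  move=> /allP h; apply/eqP/matrixP => i j; have := h i (mem_index_enum _).
  rewrite psumr_eq0; last by move=> ? _; exact: sqr_ge0.
  by move=> /allP /(_ j (mem_index_enum _)); rewrite sqrf_eq0 mxE => /eqP.
pose l i := e 0 i / e 0 0.
have l01 i : 0 <= l i <= 1 by rewrite /l ler_pdivlMr// mul0r ler_pdivrMr// mul1r.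
have l0 i : 0 <= l i by case/andP: (l01 i).
have l1 : l ord0 = 1 by rewrite /l divff// gt_eqF.
pose r := \sum_i l (lift ord0 i).
have r0 : 0 <= r by exact: sumr_ge0.
have rhoE : rho = \sum_i l i.
  rewrite /rho /effective_rank frobE (spectral_norm_gram gO.1 eE ele).
  by rewrite sqr_sqrtr ?(ltW e00)// mulr_suml.
have rhor : rho = 1 + r by rewrite rhoE big_ord_recl l1.
have tau01 : 0 < theta ^- 2 <= 1.
  by rewrite invr_gt0 exprn_gt0//= invf_le1 ?exprn_gt0// exprn_ege1.
have pE : (p <= \int[gauss_tuple n.+1]_t ratio_cdf r (theta ^- 2 - qform l t))%E.
  exact: (Tcb_probability_le G1 G2 I12 theta1 gO eE ele e00).
split => [rho7|/andP[rho1 rho7]|/andP[rho1 rho2]]; apply: (le_trans pE).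
- rewrite (_ : g_high theta = (theta ^- 2) ^+ 2 / 8).
    by apply: high_bound => //; rewrite -rhoE.
  by rewrite /g_high exprVn -exprM.
- have r1 : rho - 1 = r by rewrite rhor addrAC subrr add0r.
  have := integral_chi2_pdf r0 r0 ltr01 tau01; rewrite mul1e => H.
  rewrite /g_mid r1 (_ : (\int[lebesgue_measure]_(_ in _) _)%E =
    (\int[lebesgue_measure]_(t in `[0%R, (theta ^- 2)%R])
     (chi2_cdf 0 (r * t / (1 - t)) * chi2_pdf r ((theta ^- 2 - t) / 1)))%E).
    have tr : theta ^- 2 <= r by lra.
    rewrite H; apply: (le_trans (mid_bound l0 l1 tr)).
    rewrite le_eqVlt; apply/orP; left; apply/eqP; apply: eq_integral => y _.
    by apply: eq_integral => z _; rewrite mul1r.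
  by apply: eq_integral => t _; rewrite divr1.
- have r1 : rho - 1 = r by rewrite rhor addrAC subrr add0r.
  have rho0 : 0 < rho by lra.
  have := integral_chi2_pdf (lexx 0) r0 rho0 tau01 => H.
  rewrite /g_low r1 H rhor.
  apply: (le_trans (low_bound _ l0 l1)).
  rewrite -/r le_eqVlt; apply/orP; left; apply/eqP; congr (_ * _)%E.
  apply: eq_integral => y _.
  have fin : ratio_cdf r (theta ^- 2 - (1 + r) * (y : R) ^+ 2) \is a fin_num.
    by apply: fin_num_measure; exact: measurable_ratio.
  rewrite -[LHS](fineK fin) -[LHS](integral_probability_cst (normal_prob (0 : R) 1)).
  by apply: eq_integral => z _; rewrite mul0r addr0 fineK.
Qed.
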